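(* Let $V=(V,|0\rangle,T,S^i,Y)$ be an $N_W=N$ SUSY vertex algebra over $k$. For $n\in\mathbb Z$ let $E_n=E_n(V)$ be the linear sub-superspace $$E_n=\mathrm{span}\Big\{a^1_{(-1-k_1|K_1)}\cdots a^r_{(-1-k_r|K_r)}b \;\Big|\; r\in\mathbb Z_{>0},\ a^i,b\in V,\ k_i\in\mathbb N,\ K_i\subset[N],\ k_1+\dots+k_r\ge n\Big\},$$ which form a decreasing filtration $\cdots=E_{-1}=E_0=V\supset E_1\supset E_2\supset\cdots\supset E_n\supset\cdots$. Then the associated graded space $$\mathrm{gr}_E V=\bigoplus_{n\in\mathbb N}E_n/E_{n+1}$$ has the following structure $(\cdot,1,\partial,\delta^i,Y_-)$ of an $N_W=N$ SUSY vertex Poisson algebra, where $a\in E_r$ and $b\in E_s$: (i) the commutative multiplication is $(a+E_{r+1})\cdot(b+E_{s+1})=a_{(-1|N)}b+E_{r+s+1}$; (ii) the unit is $1=|0\rangle+E_1$; (iii) the even operator $\partial$ is $\partial(a+E_{r+1})=Ta+E_{r+2}$; (iv) the odd operator $\delta^i$ for $i\in[N]$ is $\delta^i(a+E_{r+1})=S^ia+E_{r+2}$; (v) the SUSY vertex Lie algebra structure is $$Y_-(a+E_{r+1},Z)(b+E_{s+1})=\sum_{j\ge0,\ J\subset[N]}Z^{-1-j|[N]\setminus J}\,\big(a_{(j|J)}b+E_{r+s-j+1}\big).$$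
   Context: Setting. $k$ is a field of characteristic $0$, $N$ a positive integer, $[N]=\{1<\dots<N\}$; subsets $J\subset[N]$ are ordered increasingly; $\mathbb N=\mathbb Z_{\ge0}$. A linear superspace is a $\mathbb Z/2$-graded $k$-vector space, $p(v)$ is the parity of an element $v$ of pure parity, and $[x,y]=xy-(-1)^{p(x)p(y)}yx$ is the supercommutator. A $1|N$-supervariable $Z=(z,\zeta^1,\dots,\zeta^N)$ consists of an even $z$ and odd $\zeta^i$, all supercommuting; $Z^{j|J}=z^j\zeta^{j_1}\cdots\zeta^{j_r}$ for $j\in\mathbb Z$, $J=\{j_1<\dots<j_r\}$. $V((Z))$ is the space of series $\sum_{j,J}Z^{j|J}v_{j|J}$ with $v_{j|J}=0$ for $j\ll0$, and $V[[Z]]$ that of series with only $j\ge0$. An $\mathrm{End}(V)$-valued superfield is a series $a(Z)=\sum_{j\in\mathbb Z,J\subset[N]}Z^{-1-j|[N]\setminus J}a_{(j|J)}$, $a_{(j|J)}\in\mathrm{End}(V)$, with $a(Z)v\in V((Z))$ for all $v\in V$. We write $a_{(j|N)}$ for $a_{(j|[N])}$. An $N_W=N$ SUSY vertex algebra is a tuple $(V,|0\rangle,T,S^i,Y)$ with $V$ a linear superspace, $|0\rangle\in V$ even, $T\in\mathrm{End}(V)$ even, $S^i\in\mathrm{End}(V)$ odd ($i\in[N]$), and $Y(\cdot,Z)$ an even linear map from $V$ to $\mathrm{End}(V)$-valued superfields, $Y(a,Z)=\sum Z^{-1-j|[N]\setminus J}a_{(j|J)}$, such that: (vacuum) $Y(a,Z)|0\rangle=a+O(Z)$,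 where $O(Z)$ is an element of $V[[Z]]$ vanishing at $z=\zeta^i=0$, and $T|0\rangle=S^i|0\rangle=0$; (translation) $[T,Y(a,Z)]=\partial_zY(a,Z)$, $[S^i,Y(a,Z)]=\partial_{\zeta^i}Y(a,Z)$; (locality) for all $a,b$ there is $n\in\mathbb N$ with $(z-w)^n[Y(a,Z),Y(b,W)]=0$. It is commutative if $[Y(a,Z),Y(b,W)]=0$ for all $a,b$; then $V$ is a commutative superalgebra with product $ab=a_{(-1|N)}b$, unit $|0\rangle$, even derivation $T$ and odd derivations $S^i$, and $Y(a,Z)b=(e^{zT}(1+\zeta^1S^1)\cdots(1+\zeta^NS^N)a)\cdot b$, so the structure is determined by $(\cdot,1,T,S^i)$. For a series $f=\sum Z^{j|J}v_{j|J}$ put $\mathrm{Sing}(f)=\sum_{j<0,J}Z^{j|J}v_{j|J}$, and let $Z^{-1}V[Z^{-1}]$ be the space of sums $\sum_{j<0,J}Z^{j|J}v_{j|J}$. An $N_W=N$ SUSY vertex Lie algebra is $(V,T,S^i,Y_-)$ with $V$ a linear superspace, $T$ an even and $S^i$ ($i\in[N]$) odd operators, and an even linear map $Y_-(\cdot,Z):V\to\mathrm{Hom}(V,Z^{-1}V[Z^{-1}])$, $Y_-(a,Z)=\sum_{m\ge0,M}Z^{-m-1|[N]\setminus M}a_{(m|M)}$, such that, with $Z\nabla=zT+\sum_i\zeta^iS^i$: (1) $Y_-(Ta,Z)=\partial_zY_-(a,Z)$, $Y_-(S^ia,Z)=\partial_{\zeta^i}Y_-(a,Z)$; (2) $Y_-(a,Z)b=\mathrm{Sing}\big((-1)^{p(a)p(b)}e^{Z\nabla}Y_-(b,-Z)a\big)$;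 (3) $[a_{(m|M)},Y_-(b,Z)]=\mathrm{Sing}\big(Y_-(e^{-Z\nabla}a_{(m|M)}e^{Z\nabla}b,Z)\big)$. An $N_W=N$ SUSY vertex Poisson algebra is $(V,|0\rangle,T,S^i,Y_+,Y_-)$ where $(V,|0\rangle,T,S^i,Y_+)$ is a commutative $N_W=N$ SUSY vertex algebra, $(V,T,S^i,Y_-)$ is an $N_W=N$ SUSY vertex Lie algebra, and $Y_-$ is a derivation for the commutative product $ab=a_{(-1|N)}b$ coming from $Y_+$: for $a,b,c\in V$ of pure parity, $$Y_-(a,Z)(bc)=\big(Y_-(a,Z)b\big)c+(-1)^{(p(a)+N)p(b)}\,b\big(Y_-(a,Z)c\big).$$ Classes $a_{(j|J)}b+E_{m+1}\in E_m/E_{m+1}$ with $m<0$ are zero (as $E_m=V$ for $m\le0$).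
   Formalization: In (iv), δ^i(a+E_{r+1}) is taken as S^i a + E_{r+1}, since S^i a need not lie in E_{r+1}; in the Leibniz rule, b acts on the term Z^{-1-j|[N]\J} with sign (-1)^{p(b)|J|}, as the Koszul sign fails for odd N. *)

(* Defs.v *)
From HB Require Import structures.
From mathcomp Require Export all_boot all_order all_algebra.
From mathcomp Require Export boolp classical_sets functions cardinality fsbigop.

Set Implicit Arguments.
Unset Strict Implicit.
Unset Printing Implicit Defensive.

Import GRing.Theory.
Local Open Scope ring_scope.
Local Open Scope classical_set_scope.

(* [par p] is the set of vectors of pure parity [p], with [false] = even and
   [true] = odd.  The sum of two parities is [(+)] and their product is [&&].
   As in the usual sign rule, formulas containing the parity of a vector are
   stated for vectors of pure parity only. *)

Section Super.
Variables (k : fieldType) (V : lmodType k).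

Definition subspace (A : set V) : Prop :=
  A 0 /\ forall (c : k) (u v : V), A u -> A v -> A (c *: u + v).

Definition span (A : set V) : set V :=
  [set v | exists s : seq (k * V),
     (forall t, t \in s -> A t.2) /\ v = \sum_(t <- s) t.1 *: t.2].

Record superspace (par : bool -> set V) : Prop := Superspace {
  super_sub  : forall p, subspace (par p);
  super_sum  : forall v, exists v0 v1, [/\ par false v0, par true v1 & v = v0 + v1];
  super_disj : forall v, par false v -> par true v -> v = 0
}.

Definition subsuperspace (par : bool -> set V) (A : set V) : Prop :=
  subspace A /\
  forall v, A v -> exists v0 v1,
    [/\ A v0 /\ par false v0, A v1 /\ par true v1 & v = v0 + v1].

Definition pure_op (par : bool -> set V) (p : bool) (f : V -> V) : Prop :=
  forall q v, par q v -> par (p (+) q) (f v).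

End Super.

(* A series f = sum_(j,J) Z^{j|J} f_{j|J} is the family of its coefficients,
   written to the right of the monomials.  A series in two supervariables
   (Z, W) is a Z-series of W-series, with monomials written Z^{j|J} W^{l|L}. *)
Definition fseries (N : nat) (U : Type) : Type := int -> {set 'I_N} -> U.

Section Series.
Variables (k : fieldType) (N : nat) (U : lmodType k).
Implicit Types (f : fseries N U) (j l : int) (J L : {set 'I_N}).

(* For J and L disjoint,
   zeta^J zeta^L = (-1) ^ (inversions J L) zeta^(J :|: L). *)
Definition inversions J L : nat :=
  #|[set x : 'I_N * 'I_N | [&& x.1 \in J, x.2 \in L & (x.2 < x.1)%N]]%SET|.

Definition monom_mul j J f : fseries N U := fun l L =>
  if J \subset L then (-1) ^+ inversions J (L :\: J) *: f (l - j) (L :\: J)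
  else 0.

Definition const_series (u : U) : fseries N U := fun j J =>
  if (j == 0) && (J == finset.set0) then u else 0.

Definition dz f : fseries N U := fun j J => (j + 1)%:~R *: f (j + 1) J.

(* The left derivative with respect to zeta^i. *)
Definition dzeta (i : 'I_N) f : fseries N U := fun j J =>
  if i \in J then 0 else (-1) ^+ inversions [set i]%SET J *: f j (i |: J)%SET.

(* f(-Z), where -Z = (-z, -zeta^1, ..., -zeta^N) *)
Definition subst_opp f : fseries N U := fun j J =>
  ((-1) ^ j * (-1) ^+ #|J|) *: f j J.

Definition sing f : fseries N U := fun j J => if j < 0 then f j J else 0.

Definition laurent f : Prop := exists n : int, forall j J, j < n -> f j J = 0.

(* Membership in Z^{-1} U[Z^{-1}]. *)
Definition singular_part f : Prop :=
  laurent f /\ forall j J, 0 <= j -> f j J = 0.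

(* exp(D) f = sum_n D^n f / n!.  A sum over [set: nat] is the sum of its
   nonzero terms when there are finitely many of them.  That is the case in
   each coefficient for the operators D = +-(zT + sum_i zeta^i S^i) below and
   Laurent series f, as all but at most N of the factors of D^n which
   contribute to a given term raise the exponent of z. *)
Definition exp_op (D : fseries N U -> fseries N U) f : fseries N U := fun j J =>
  \sum_(n \in [set: nat]) (n`!%:R : k)^-1 *: iter n D f j J.

End Series.

Definition mul_z_sub_w (k : fieldType) (N : nat) (U : lmodType k)
    (F : fseries N (fseries N U)) : fseries N (fseries N U) :=
  fun j J l L => F (j - 1) J l L - F j J (l - 1) L.

Section Operators.
Variables (k : fieldType) (N : nat) (V : lmodType k).
Implicit Types (A B : fseries N (V -> V)) (f : V -> V) (s : fseries N V).

Definition fapp A (v : V) : fseries N V := fun j J => A j J v.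

(* The coefficient a_(j|J) of Z^{-1-j|[N]\J}. *)
Definition mode A (j : int) (J : {set 'I_N}) : V -> V := A (-1 - j) (~: J)%SET.

(* The action on V-valued series of an operator [f] of parity [p]; the sign
   comes from moving [f] across the odd variables. *)
Definition op_act (p : bool) f s : fseries N V := fun j J =>
  (-1) ^+ (p && odd #|J|) *: f (s j J).

(* [f, A(Z)] v for an operator [f] of parity [p] and a superfield [A] of
   parity [q]; the coefficient of Z^{j|J} in [A] has parity q + |J|. *)
Definition op_comm p f q A (v : V) : fseries N V :=
  fun j J => op_act p f (fapp A v) j J - (-1) ^+ (p && q) *: A j J (f v).

(* [A(Z), B(W)] v = sum_(j,J) Z^{j|J} [A_{j|J}, B(W)] v *)
Definition field_comm p A q B (v : V) : fseries N (fseries N V) := fun j J =>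
  op_comm (p (+) odd #|J|) (A j J) q B v.

(* Z nabla = zT + sum_i zeta^i S^i *)
Definition Znabla (T : V -> V) (S : 'I_N -> V -> V) s : fseries N V := fun j J =>
  monom_mul 1 finset.set0 (op_act false T s) j J +
  \sum_(i < N) monom_mul 0 [set i]%SET (op_act true (S i) s) j J.

Definition exp_Znabla T S : fseries N V -> fseries N V :=
  exp_op (Znabla T S).
Definition exp_opp_Znabla T S : fseries N V -> fseries N V :=
  exp_op (fun s j J => - Znabla T S s j J).

(* e^{-Z nabla} f e^{Z nabla} b for an operator [f] of parity [p]. *)
Definition conj_Znabla T S p f (b : V) : fseries N V :=
  exp_opp_Znabla T S (op_act p f (exp_Znabla T S (const_series b))).

(* The terms of Y(x(Z), Z) v = sum_(i,I) Z^{i|I} Y(x_{i|I}, Z) v which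
   contribute to the coefficient of Z^{l|L}, grouped by the exponent i. *)
Definition subst_term (Y : V -> fseries N (V -> V)) (x : fseries N V) (v : V)
    (l : int) (L : {set 'I_N}) (i : int) : V :=
  \sum_(I : {set 'I_N}) monom_mul i I (fapp (Y (x i I)) v) l L.

Definition field_subst Y x v : fseries N V := fun l L =>
  \sum_(i \in [set: int]) subst_term Y x v l L i.

End Operators.

Section SUSY.
Variables (k : fieldType) (N : nat) (V : lmodType k) (par : bool -> set V).

Record susy_va (vac : V) (T : V -> V) (S : 'I_N -> V -> V)
    (Y : V -> fseries N (V -> V)) : Prop := SusyVA {
  va_super   : superspace par;
  va_vac_par : par false vac;
  va_T_lin   : linear T;
  va_T_par   : pure_op par false T;
  va_S_lin   : forall i, linear (S i);
  va_S_par   : forall i, pure_op par true (S i);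
  va_Y_lin   : forall (c : k) a b j J v,
                 Y (c *: a + b) j J v = c *: Y a j J v + Y b j J v;
  va_Y_end   : forall a j J, linear (Y a j J);
  va_Y_par   : forall p a, par p a ->
                 forall j (J : {set 'I_N}), pure_op par (p (+) odd #|J|) (Y a j J);
  va_Y_field : forall a v, laurent (fapp (Y a) v);
  va_vacuum  : forall a, (forall j J, j < 0 -> Y a j J vac = 0) /\
                         Y a 0 finset.set0 vac = a;
  va_T_vac   : T vac = 0;
  va_S_vac   : forall i, S i vac = 0;
  va_T_comm  : forall p a, par p a -> forall v,
                 op_comm false T p (Y a) v = dz (fapp (Y a) v);
  va_S_comm  : forall p a, par p a -> forall i v,
                 op_comm true (S i) p (Y a) v = dzeta i (fapp (Y a) v);
  va_local   : forall p a q b, par p a -> par q b -> exists n : nat,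
                 forall v, iter n (@mul_z_sub_w k N V)
                                (field_comm p (Y a) q (Y b) v) = fun _ _ _ _ => 0
}.

Definition susy_comm (Y : V -> fseries N (V -> V)) : Prop :=
  forall p a q b, par p a -> par q b -> forall v,
    field_comm p (Y a) q (Y b) v = fun _ _ _ _ => 0.

(* The product ab = a_(-1|[N]) b. *)
Definition susy_prod (Y : V -> fseries N (V -> V)) (a b : V) : V :=
  mode (Y a) (-1) [set: 'I_N]%SET b.

(* [vl_jacobi_fin] says that the right-hand side of [vl_jacobi] is well
   defined, i.e. that each of its coefficients is a finite sum.  Here
   a_(m|M) has parity p(a) + N - |M|. *)
Record susy_vla (T : V -> V) (S : 'I_N -> V -> V)
    (Ym : V -> fseries N (V -> V)) : Prop := SusyVLA {
  vl_super : superspace par;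
  vl_T_lin : linear T;
  vl_T_par : pure_op par false T;
  vl_S_lin : forall i, linear (S i);
  vl_S_par : forall i, pure_op par true (S i);
  vl_Y_lin : forall (c : k) a b j J v,
               Ym (c *: a + b) j J v = c *: Ym a j J v + Ym b j J v;
  vl_Y_end : forall a j J, linear (Ym a j J);
  vl_Y_par : forall p a, par p a ->
               forall j (J : {set 'I_N}), pure_op par (p (+) odd #|J|) (Ym a j J);
  vl_Y_sing : forall a v, singular_part (fapp (Ym a) v);
  vl_T     : forall a v, fapp (Ym (T a)) v = dz (fapp (Ym a) v);
  vl_S     : forall i a v, fapp (Ym (S i a)) v = dzeta i (fapp (Ym a) v);
  vl_skew  : forall p a q b, par p a -> par q b ->
    fapp (Ym a) b =
    sing (fun j J => (-1) ^+ (p && q) *: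
                     exp_Znabla T S (subst_opp (fapp (Ym b) a)) j J);
  vl_jacobi_fin : forall p a q b, par p a -> par q b ->
    forall (m : nat) (M : {set 'I_N}) v l L,
      finite_set [set i | subst_term Ym
        (conj_Znabla T S (p (+) odd #|(~: M)%SET|) (mode (Ym a) m M) b)
        v l L i != 0];
  vl_jacobi : forall p a q b, par p a -> par q b ->
    forall (m : nat) (M : {set 'I_N}) v,
      op_comm (p (+) odd #|(~: M)%SET|) (mode (Ym a) m M) q (Ym b) v =
      sing (field_subst Ym
        (conj_Znabla T S (p (+) odd #|(~: M)%SET|) (mode (Ym a) m M) b) v)
}.

(* In the Leibniz rule
     Y_-(a,Z)(bc) = (Y_-(a,Z)b)c + (-1)^{(p(a)+N)p(b)} b (Y_-(a,Z)c)
   the expansion Y_-(a,Z) = sum Z^{-1-j|[N]\J} a_(j|J) is regarded as a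
   generating function in the dual basis Z^{-1-j|[N]\J} of Z^{j|J}, which is of
   parity p(a)+N, and b is multiplied by
     b (sum Z^{-1-j|[N]\J} v_(j|J)) = sum (-1)^{p(b)|J|} Z^{-1-j|[N]\J} b v_(j|J).
   Thus the rule says that a_(j|J), of parity p(a)+N-|J|, is a superderivation.
   The sign (-1)^{p(b)(N-|J|)} here would, for odd N, contradict this. *)
Definition dual_lmul (mul : V -> V -> V) (q : bool) (b : V) (s : fseries N V) :
    fseries N V := fun j K =>
  (-1) ^+ (q && odd #|(~: K)%SET|) *: mul b (s j K).

Record susy_vpa (vac : V) (T : V -> V) (S : 'I_N -> V -> V)
    (Yp Ym : V -> fseries N (V -> V)) : Prop := SusyVPA {
  vp_va      : susy_va vac T S Yp;
  vp_comm    : susy_comm Yp;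
  vp_vla     : susy_vla T S Ym;
  vp_leibniz : forall p a q b r c, par p a -> par q b -> par r c ->
    fapp (Ym a) (susy_prod Yp b c) =
    fun j K => susy_prod Yp (fapp (Ym a) b j K) c +
               (-1) ^+ ((p (+) odd N) && q) *:
                 dual_lmul (susy_prod Yp) q b (fapp (Ym a) c) j K
}.

End SUSY.

Record filtration (k : fieldType) (V : lmodType k) := Filtration {
  fil :> int -> set V;
  fil_sub : forall n, subspace (fil n)
}.

Definition coset (k : fieldType) (V : lmodType k) (A : set V) (v : V) : set V :=
  [set x | A (x - v)].

(* An element of the direct sum of the E_n / E_{n+1}, n in nat: a family of
   cosets v + E_{n+1} with v in E_n, almost all equal to E_{n+1}. *)
Definition is_graded (k : fieldType) (V : lmodType k) (F : filtration V)
    (g : nat -> set V) : Prop :=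
  (forall n : nat, exists2 v, F n v & g n = coset (F n.+1) v) /\
  (exists m : nat, forall n, (m <= n)%N -> g n = coset (F n.+1) 0).

Record graded (k : fieldType) (V : lmodType k) (F : filtration V) := Graded {
  gval : nat -> set V;
  gvalP : is_graded F gval
}.

Section GradedModule.
Variables (k : fieldType) (V : lmodType k) (F : filtration V).

HB.instance Definition _ := gen_eqMixin (graded F).
HB.instance Definition _ := gen_choiceMixin (graded F).

Lemma subspace0 (A : set V) : subspace A -> A 0.
Proof. by case. Qed.

Lemma subspaceZ (A : set V) c u : subspace A -> A u -> A (c *: u).
Proof. by move=> [A0 AD] Au; rewrite -[_ *: _]addr0; apply: AD. Qed.

Lemma subspaceD (A : set V) u v : subspace A -> A u -> A v -> A (u + v).
Proof. by move=> [A0 AD] Au Av; rewrite -[u]scale1r; apply: AD. Qed.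

Lemma subspaceN (A : set V) u : subspace A -> A u -> A (- u).
Proof. by move=> sA Au; rewrite -scaleN1r; apply: subspaceZ. Qed.

Lemma coset_eq (A : set V) u v : subspace A -> coset A u = coset A v <-> A (u - v).
Proof.
move=> sA; split=> [e|Auv].
  have : coset A u u by rewrite /coset /= subrr; apply: subspace0.
  by rewrite e.
rewrite /coset; apply/seteqP; split=> x /= Ax.
  by rewrite (_ : x - v = (x - u) + (u - v)); [apply: subspaceD | rewrite addrA subrK].
rewrite (_ : x - u = (x - v) + - (u - v)); last by rewrite opprB addrA subrK.
by apply: subspaceD => //; apply: subspaceN.
Qed.

Lemma graded_eq (x y : graded F) : gval x = gval y -> x = y.
Proof. by case: x y => [g Pg] [h Ph] /= e; subst h; congr Graded; exact: Prop_irrelevance. Qed.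

(* A representative in E_n of the n-th component. *)
Definition grepr (x : graded F) (n : nat) : V :=
  sval (cid2 ((gvalP x).1 n)).

Lemma grepr_in x (n : nat) : F n (grepr x n).
Proof. by rewrite /grepr; case: cid2. Qed.

Lemma greprE x n : gval x n = coset (F n.+1) (grepr x n).
Proof. by rewrite /grepr; case: cid2. Qed.

Lemma grepr_fin x : exists m : nat, forall n, (m <= n)%N -> F n.+1 (grepr x n).
Proof.
have [m hm] := (gvalP x).2; exists m => n /hm; rewrite greprE.
by move/coset_eq; rewrite subr0; apply; exact: fil_sub.
Qed.

Lemma mk_graded_subproof (v : nat -> V) :
  (forall n : nat, F n (v n)) ->
  (exists m : nat, forall n, (m <= n)%N -> F n.+1 (v n)) ->
  is_graded F (fun n => coset (F n.+1) (v n)).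
Proof.
move=> vF [m hm]; split=> [n|]; first by exists (v n).
exists m => n /hm h; apply/coset_eq; first exact: fil_sub.
by rewrite subr0.
Qed.

Definition mk_graded v h1 h2 := Graded (@mk_graded_subproof v h1 h2).

Lemma gadd_in x y (n : nat) : F n (grepr x n + grepr y n).
Proof. by apply: subspaceD; [exact: fil_sub | exact: grepr_in | exact: grepr_in]. Qed.

Lemma gadd_fin x y :
  exists m : nat, forall n, (m <= n)%N -> F n.+1 (grepr x n + grepr y n).
Proof.
have [m1 h1] := grepr_fin x; have [m2 h2] := grepr_fin y.
exists (maxn m1 m2) => n; rewrite geq_max => /andP[/h1 ? /h2 ?].
by apply: subspaceD => //; exact: fil_sub.
Qed.

Definition gadd x y := mk_graded (gadd_in x y) (gadd_fin x y).

Lemma gscale_in c x (n : nat) : F n (c *: grepr x n).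
Proof. by apply: subspaceZ; [exact: fil_sub | exact: grepr_in]. Qed.

Lemma gscale_fin c x :
  exists m : nat, forall n, (m <= n)%N -> F n.+1 (c *: grepr x n).
Proof.
have [m h] := grepr_fin x; exists m => n /h ?.
by apply: subspaceZ => //; exact: fil_sub.
Qed.

Definition gscale c x := mk_graded (gscale_in c x) (gscale_fin c x).

Lemma gzero_in (n : nat) : F n 0.
Proof. exact: subspace0 (fil_sub _ _). Qed.

Lemma gzero_fin : exists m : nat, forall n, (m <= n)%N -> F n.+1 0.
Proof. by exists 0%N => n _; exact: subspace0 (fil_sub _ _). Qed.

Definition gzero := mk_graded gzero_in gzero_fin.

Definition gopp x := gscale (-1) x.

Lemma gaddE x y n u v :
  gval x n = coset (F n.+1) u -> gval y n = coset (F n.+1) v ->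
  gval (gadd x y) n = coset (F n.+1) (u + v).
Proof.
rewrite (greprE x) (greprE y).
move=> /(coset_eq _ _ (fil_sub F _)) xu /(coset_eq _ _ (fil_sub F _)) yv.
apply/coset_eq; first exact: fil_sub.
by rewrite opprD addrACA; apply: subspaceD => //; exact: fil_sub.
Qed.

Lemma gscaleE c x n u :
  gval x n = coset (F n.+1) u -> gval (gscale c x) n = coset (F n.+1) (c *: u).
Proof.
rewrite (greprE x) => /(coset_eq _ _ (fil_sub F _)) xu.
apply/coset_eq; first exact: fil_sub.
by rewrite -scalerBr; apply: subspaceZ => //; exact: fil_sub.
Qed.

Lemma gaddA : associative gadd.
Proof.
move=> x y z; apply: graded_eq; apply: funext => n.
rewrite (gaddE (greprE x n) (gaddE (greprE y n) (greprE z n))).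
by rewrite (gaddE (gaddE (greprE x n) (greprE y n)) (greprE z n)) addrA.
Qed.

Lemma gaddC : commutative gadd.
Proof.
move=> x y; apply: graded_eq; apply: funext => n.
by rewrite (gaddE (greprE x n) (greprE y n)) (gaddE (greprE y n) (greprE x n)) addrC.
Qed.

Lemma gadd0 : left_id gzero gadd.
Proof.
move=> x; apply: graded_eq; apply: funext => n.
by rewrite (@gaddE gzero x n 0 _ erefl (greprE x n)) add0r -greprE.
Qed.

Lemma gaddN : left_inverse gzero gopp gadd.
Proof.
move=> x; apply: graded_eq; apply: funext => n.
by rewrite (gaddE (gscaleE (-1) (greprE x n)) (greprE x n)) scaleN1r addNr.
Qed.

HB.instance Definition _ :=
  GRing.isZmodule.Build (graded F) gaddA gaddC gadd0 gaddN.

Lemma gscaleA a b (x : graded F) : gscale a (gscale b x) = gscale (a * b) x.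
Proof.
apply: graded_eq; apply: funext => n.
by rewrite (gscaleE _ (gscaleE _ (greprE x n))) (gscaleE _ (greprE x n)) scalerA.
Qed.

Lemma gscale1 : left_id 1 gscale.
Proof.
move=> x; apply: graded_eq; apply: funext => n.
by rewrite (gscaleE _ (greprE x n)) scale1r -greprE.
Qed.

Lemma gscaleDr : right_distributive gscale +%R.
Proof.
move=> c x y; apply: graded_eq; apply: funext => n.
rewrite (gscaleE _ (gaddE (greprE x n) (greprE y n))).
by rewrite (gaddE (gscaleE _ (greprE x n)) (gscaleE _ (greprE y n))) scalerDr.
Qed.

Lemma gscaleDl (x : graded F) : {morph gscale^~ x : a b / a + b}.
Proof.
move=> a b; apply: graded_eq; apply: funext => n.
rewrite (gscaleE _ (greprE x n)).
by rewrite (gaddE (gscaleE _ (greprE x n)) (gscaleE _ (greprE x n))) scalerDl.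
Qed.

HB.instance Definition _ :=
  GRing.Zmodule_isLmodule.Build k (graded F) gscaleA gscale1 gscaleDr gscaleDl.

(* [x] is the class v + E_{m+1} of an element v of E_m, placed in degree [m];
   it is zero if m < 0. *)
Definition is_class (x : graded F) (m : int) (v : V) : Prop :=
  F m v /\
  gval x = fun n : nat => coset (F n.+1) (if n%:Z == m then v else 0).

Definition graded_par (par : bool -> set V) (p : bool) : set (graded F) :=
  [set x | forall n : nat, exists v,
     [/\ F n v, par p v & gval x n = coset (F n.+1) v]].

End GradedModule.

Section SpanSubspace.
Variables (k : fieldType) (V : lmodType k).

Lemma span_subspace (A : set V) : subspace (span A).
Proof.
split=> [|c u v [s [sA ->]] [t [tA ->]]].
  by exists [::]; split=> //; rewrite big_nil.
exists ([seq (c * x.1, x.2) | x <- s] ++ t); split=> [x|].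
  by rewrite mem_cat => /orP[/mapP[y /sA Ay ->]|/tA].
rewrite big_cat big_map /= scaler_sumr; congr (_ + _).
by apply: eq_bigr => x _; rewrite scalerA.
Qed.

(* The products a^1_(-1-k_1|K_1) ... a^r_(-1-k_r|K_r) b with r > 0 and
   k_1 + ... + k_r >= n, for s the sequence of the (a^i, k_i, K_i). *)
Definition li_gens (N : nat) (Y : V -> fseries N (V -> V)) (n : int) : set V :=
  [set v | exists (s : seq (V * nat * {set 'I_N})) (b : V),
     [/\ (0 < size s)%N,
         n <= (\sum_(t <- s) t.1.2)%N%:Z &
         v = foldr (fun t u => mode (Y t.1.1) (-1 - t.1.2%:Z) t.2 u) b s]].

Definition li_filtration (N : nat) (Y : V -> fseries N (V -> V)) : filtration V :=
  Filtration (fun n => span_subspace (li_gens Y n)).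

End SpanSubspace.

(* Main.v *)
Require Import Defs.
From HB Require Import structures.
From mathcomp Require Import all_boot all_order all_algebra.
From mathcomp Require Import boolp classical_sets functions cardinality fsbigop.
From mathcomp Require Import zify ring.

Set Implicit Arguments.
Unset Strict Implicit.
Unset Printing Implicit Defensive.

Import Order.TTheory GRing.Theory Num.Theory.
Local Open Scope ring_scope.
Local Open Scope classical_set_scope.

(** Expanding the odd variables, [Y(a, Z) = Y((1 + zeta^1 S^1) ... (1 + zeta^N S^N) a, z)],
    where [Y(a, z)] is the value of [Y(a, Z)] at [zeta = 0].  So a SUSY vertex
    algebra is a vertex superalgebra with modes [a_(n)], together with [N]
    anticommuting odd derivations [S^i] which commute with [T]
    ([md_oddmono], [susy_va_modes]), and [E_n] is the filtration which Li
    attaches to this vertex superalgebra: as [S^i] is a derivation of all the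
    modes and preserves [E_0 = V], it preserves every [E_n].

    Locality yields the three identities on which the filtration depends:
    [commutator_formula], [skew_symmetry] and [associativity].  The first rests
    on Goddard's principle, that a family of operators which is local to all the
    fields and kills the vacuum is zero; skew-symmetry is the Taylor expansion
    of a solution of [T G = (d_z + d_w) G]; associativity follows from the other
    two and Vandermonde's identity.

    Moving a nonnegative mode through the generators of [E_n], and then
    induction by associativity, show that [a_(m)] with [a] in [E_r] maps [E_s]
    to [E_{r+s-m-1}], and to [E_{r+s-m}] when [m >= 0] ([li_nonneg_mode],
    [li_mode]).  The product and the brackets of [gr_E V] are therefore well
    defined.  In a vertex algebra commutativity, associativity and the Leibniz
    rule of the product [a_(-1) b] hold up to corrections; each correction
    contains one more nonnegative mode than the main terms, so it lies one step
    deeper in the filtration and vanishes in [gr_E V] ([gr_mulC], [gr_mulA],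
    [gr_leibniz]).  Skew-symmetry, the Jacobi identity and the rules for [T] and
    [S^i] are homogeneous and pass to classes as they stand.  Hence [gr_E V] is
    a vertex Poisson superalgebra with odd derivations ([gr_mode_vpa]).

    Such an object is in turn an [N_W = N] SUSY vertex Poisson algebra
    ([mode_vpa_susy]).  A series is determined by the values at [zeta = 0] of
    its derivatives in the [zeta^i].  The derivative [d/dzeta^i] turns both
    sides of the skew-symmetry axiom into the two sides of the same axiom with
    [a] replaced by [S^i a], and those of the Jacobi axiom into the same with
    [b] replaced by [S^i b].  Induction on the number of odd variables therefore
    reduces each axiom to [zeta = 0], where it is an identity between modes
    ([vpa_skew], [vpa_jacobi]). *)

(** * Linear identities and finite sums *)

(** The trivial extension of [k] by [V], a commutative ring with [V * V = 0].
    A linear identity between vectors is an identity in this ring, where it can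
    be decided by [ring]. *)
Definition sqzero (k : fieldType) (V : lmodType k) : Type := (k * V)%type.

Section SquareZero.
Variables (k : fieldType) (V : lmodType k).

HB.instance Definition _ := GRing.Zmodule.copy (sqzero V) (k * V)%type.

Definition sqz_mul (x y : sqzero V) : sqzero V :=
  (x.1 * y.1, x.1 *: y.2 + y.1 *: x.2).

Lemma sqz_mulA : associative sqz_mul.
Proof.
move=> x y z; congr pair; rewrite /= ?mulrA // !scalerDr !scalerA addrA.
by rewrite [z.1 * x.1]mulrC [z.1 * y.1]mulrC -!addrA; congr (_ + (_ + _ *: _)); rewrite mulrC.
Qed.

Lemma sqz_mulC : commutative sqz_mul.
Proof. by move=> x y; rewrite /sqz_mul mulrC addrC. Qed.

Lemma sqz_mul1 : left_id (1, 0) sqz_mul.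
Proof. by case=> x u; rewrite /sqz_mul /= mul1r scale1r scaler0 addr0. Qed.

Lemma sqz_mulDl : left_distributive sqz_mul +%R.
Proof.
move=> x y z; congr pair; rewrite /= ?mulrDl // scalerDl scalerDr.
by rewrite addrACA.
Qed.

Lemma sqz1_neq0 : (1, 0) != 0 :> sqzero V.
Proof. by apply/eqP => -[/eqP]; rewrite oner_eq0. Qed.

HB.instance Definition _ := GRing.Zmodule_isComNzRing.Build (sqzero V)
  sqz_mulA sqz_mulC sqz_mul1 sqz_mulDl sqz1_neq0.

Definition sqz_scal (c : k) : sqzero V := (c, 0).
Definition sqz_vect (v : V) : sqzero V := (0, v).

Lemma sqz_scal_additive : zmod_morphism sqz_scal.
Proof. by move=> c d; congr pair; rewrite subr0. Qed.
Lemma sqz_scal_monoid : monoid_morphism sqz_scal.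
Proof. by split=> // c d; congr pair; rewrite !scaler0 addr0. Qed.
HB.instance Definition _ := GRing.isZmodMorphism.Build k (sqzero V) sqz_scal sqz_scal_additive.
HB.instance Definition _ := GRing.isMonoidMorphism.Build k (sqzero V) sqz_scal sqz_scal_monoid.

Lemma sqz_vect_additive : zmod_morphism sqz_vect.
Proof. by move=> u v; congr pair; rewrite subr0. Qed.
HB.instance Definition _ := GRing.isZmodMorphism.Build V (sqzero V) sqz_vect sqz_vect_additive.

Lemma sqz_vectD u v : sqz_vect (u + v) = sqz_vect u + sqz_vect v.
Proof. exact: raddfD. Qed.

Lemma sqz_vectN u : sqz_vect (- u) = - sqz_vect u.
Proof. exact: raddfN. Qed.

Lemma sqz_vect0 : sqz_vect 0 = 0.
Proof. exact: raddf0. Qed.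

Lemma sqz_vectZ c v : sqz_vect (c *: v) = sqz_scal c * sqz_vect v.
Proof. by congr pair; rewrite /= ?mulr0 // scaler0 addr0. Qed.

Lemma sqz_vect_inj : injective sqz_vect.
Proof. by move=> u v []. Qed.

End SquareZero.

Ltac linear_ring :=
  apply: sqz_vect_inj;
  rewrite ?(sqz_vectD, sqz_vectN, sqz_vect0, sqz_vectZ);
  ring.

Section LinearMaps.
Variables (k : fieldType) (U W : lmodType k) (f : U -> W).
Hypothesis f_lin : linear f.

Lemma lin0 : f 0 = 0.
Proof. by have := f_lin (-1) 0 0; rewrite !scaleN1r !addNr. Qed.

Lemma linD u v : f (u + v) = f u + f v.
Proof. by rewrite -[u]scale1r f_lin !scale1r. Qed.

Lemma linZ c u : f (c *: u) = c *: f u.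
Proof. by rewrite -[c *: u]addr0 f_lin lin0 addr0. Qed.

Lemma linN u : f (- u) = - f u.
Proof. by rewrite -scaleN1r linZ scaleN1r. Qed.

Lemma linB u v : f (u - v) = f u - f v.
Proof. by rewrite linD linN. Qed.

Lemma lin_sum (I : Type) (r : seq I) (P : pred I) (F : I -> U) :
  f (\sum_(i <- r | P i) F i) = \sum_(i <- r | P i) f (F i).
Proof. by apply: (big_morph f linD lin0). Qed.

End LinearMaps.

Section IterLinear.
Variables (k : fieldType) (U : lmodType k) (f : U -> U).
Hypothesis f_lin : linear f.

Lemma iter_lin n : linear (iter n f).
Proof. by elim: n => [|n IH] c u v //=; rewrite IH f_lin. Qed.

End IterLinear.

Section Sums.
Variables (k : fieldType) (U : lmodType k).

Lemma sum_trunc (f : nat -> U) L L' :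
  (forall i, (L <= i)%N -> f i = 0) -> (forall i, (L' <= i)%N -> f i = 0) ->
  \sum_(i < L) f i = \sum_(i < L') f i.
Proof.
move=> hL hL'.
wlog le : L L' hL hL' / (L <= L')%N.
  move=> h; case: (leqP L L') => [|/ltnW] le; first exact: h.
  by apply/esym; apply: h.
rewrite (big_ord_widen _ _ le) big_mkcond; apply: eq_bigr => i _.
by case: ltnP => // /hL.
Qed.

Lemma triangle_sum (G : nat -> nat -> U) n :
  \sum_(i < n) \sum_(j < n - i) G i j = \sum_(l < n) \sum_(i < l.+1) G i (l - i)%N.
Proof.
elim: n => [|n IH]; first by rewrite !big_ord0.
rewrite [RHS]big_ord_recr /= -IH [X in _ = _ + X]big_ord_recr /= subnn addrA.
rewrite -big_split [LHS]big_ord_recr /= subSnn big_ord1; congr (_ + _).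
by apply: eq_bigr => i _; rewrite subSn ?big_ord_recr //= ltnW.
Qed.

(** The Leibniz rule for the weight [i + j] on the terms of a convolution.  It
    lets identities between divided powers and between binomial coefficients be
    proved by induction, after multiplication by [n + 1]. *)
Lemma conv_leibniz (G : nat -> nat -> U) n :
  n.+1%:R *: \sum_(i < n.+2) G i (n.+1 - i)%N =
  \sum_(i < n.+1) (i.+1%:R *: G i.+1 (n - i)%N + (n - i).+1%:R *: G i (n - i).+1).
Proof.
rewrite scaler_sumr big_split /=.
have -> : \sum_(i < n.+2) n.+1%:R *: G i (n.+1 - i)%N =
  \sum_(i < n.+2) i%:R *: G i (n.+1 - i)%N +
  \sum_(i < n.+2) (n.+1 - i)%:R *: G i (n.+1 - i)%N.
  rewrite -big_split; apply: eq_bigr => i _ /=.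
  by rewrite -scalerDl -natrD subnKC // -ltnS ltn_ord.
congr (_ + _).
  by rewrite big_ord_recl scale0r add0r; apply: eq_bigr => i _; rewrite /bump /= subSS.
rewrite big_ord_recr /= subnn scale0r addr0; apply: eq_bigr => i _.
by rewrite subSn // -ltnS.
Qed.

End Sums.

(** * Binomial coefficients and divided powers *)

(** The divided power [T^i / i!], locked so that the rules for scalars do not
    see through it. *)
HB.lock Definition dpow (k : fieldType) (V : lmodType k) (T : V -> V) (i : nat)
  (v : V) : V := (i`!%:R : k)^-1 *: iter i T v.

Section CharZero.
Variables (k : fieldType) (k0 : [pchar k] =i pred0).

Lemma natS_neq0 n : n.+1%:R != 0 :> k.
Proof. by rewrite ((pcharf0P k).1 k0). Qed.

Lemma natS_inj (U : lmodType k) n (u v : U) :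
  (n.+1%:R : k) *: u = n.+1%:R *: v -> u = v.
Proof. by apply: (can_inj (scalerK (natS_neq0 n))). Qed.

(** The binomial coefficient [m (m-1) ... (m-i+1) / i!] of an arbitrary
    integer [m]. *)
Fixpoint binz (m : int) (i : nat) : k :=
  if i is i'.+1 then m%:~R / i%:R * binz (m - 1) i' else 1.
Arguments binz : simpl never.

Lemma binzE m i : binz m i.+1 = m%:~R / i.+1%:R * binz (m - 1) i.
Proof. by []. Qed.

Lemma binzS m i : i.+1%:R * binz m i.+1 = m%:~R * binz (m - 1) i.
Proof. by rewrite binzE mulrA mulrCA mulfV ?natS_neq0 // mulr1. Qed.

Lemma binz_pred m i : (m - i%:Z)%:~R * binz m i = m%:~R * binz (m - 1) i.
Proof.
elim: i m => [|i IH] m; first by rewrite subr0.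
apply: (mulfI (natS_neq0 i)); rewrite mulrCA binzS mulrCA.
rewrite (_ : m - i.+1%:Z = m - 1 - i%:Z); last by lia.
by rewrite IH [RHS]mulrCA binzS.
Qed.

Lemma binzS' m i : i.+1%:R * binz m i.+1 = (m - i%:Z)%:~R * binz m i.
Proof. by rewrite binzS binz_pred. Qed.

Lemma binz_pascal m i : binz (m + 1) i.+1 = binz m i.+1 + binz m i.
Proof.
apply: (mulfI (natS_neq0 i)); rewrite mulrDr [LHS]binzS [in RHS]binzS' addrK -mulrDl.
by congr (_ * _); rewrite -[i.+1%:R]/((i.+1%:Z)%:~R) -intrD; congr (_%:~R); lia.
Qed.

Lemma binz_small (m i : nat) : (m < i)%N -> binz m%:Z i = 0.
Proof.
elim: i m => // i IH [|m] lt; first by rewrite binzE !mul0r.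
by rewrite binzE (_ : m.+1%:Z - 1 = m%:Z) ?IH ?mulr0 //; lia.
Qed.

Lemma binzz (m : nat) : binz m%:Z m = 1.
Proof.
elim: m => // m IH; rewrite binzE (_ : m.+1%:Z - 1 = m%:Z) ?IH; last by lia.
by rewrite mulr1 mulfV // natS_neq0.
Qed.

Lemma binz_vandermonde m n l :
  \sum_(j < l.+1) binz m j * binz n (l - j) = binz (m + n) l.
Proof.
elim: l m n => [|l IH] m n; first by rewrite big_ord1 mulr1.
apply: (mulfI (natS_neq0 l)); rewrite binzS.
have := conv_leibniz (fun i j => binz m i * binz n j : k^o) l.
rewrite /GRing.scale /= => ->.
rewrite (eq_bigr (fun i : 'I_l.+1 => m%:~R * (binz (m - 1) i * binz n (l - i)) +
                                n%:~R * (binz m i * binz (n - 1) (l - i)))).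
  rewrite big_split -!mulr_sumr !IH /= intrD mulrDl.
  by congr (_ * binz _ _ + _ * binz _ _); lia.
move=> i _; congr (_ + _); first by rewrite mulrA binzS mulrA.
by rewrite mulrCA binzS mulrCA.
Qed.

(** Upper negation.  It turns Vandermonde's identity into [binz_alt], which
    recombines the coefficients of the associativity formula. *)
Lemma binzN m i : binz m i = (-1) ^+ i * binz (i%:Z - m - 1) i.
Proof.
elim: i m => [|i IH] m; first by rewrite mul1r.
apply: (mulfI (natS_neq0 i)); rewrite [RHS]mulrCA [in RHS]binzS [LHS]binzS'.
rewrite (_ : i.+1%:Z - m - 1 = i%:Z - m); last by lia.
rewrite IH exprS.
have -> : (i%:Z - m)%:~R = - (m - i%:Z)%:~R :> k by rewrite -mulrNz opprB.
by ring.
Qed.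

Lemma binz_alt m n l :
  \sum_(j < l.+1) (-1) ^+ j * binz m j * binz (n - j%:Z) (l - j) = binz (n - m) l.
Proof.
rewrite [RHS]binzN (_ : l%:Z - (n - m) - 1 = m + (l%:Z - n - 1)); last by lia.
rewrite -binz_vandermonde mulr_sumr; apply: eq_bigr => j _.
rewrite [binz (n - _) _]binzN; have jl : (j <= l)%N by rewrite -ltnS.
rewrite (_ : (l - j)%N%:Z - (n - j%:Z) - 1 = l%:Z - n - 1); last by lia.
rewrite -[in (-1) ^+ l](subnKC jl) exprD !mulrA; congr (_ * _).
by rewrite -!mulrA [binz m j * _]mulrC.
Qed.

Section DividedPowers.
Variables (V : lmodType k) (T : V -> V).
Hypothesis T_lin : linear T.

Lemma dpow0 v : dpow T 0 v = v.
Proof. by rewrite dpow.unlock invr1 scale1r. Qed.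

Lemma dpow_lin i : linear (dpow T i).
Proof.
by move=> c u v; rewrite dpow.unlock (iter_lin T_lin) scalerDr !scalerA mulrC.
Qed.

Lemma dpowS i v : i.+1%:R *: dpow T i.+1 v = T (dpow T i v).
Proof.
rewrite dpow.unlock (linZ T_lin) scalerA factS natrM invfM mulrA.
by rewrite mulfV ?natS_neq0 // mul1r.
Qed.

Lemma dpowSr i v : i.+1%:R *: dpow T i.+1 v = dpow T i (T v).
Proof. by rewrite dpowS dpow.unlock (linZ T_lin) -iterS -iterSr. Qed.

Section Conjugation.
Variable A : int -> V -> V.
Hypothesis A_lin : forall m, linear (A m).
Hypothesis TA : forall m v, T (A m v) = A m (T v) - m%:~R *: A (m - 1) v.

(** The sum is the coefficient of [z^j] in [e^{-zT} A_m e^{zT}].  The hypothesis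
    [TA] says that commuting with [T] differentiates the field with modes [A_m],
    so that this conjugation translates it. *)
Lemma dpow_conj m j b :
  \sum_(i < j.+1) (-1) ^+ i *: dpow T i (A m (dpow T (j - i) b)) =
  binz m j *: A (m - j%:Z) b.
Proof.
elim: j m => [|j IH] m; first by rewrite big_ord1 !dpow0 !scale1r subr0.
apply: (@natS_inj _ j); rewrite scalerA binzS -scalerA.
have := conv_leibniz (fun a c => (-1) ^+ a *: dpow T a (A m (dpow T c b))) j.
move=> ->; rewrite (_ : m - j.+1%:Z = m - 1 - j%:Z) -?IH; last by lia.
rewrite scaler_sumr; apply: eq_bigr => i _.
rewrite [X in X + _]scalerA mulrC -scalerA dpowSr TA.
rewrite [X in _ + X]scalerA [_ * (-1) ^+ _]mulrC -[X in _ + X]scalerA.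
have <- : dpow T i (A m (T (dpow T (j - i) b))) =
    (j - i).+1%:R *: dpow T i (A m (dpow T (j - i).+1 b)).
  by rewrite -dpowS (linZ (A_lin _)) (linZ (dpow_lin _)).
rewrite exprS mulN1r scaleNr -scalerN -scalerDr -(linN (dpow_lin _)).
rewrite -(linD (dpow_lin _)) opprB subrK (linZ (dpow_lin _)).
by rewrite !scalerA mulrC.
Qed.

(** The coefficient of [z^j] in
    [e^{zT} A_m = (e^{zT} A_m e^{-zT}) e^{zT}]. *)
Lemma dpow_mode m j b :
  dpow T j (A m b) =
  \sum_(l < j.+1) ((-1) ^+ l * binz m l) *: A (m - l%:Z) (dpow T (j - l) b).
Proof.
elim: j m b => [|j IH] m b; first by rewrite big_ord1 !dpow0 mulr1 scale1r subr0.
apply: (@natS_inj _ j); rewrite dpowSr TA (linB (dpow_lin _)) (linZ (dpow_lin _)) !IH.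
have := conv_leibniz (fun a c => ((-1) ^+ a * binz m a) *: A (m - a%:Z) (dpow T c b)) j.
move=> ->; rewrite scaler_sumr -sumrB; apply: eq_bigr => i _.
rewrite [RHS]addrC; congr (_ + _).
  by rewrite -dpowSr (linZ (A_lin _)) !scalerA mulrC.
rewrite -scaleNr !scalerA (_ : m - i.+1%:Z = m - 1 - i%:Z); last by lia.
congr (_ *: _); rewrite exprS mulN1r !mulNr mulrN; congr (- _).
by rewrite [RHS]mulrCA binzS mulrCA.
Qed.

End Conjugation.
End DividedPowers.

End CharZero.

(** * Killing by powers of [z - w] *)

Section ZW.
Variables (k : fieldType) (V : lmodType k).
Implicit Types (f g : int -> int -> V).

(** Multiplication by [z - w] of a series whose coefficient of
    [z^(-1-m) w^(-1-n)] is [f m n]. *)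
Definition zw f : int -> int -> V := fun m n => f (m + 1) n - f m (n + 1).

(** The exponent does not depend on the index: vectors, or exponents of a third
    variable, can then be carried along as parameters. *)
Definition zw_killed (I : Type) (F : I -> int -> int -> V) :=
  exists n, forall i m l, iter n zw (F i) m l = 0.

Lemma iter_zw_lin n c f g m l :
  iter n zw (fun m l => c *: f m l + g m l) m l =
  c *: iter n zw f m l + iter n zw g m l.
Proof.
elim: n m l => // n IH m l; rewrite !iterS /zw -/zw !IH scalerBr.
by rewrite opprD addrACA.
Qed.

Lemma iter_zw_shift f n d e m l :
  iter n zw (fun m l => f (d + m) (l + e)) m l = iter n zw f (d + m) (l + e).
Proof.
elim: n m l => // n IH m l; rewrite !iterS /zw -/zw !IH.
by rewrite addrA [l + 1 + e]addrAC.
Qed.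

Lemma iter_zw0 n m l : iter n zw (fun _ _ => 0) m l = 0.
Proof. by elim: n m l => // n IH m l; rewrite iterS /zw -/zw !IH subrr. Qed.

Lemma iter_zw_top_r f n m : (forall m l, 0 <= l -> f m l = 0) ->
  iter n zw f m (-1) = f (m + n%:Z) (-1).
Proof.
elim: n f m => [|n IH] f m f0; first by rewrite addr0.
rewrite iterSr IH => [|x y y0]; last by rewrite /zw !f0 ?subrr // addr_ge0.
by rewrite /zw (f0 _ (-1 + 1)) // subr0 -addrA; congr (f (_ + _) _); lia.
Qed.

Lemma iter_zw_top_l f n l : (forall m l, 0 <= m -> f m l = 0) ->
  iter n zw f (-1) l = (-1) ^+ n *: f (-1) (l + n%:Z).
Proof.
elim: n f l => [|n IH] f l f0; first by rewrite addr0 scale1r.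
rewrite iterSr IH => [|x y x0]; last by rewrite /zw !f0 ?subrr // addr_ge0.
rewrite /zw (f0 (-1 + 1)) // exprS mulN1r scaleNr sub0r scalerN -addrA.
by congr (- (_ *: f _ (_ + _))); lia.
Qed.

Lemma zw_kill_le f n n' :
  (forall m l, iter n zw f m l = 0) -> (n <= n')%N ->
  forall m l, iter n' zw f m l = 0.
Proof.
move=> h /subnK <- m l; rewrite iterD.
by rewrite (_ : iter n zw f = fun _ _ => 0) ?iter_zw0 //; apply/funext => x; apply/funext.
Qed.

Section Families.
Variable I : Type.
Implicit Types F G : I -> int -> int -> V.

Lemma zw_killed_ext F G :
  (forall i m l, F i m l = G i m l) -> zw_killed F -> zw_killed G.
Proof.
move=> e; rewrite (_ : F = G) //.
by apply/funext => i; apply/funext => m; apply/funext.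
Qed.

Lemma zw_killed0 : zw_killed (fun (_ : I) _ _ => 0).
Proof. by exists 0%N. Qed.

Lemma zw_killed_lin (c : I -> k) F G :
  zw_killed F -> zw_killed G ->
  zw_killed (fun i m l => c i *: F i m l + G i m l).
Proof.
move=> [n hn] [n' hn']; exists (maxn n n') => i m l.
by rewrite iter_zw_lin (zw_kill_le (hn i) (leq_maxl _ _))
   (zw_kill_le (hn' i) (leq_maxr _ _)) scaler0 addr0.
Qed.

Lemma zw_killedD F G :
  zw_killed F -> zw_killed G -> zw_killed (fun i m l => F i m l + G i m l).
Proof.
move=> hf hg; apply: zw_killed_ext (zw_killed_lin (fun _ => 1) hf hg) => i m l.
by rewrite scale1r.
Qed.

Lemma zw_killedZ c F : zw_killed F -> zw_killed (fun i m l => c i *: F i m l).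
Proof.
move=> hf; apply: zw_killed_ext (zw_killed_lin c hf zw_killed0) => i m l.
by rewrite addr0.
Qed.

Lemma zw_killed_sum (M : nat) (F : nat -> I -> int -> int -> V) :
  (forall j, zw_killed (F j)) ->
  zw_killed (fun i m l => \sum_(j < M) F j i m l).
Proof.
move=> h; elim: M => [|M IH].
  by apply: zw_killed_ext zw_killed0 => i m l; rewrite big_ord0.
by apply: zw_killed_ext (zw_killedD IH (h M)) => i m l; rewrite big_ord_recr.
Qed.

Lemma zw_killed_map (J : Type) (h : I -> J) (L : I -> V -> V)
    (F : J -> int -> int -> V) :
  (forall i, linear (L i)) -> zw_killed F ->
  zw_killed (fun i m l => L i (F (h i) m l)).
Proof.
move=> L_lin [n hn]; exists n => i m l; rewrite -(lin0 (L_lin i)) -(hn (h i) m l).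
elim: n m l {hn} => // n IH m l.
by rewrite !iterS /zw -/zw !IH (linB (L_lin i)).
Qed.

Lemma zw_killed_shift (J : Type) (h : I -> J) (d : I -> int)
    (F : J -> int -> int -> V) :
  zw_killed F -> zw_killed (fun i m l => F (h i) (d i + m) l).
Proof.
move=> [n hn]; exists n => i m l; rewrite -(hn (h i) (d i + m) l).
rewrite -[in RHS](addr0 l) -iter_zw_shift; congr (iter n zw _ _ _).
by apply/funext => x; apply/funext => y; rewrite addr0.
Qed.

(** Up to a shift, multiplication by [m] is [d/dz], and [(z - w)^{n+1} df/dz] is a
    combination of [(z - w)^n f] and of the derivative of [(z - w)^{n+1} f]. *)
Lemma zw_killed_mul F :
  zw_killed F -> zw_killed (fun i m l => m%:~R *: F i m l).
Proof.
case=> n; elim: n F => [|n IH] F hn.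
  by exists 0%N => i m l; have /= -> := hn i m l; rewrite scaler0.
have step : zw_killed (fun i m l => m%:~R *: zw (F i) m l + F i (1 + m) l).
  apply: zw_killedD; first by apply: IH => i m l; rewrite -iterSr hn.
  by apply: (zw_killed_shift id (fun _ => 1)); exists n.+1.
have [n' hn'] := step; exists n'.+1 => i m l; rewrite iterSr -(hn' i m l).
congr (iter n' zw _ m l); apply/funext => x; apply/funext => y.
by rewrite /zw [1 + x]addrC; linear_ring.
Qed.

(** A series with [(z - w) f = 0] is a function of [m + l] alone, so it vanishes
    as soon as it does for [m >= 0]. *)
Lemma zw_inj_l F :
  zw_killed F -> (forall i m l, 0 <= m -> F i m l = 0) ->
  forall i m l, F i m l = 0.
Proof.
move=> [n hn] hF i; move: (F i) (hn i) (hF i) => {hn hF}f.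
elim: n f => [|n IH] f hf f0 m l; first exact: hf.
have step m' l' : zw f m' l' = 0.
  apply: IH => [x y|x y x0]; first by rewrite -iterSr hf.
  by rewrite /zw !f0 ?subrr // addr_ge0.
case: m => m; first by rewrite f0.
elim: m l => [|m IHm] l.
  by have /eqP := step (-1) (l - 1); rewrite /zw f0 // subrK sub0r oppr_eq0 => /eqP.
have /eqP := step (Negz m.+1) (l - 1); rewrite /zw subrK.
by rewrite (_ : Negz m.+1 + 1 = Negz m) ?IHm ?sub0r ?oppr_eq0 => [/eqP|]; last by lia.
Qed.

Lemma zw_inj_r F :
  zw_killed F -> (forall i m l, 0 <= l -> F i m l = 0) ->
  forall i m l, F i m l = 0.
Proof.
move=> [n hn] F0 i m l.
apply: (@zw_inj_l (fun i x y => F i y x)) => [|j x y]; last exact: F0.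
exists n => j x y.
suff -> : iter n zw (fun x y => F j y x) x y = (-1) ^+ n *: iter n zw (F j) y x.
  by rewrite hn scaler0.
elim: n {hn} x y => [|n IH] x y; first by rewrite scale1r.
by rewrite !iterS /zw -/zw !IH exprS mulN1r scaleNr scalerBr opprB.
Qed.

End Families.

(** The variables are [z], [w], [x].  A power of [z - x] removes [g1] from
    [g = g1 + g2]; what remains is a multiple of [g2], hence killed by a power of
    [w - x], and it is bounded below in [x], so it is zero.  As [g] is bounded
    below in [x] too, it was zero before the multiplication. *)
Lemma zw_inj2 (g g1 g2 : int -> int -> int -> V) :
  (forall m i l, g m i l = g1 m i l + g2 m i l) ->
  zw_killed (fun i m l => g1 m i l) -> zw_killed g2 ->
  (forall m i l, 0 <= l -> g m i l = 0) -> forall m i l, g m i l = 0.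
Proof.
move=> gE [n h1] h2 g0; elim: n g g1 g2 gE h1 h2 g0 => [|n IH] g g1 g2 gE h1 h2 g0.
  apply: zw_inj_r => //; apply: zw_killed_ext h2 => m i l.
  by have := h1 i m l; rewrite /= gE => ->; rewrite add0r.
pose d (h : int -> int -> int -> V) m i l := h (m + 1) i l - h m i (l + 1).
suff dg0 m i l : d g m i l = 0.
  move=> m i l; apply: (@zw_inj_r _ (fun i m l => g m i l)) => [|j x y]; last exact: g0.
  by exists 1%N => j x y; apply: dg0.
apply: (IH (d g) (d g1) (d g2)) => [x y z|x y z||x y z z0].
- by rewrite /d !gE opprD addrACA.
- by have := h1 x y z; rewrite iterSr.
- have [n' hn'] := h2; exists n' => x y z; rewrite /d.
  have -> : (fun y z => g2 (x + 1) y z - g2 x y (z + 1)) =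
     (fun y z => -1 *: g2 x (0 + y) (z + 1) + g2 (x + 1) y z).
    by apply/funext => u; apply/funext => v; rewrite scaleN1r addrC add0r.
  by rewrite iter_zw_lin hn' iter_zw_shift hn' scaler0 addr0.
- by rewrite /d !g0 ?subrr // addr_ge0.
Qed.

End ZW.

(** * Monomials in the odd derivations *)

Section OddMonomials.
Variables (k : fieldType) (N : nat) (U : lmodType k) (S : 'I_N -> U -> U).
Implicit Types (i j : 'I_N) (J : {set 'I_N}).

(** [S^{j_r} ... S^{j_1} a] for [J = {j_1 < ... < j_r}], the coefficient of
    [zeta^J] in [(1 + zeta^1 S^1) ... (1 + zeta^N S^N) a]. *)
Definition oddmono (J : {set 'I_N}) (a : U) : U :=
  foldl (fun u j => if j \in J then S j u else u) a (enum 'I_N).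

Lemma oddmono0 a : oddmono finset.set0 a = a.
Proof. by rewrite /oddmono; elim: (enum _) => //= i s; rewrite inE. Qed.

Lemma card_count_enum J : #|J| = count (fun j => j \in J) (enum 'I_N).
Proof.
rewrite cardE -size_filter /enum_mem -filter_predI; congr size.
by apply: eq_filter => x; rewrite /= andbT.
Qed.

Lemma oddmono_par (par : bool -> set U) :
  (forall i, pure_op par true (S i)) ->
  forall J p a, par p a -> par (p (+) odd #|J|) (oddmono J a).
Proof.
move=> S_par J p a pa.
rewrite card_count_enum /oddmono.
elim: (enum _) p a pa => [|i s IH] p a pa /=; first by rewrite addbF.
case: (i \in J) => /=; last by rewrite add0n; apply: IH.
by rewrite add0n addbN -addNb; apply: IH; exact: (S_par i p).
Qed.

Hypothesis S_lin : forall i, linear (S i).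

Lemma oddmono_lin J : linear (oddmono J).
Proof.
move=> c; rewrite /oddmono; elim: (enum _) => //= i s IH u v.
by case: (i \in J); rewrite ?S_lin IH.
Qed.

Hypothesis S_anti : forall i j v, S i (S j v) = - S j (S i v).

Lemma oddmono_comm J i a : S i (oddmono J a) = (-1) ^+ #|J| *: oddmono J (S i a).
Proof.
rewrite card_count_enum.
have fl s : linear (fun a => foldl (fun u j => if j \in J then S j u else u) a s).
  by move=> c; elim: s => //= j s IH u v; case: (j \in J); rewrite ?S_lin IH.
rewrite /oddmono; elim: (enum _) a => [|j s IH] a /=; first by rewrite scale1r.
case: (j \in J); rewrite /= IH //.
by rewrite S_anti (linN (fl s)) exprS mulN1r scaleNr scalerN.
Qed.

Lemma inversions1 (i : 'I_N) (J : {set 'I_N}) :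
  inversions [set i]%SET J = count (fun x => (x \in J) && (x < i)%N) (enum 'I_N).
Proof.
rewrite /inversions.
have -> : [set x : 'I_N * 'I_N | [&& x.1 \in [set i]%SET, x.2 \in J & (x.2 < x.1)%N]]%SET
   = [set (i, x) | x in [set x in J | (x < i)%N]]%SET.
  apply/setP => -[u v]; rewrite !inE /=; apply/and3P/imsetP.
    by case=> /eqP -> vJ vi; exists v; rewrite ?inE ?vJ.
  by case=> w; rewrite inE => /andP[wJ wi] [-> ->]; rewrite wJ wi eqxx.
rewrite card_imset => [|u v []//].
by rewrite card_count_enum; apply: eq_count => x; rewrite !inE.
Qed.

Lemma oddmonoU J i a : i \notin J ->
  oddmono (i |: J)%SET a = (-1) ^+ inversions [set i]%SET J *: oddmono J (S i a).
Proof.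
move=> iJ; rewrite inversions1 /oddmono.
have fl s : linear (fun a => foldl (fun u j => if j \in J then S j u else u) a s).
  by move=> c; elim: s => //= j s IH u v; case: (j \in J); rewrite ?S_lin IH.
have : sorted (fun x y : 'I_N => (x < y)%N) (enum 'I_N).
  by have := iota_ltn_sorted 0 N; rewrite -val_enum_ord sorted_map.
have : i \in enum 'I_N by rewrite mem_enum.
have tr : transitive (fun x y : 'I_N => (x < y)%N) by move=> u v w; apply: ltn_trans.
elim: (enum _) a => //= j s IH a.
rewrite inE => /orP[/eqP <-|si] hs.
  rewrite /= finset.setU11 (negPf iJ) ltnn add0n.
  have hlt : {in s, forall x : 'I_N, (i < x)%N}.
    exact/allP/(order_path_min tr hs).
  rewrite (_ : count _ s = 0%N); last first.
    apply/eqP; rewrite -[_ == _]negbK -lt0n -has_count; apply/hasPn => x /hlt.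
    by move=> ix; rewrite negb_and -leqNgt (ltnW ix) orbT.
  rewrite scale1r; elim: s (S i a) hlt {hs IH} => //= x s IH b hlt.
  have /negPf xi : x != i.
    by apply: contraTneq (hlt x (mem_head _ _)) => ->; rewrite ltnn.
  by rewrite finset.in_setU1 xi orFb; apply: IH => y ys; apply: hlt; rewrite inE ys orbT.
have ji : (j < i)%N by apply: (allP (order_path_min tr hs)).
have /negPf jni : j != i by apply: contraTneq ji => ->; rewrite ltnn.
rewrite /= finset.in_setU1 jni orFb ji andbT IH ?(path_sorted hs) //.
case: (j \in J); rewrite /= ?add0n // add1n exprS mulN1r scaleNr -scalerN.
by rewrite S_anti (linN (fl s)).
Qed.

Lemma oddmonoUl J i a : i \notin J ->
  oddmono (i |: J)%SET a =
  ((-1) ^+ inversions [set i]%SET J * (-1) ^+ #|J|) *: S i (oddmono J a).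
Proof.
by move=> iJ; rewrite oddmonoU // oddmono_comm scalerA -mulrA -signr_odd -expr2 sqrr_sign mulr1.
Qed.

Hypothesis k0 : [pchar k] =i pred0.

Lemma oddmono_in J i a : i \in J -> oddmono J (S i a) = 0.
Proof.
move=> iJ; rewrite -(finset.setD1K iJ) oddmonoU ?finset.setD11 //.
have -> : S i (S i a) = 0.
  apply: (@natS_inj _ k0 _ 1); rewrite scaler0 scaler_nat mulr2n.
  by rewrite {1}S_anti addNr.
by rewrite (lin0 (@oddmono_lin _)) scaler0.
Qed.

Lemma oddmono_in_l J i a : i \in J -> S i (oddmono J a) = 0.
Proof. by move=> iJ; rewrite oddmono_comm oddmono_in ?scaler0. Qed.

End OddMonomials.

(** * The even parts of the superfields *)

Lemma par_ind (k : fieldType) (V : lmodType k) (par : bool -> set V) (P : V -> Prop) :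
  superspace par -> (forall u v, P u -> P v -> P (u + v)) ->
  (forall p v, par p v -> P v) -> forall v, P v.
Proof.
move=> spar PD Pp v; have [v0 [v1 [p0 p1 ->]]] := super_sum spar v.
by apply: PD; [apply: Pp p0 | apply: Pp p1].
Qed.

(** The coefficient of [z^{-1-n} zeta^J] in [Y(a, Z)]. *)
Definition coef_mode (k : fieldType) (N : nat) (V : lmodType k)
    (Y : V -> fseries N (V -> V)) (J : {set 'I_N}) (a : V) (n : int) : V -> V :=
  Y a (-1 - n) J.

Section Modes.
Variables (k : fieldType) (N : nat) (V : lmodType k) (par : bool -> set V).
Variables (vac : V) (T : V -> V) (S : 'I_N -> V -> V).
Variable Y : V -> fseries N (V -> V).
Hypothesis k0 : [pchar k] =i pred0.
Hypothesis H : susy_va par vac T S Y.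
Implicit Types (a b c u v : V) (m n l : int) (J : {set 'I_N}) (p q : bool).

Local Notation md := (coef_mode Y).
Local Notation pr := (coef_mode Y finset.set0).

Let spar := va_super H.
Let T_lin := va_T_lin H.

Lemma md_linr J a n : linear (md J a n).
Proof. exact: (va_Y_end H). Qed.

Lemma md_linl J n v : linear (fun a => md J a n v).
Proof. by move=> c a b; apply: (va_Y_lin H). Qed.

Lemma md_T J a n v : T (md J a n v) = md J a n (T v) - n%:~R *: md J a (n - 1) v.
Proof.
move: a; apply: (par_ind spar) => [a b ha hb|p a pa].
  rewrite !(linD (md_linl _ _ _)) (linD T_lin) ha hb; linear_ring.
have /(congr1 (fun s => s (-1 - n) J)) := va_T_comm H pa v.
rewrite /op_comm /op_act /dz /fapp /= expr0 !scale1r.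
rewrite (_ : -1 - n + 1 = - n); last by lia.
rewrite /coef_mode (_ : -1 - (n - 1) = - n); last by lia.
by move/eqP; rewrite subr_eq => /eqP ->; linear_ring.
Qed.

Lemma md_S_notin J a p i n v : par p a -> i \notin J ->
  (-1) ^+ #|J| *: S i (md J a n v) - (-1) ^+ p *: md J a n (S i v) =
  (-1) ^+ inversions [set i]%SET J *: md (i |: J)%SET a n v.
Proof.
move=> pa /negPf iJ; have /(congr1 (fun s => s (-1 - n) J)) := va_S_comm H pa i v.
by rewrite /op_comm /op_act /dzeta /fapp iJ /= signr_odd.
Qed.

Lemma md_S_in J a p i n v : par p a -> i \in J ->
  (-1) ^+ #|J| *: S i (md J a n v) - (-1) ^+ p *: md J a n (S i v) = 0.
Proof.
move=> pa iJ; have /(congr1 (fun s => s (-1 - n) J)) := va_S_comm H pa i v.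
by rewrite /op_comm /op_act /dzeta /fapp iJ /= signr_odd.
Qed.

Lemma iter_mul_z_sub_w (F : fseries N (fseries N V)) (n : nat) m J l L :
  iter n (@mul_z_sub_w k N V) F (-1 - m) J (-1 - l) L =
  iter n (@zw k V) (fun m l => F (-1 - m) J (-1 - l) L) m l.
Proof.
elim: n m l => // n IH m l; rewrite !iterS /zw -/zw -!IH /mul_z_sub_w.
by congr (iter n _ F _ J _ L - iter n _ F _ J _ L); lia.
Qed.

Lemma md_local J a p b q : par p a -> par q b ->
  zw_killed (fun v m l => md J a m (pr b l v) -
     (-1) ^+ ((p (+) odd #|J|) && q) *: pr b l (md J a m v)).
Proof.
move=> pa qb; have [n hn] := va_local H pa qb; exists n => v m l.
have := congr1 (fun s => s (-1 - m) J (-1 - l) finset.set0) (hn v).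
rewrite iter_mul_z_sub_w => <-; congr (iter n _ _ m l).
apply/funext => x; apply/funext => y.
by rewrite /field_comm /op_comm /op_act cards0 andbF expr0 scale1r.
Qed.

Lemma md_vac J a n : 0 <= n -> md J a n vac = 0.
Proof. by move=> n0; apply: (va_vacuum H a).1; lia. Qed.

Lemma pr_vac a : pr a (-1) vac = a.
Proof. by rewrite /coef_mode subrr (va_vacuum H a).2. Qed.

Lemma md_par J a p n b q : par p a -> par q b ->
  par (p (+) odd #|J| (+) q) (md J a n b).
Proof. by move=> pa; apply: (va_Y_par H pa). Qed.

Lemma pr_par a p n b q : par p a -> par q b -> par (p (+) q) (pr a n b).
Proof. by move=> pa qb; have := md_par finset.set0 n pa qb; rewrite cards0 addbF. Qed.

Lemma pr_trunc a b : exists M : nat, forall n, M%:Z <= n -> pr a n b = 0.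
Proof.
have [n hn] := va_Y_field H a b; exists `|n|%N => m le.
by apply: hn; lia.
Qed.

(** Goddard's uniqueness theorem.  The field [Y(b, x)] creates [b] from the
    vacuum, and for large [n] one has
    [(z - x)^n B(z) Y(b, x) vac = +- (z - x)^n Y(b, x) B(z) vac = 0]; the powers
    of [x] in [Y(b, x) vac] being nonnegative, [z - x] can be cancelled. *)
Lemma goddard (B : int -> V -> V) (r : bool) :
  (forall n, linear (B n)) ->
  (forall q b, par q b -> zw_killed (fun v m l =>
      B m (pr b l v) - (-1) ^+ (r && q) *: pr b l (B m v))) ->
  (forall m, B m vac = 0) -> forall m v, B m v = 0.
Proof.
move=> B_lin Bloc Bvac m; apply: (par_ind spar) => [u v hu hv|q b qb].
  by rewrite (linD (B_lin m)) hu hv addr0.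
have [n hn] := Bloc q b qb.
rewrite -[b]pr_vac; apply: (@zw_inj_r _ _ unit (fun _ m l => B m (pr b l vac)) _ _ tt m (-1)).
- exists n => _ x y; rewrite -(hn vac x y); congr (iter n _ _ x y).
  apply/funext => u; apply/funext => v.
  by rewrite Bvac (lin0 (md_linr _ _ _)) scaler0 subr0.
- by move=> _ x y y0; rewrite md_vac // (lin0 (B_lin x)).
Qed.

(** Covariance [[T, B(z)] = dB/dz] gives [B(z) vac = e^{zT} B_{-1} vac] once
    [B(z) vac] has no pole. *)
Lemma covariant_vac0 (B : int -> V -> V) :
  (forall m v, T (B m v) = B m (T v) - m%:~R *: B (m - 1) v) ->
  (forall m, linear (B m)) ->
  (forall m, -1 <= m -> B m vac = 0) -> forall m, B m vac = 0.
Proof.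
move=> TB B_lin B0; case=> [n|n]; first by apply: B0; lia.
elim: n => [|n IH]; first by rewrite B0.
have := TB (Negz n) vac; rewrite IH (va_T_vac H) (lin0 T_lin) (lin0 (B_lin _)) sub0r.
rewrite (_ : Negz n - 1 = Negz n.+1); last by lia.
rewrite NegzE mulrNz scaleNr opprK => /esym e.
by apply: (natS_inj k0); rewrite scaler0 -[RHS]e.
Qed.

(** Combining the two previous lemmas, applied to the difference of the two sides:
    this identifies a field from its locality, its covariance and the single
    vector [B_{-1} vac]. *)
Lemma covariant_eq (B : int -> V -> V) c (r : bool) :
  (forall n, linear (B n)) -> par r c ->
  (forall q b, par q b -> zw_killed (fun v m l =>
      B m (pr b l v) - (-1) ^+ (r && q) *: pr b l (B m v))) ->
  (forall m v, T (B m v) = B m (T v) - m%:~R *: B (m - 1) v) ->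
  (forall m, 0 <= m -> B m vac = 0) -> B (-1) vac = c ->
  forall m v, B m v = pr c m v.
Proof.
move=> B_lin rc Bloc TB B0 Bc m v; apply/eqP; rewrite -subr_eq0; apply/eqP.
move: m v; pose D m v := B m v - pr c m v; rewrite -/(D _ _).
have D_lin m : linear (D m).
  by move=> e x y; rewrite /D B_lin (md_linr _ _ _ e); linear_ring.
apply: (@goddard D r) => // [q b qb|].
  apply: zw_killed_ext (zw_killed_lin (fun _ => -1)
    (md_local finset.set0 rc qb) (Bloc q b qb)) => x m l.
  by rewrite /D cards0 addbF (linB (md_linr _ _ _)); linear_ring.
apply: covariant_vac0 => // [m v|m].
  by rewrite /D (linB T_lin) TB md_T; linear_ring.
rewrite -subr_ge0; case: m => [n _|n].
  by rewrite /D B0 ?md_vac ?subrr.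
case: n => [_|n]; last by lia.
by rewrite /D Bc pr_vac subrr.
Qed.

Lemma md_eq_pr J a p n v : par p a -> md J a n v = pr (md J a (-1) vac) n v.
Proof.
move=> pa; apply: (@covariant_eq (md J a) _ (p (+) odd #|J|)) => //.
- exact: md_linr.
- by have := md_par J (-1) pa (va_vac_par H); rewrite addbF.
- by move=> q b qb; apply: md_local.
- by move=> *; apply: md_T.
- by move=> *; apply: md_vac.
Qed.

Lemma inversions0 (i : 'I_N) : inversions [set i]%SET finset.set0 = 0%N.
Proof. by rewrite inversions1 (eq_count (a2 := pred0)) ?count_pred0 // => x; rewrite inE. Qed.

Lemma notin0 (i : 'I_N) : i \notin (finset.set0 : {set 'I_N}).
Proof. by rewrite inE. Qed.

Lemma pr_S1 a p i n v : par p a ->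
  md [set i]%SET a n v = S i (pr a n v) - (-1) ^+ p *: pr a n (S i v).
Proof.
move=> pa; have := md_S_notin n v pa (notin0 i).
by rewrite finset.setU0 inversions0 cards0 !scale1r => <-.
Qed.

Lemma md1_vac a p i : par p a -> md [set i]%SET a (-1) vac = S i a.
Proof.
move=> pa; rewrite (pr_S1 i _ _ pa) (va_S_vac H) (lin0 (md_linr _ _ _)).
by rewrite scaler0 subr0 pr_vac.
Qed.

Lemma pr_S a p i n v : par p a ->
  S i (pr a n v) = pr (S i a) n v + (-1) ^+ p *: pr a n (S i v).
Proof.
move=> pa; have := pr_S1 i n v pa.
by rewrite (md_eq_pr _ _ _ pa) (md1_vac _ pa) => ->; rewrite subrK.
Qed.

Lemma T_eq_mode a : T a = pr a (-2) vac.
Proof.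
rewrite -{1}[a]pr_vac md_T (va_T_vac H) (lin0 (md_linr _ _ _)) sub0r.
by rewrite mulrN1z scaleN1r opprK.
Qed.

Lemma S_T_comm i a : S i (T a) = T (S i a).
Proof.
move: a; apply: (par_ind (va_super H)) => [a b ha hb|p a pa].
  by rewrite !(linD (va_T_lin H)) !(linD (va_S_lin H i)) (linD (va_T_lin H)) ha hb.
by rewrite !T_eq_mode (pr_S _ _ _ pa) (va_S_vac H) (lin0 (md_linr _ _ _)) scaler0 addr0.
Qed.

Lemma md_vac_U J a p i : par p a -> i \notin J ->
  md (i |: J)%SET a (-1) vac =
  ((-1) ^+ inversions [set i]%SET J * (-1) ^+ #|J|) *: S i (md J a (-1) vac).
Proof.
move=> pa iJ; have := md_S_notin (-1) vac pa iJ.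
rewrite (va_S_vac H) (lin0 (md_linr _ _ _)) scaler0 subr0 -scalerA => ->.
by rewrite scalerA -signr_odd -expr2 sqrr_sign scale1r.
Qed.

Lemma inversions11 (i j : 'I_N) :
  inversions [set i]%SET [set j]%SET = (j < i)%N.
Proof.
rewrite inversions1 (eq_count (a2 := fun x => (x == j) && (j < i)%N)); last first.
  by move=> x; rewrite inE; case: eqP => // ->.
case: (j < i)%N; last by rewrite (eq_count (a2 := pred0)) ?count_pred0 // => x; rewrite andbF.
rewrite (eq_count (a2 := pred1 j)); last by move=> x; rewrite /= andbT.
by rewrite count_uniq_mem ?enum_uniq // mem_enum.
Qed.

(** The coefficient of [zeta^i zeta^j] in [Y(a, Z) vac] can be reached by
    [S^i] from that of [zeta^j], or by [S^j] from that of [zeta^i]. *)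
Lemma S_anticomm i j a : S i (S j a) = - S j (S i a).
Proof.
move: a; apply: (par_ind (va_super H)) => [a b ha hb|p a pa].
  by rewrite !(linD (va_S_lin H _)) ha hb opprD.
have [->|ij] := eqVneq i j.
  have jj : j \in [set j]%SET by rewrite inE.
  have := md_S_in (-1) vac pa jj.
  rewrite (va_S_vac H) (lin0 (md_linr _ _ _)) scaler0 subr0 cards1 (md1_vac _ pa).
  by rewrite scaleN1r => /eqP; rewrite oppr_eq0 => /eqP ->; rewrite oppr0.
have h x y : x != y -> md (x |: [set y])%SET a (-1) vac =
    ((-1) ^+ (y < x)%N * -1) *: S x (S y a).
  by move=> xy; rewrite (md_vac_U pa) ?inE // inversions11 cards1 (md1_vac _ pa).
have := h _ _ ij; rewrite finset.setUC h 1?eq_sym //.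
case: (ltngtP i j) => [_|_|/val_inj e]; last by rewrite e eqxx in ij.
  rewrite expr0 expr1 mul1r mulN1r opprK scale1r scaleN1r => ->.
  by rewrite opprK.
by rewrite expr0 expr1 mul1r mulN1r opprK scale1r scaleN1r.
Qed.

(** The coefficient of [zeta^J] in [Y(a, Z)] is local and covariant, so it is
    the even field of the vector it creates from the vacuum; translation in
    [zeta] shows that this vector is [oddmono S J a]. *)
Lemma md_oddmono J a n v : md J a n v = pr (oddmono S J a) n v.
Proof.
have O_lin := oddmono_lin (va_S_lin H) J.
move: a; apply: (par_ind (va_super H)) => [a b ha hb|p a pa].
  by rewrite (linD O_lin) (linD (md_linl J n v)) (linD (md_linl _ n v)) ha hb.
rewrite (md_eq_pr _ _ _ pa); congr (pr _ n v).
move cJ: #|J| => m; elim: m J cJ {O_lin} => [|m IH] J cJ.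
  by rewrite (cards0_eq cJ) pr_vac oddmono0.
have /card_gt0P[i iJ] : (0 < #|J|)%N by rewrite cJ.
rewrite -(finset.setD1K iJ) (md_vac_U pa) ?finset.setD11 // IH; last first.
  by move: cJ; rewrite (finset.cardsD1 i) iJ => -[].
by rewrite (oddmonoUl (va_S_lin H) S_anticomm) ?finset.setD11.
Qed.

(** The field [dY(a, z)/dz] is local and covariant, and it creates [T a]. *)
Lemma pr_T a n v : pr (T a) n v = - n%:~R *: pr a (n - 1) v.
Proof.
move: a; apply: (par_ind (va_super H)) => [a b ha hb|p a pa].
  rewrite (linD (va_T_lin H)) !(linD (md_linl _ n v)) (linD (md_linl _ (n - 1) v)) ha hb.
  by rewrite scalerDr.
pose B m v := - m%:~R *: pr a (m - 1) v; rewrite -/(B _ _).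
apply/esym/(@covariant_eq B _ p) => //.
- by move=> m e x y; rewrite /B (md_linr _ _ _ e); linear_ring.
- by have := va_T_par H pa.
- move=> q b qb; have := md_local finset.set0 pa qb; rewrite cards0 addbF.
  set f := (X in zw_killed X) => hf.
  apply: zw_killed_ext
    (zw_killedZ (fun _ => -1) (zw_killed_mul (zw_killed_shift id (fun _ => -1) hf))) => x m l.
  rewrite /f /B (linZ (md_linr _ _ _)) [- 1 + m]addrC /=.
  by linear_ring.
- move=> m u; rewrite /B (linZ (va_T_lin H)) md_T.
  by linear_ring.
- by move=> m m0; rewrite /B; case: m m0 => // -[|m] _;
     rewrite ?oppr0 ?scale0r // md_vac ?scaler0 //; lia.
by rewrite /B T_eq_mode mulrN1z opprK scale1r.
Qed.

End Modes.

(** * Vertex superalgebras with odd derivations *)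

(** The even parts [Y(a, z)] of the fields, with modes [pr a n = a_(n)], and the
    odd derivations [S^i]; by [md_oddmono] they carry all the information of an
    [N_W = N] SUSY vertex algebra. *)
Record mode_va (k : fieldType) (N : nat) (V : lmodType k) (par : bool -> set V)
    (vac : V) (T : V -> V) (S : 'I_N -> V -> V) (pr : V -> int -> V -> V) : Prop :=
  ModeVA {
  mv_super : superspace par;
  mv_vac_par : par false vac;
  mv_T_lin : linear T;
  mv_T_par : pure_op par false T;
  mv_S_lin : forall i, linear (S i);
  mv_S_par : forall i, pure_op par true (S i);
  mv_linl : forall n v, linear (fun a => pr a n v);
  mv_linr : forall a n, linear (pr a n);
  mv_par : forall a p n b q, par p a -> par q b -> par (p (+) q) (pr a n b);
  mv_trunc : forall a b, exists M : nat, forall n : int, M%:Z <= n -> pr a n b = 0;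
  mv_vac0 : forall a n, 0 <= n -> pr a n vac = 0;
  mv_vacr : forall a, pr a (-1) vac = a;
  mv_T_vac : T vac = 0;
  mv_S_vac : forall i, S i vac = 0;
  mv_T_der : forall a n b, T (pr a n b) = pr a n (T b) - n%:~R *: pr a (n - 1) b;
  mv_T_mode : forall a n b, pr (T a) n b = - n%:~R *: pr a (n - 1) b;
  mv_S_der : forall a p i n b, par p a ->
    S i (pr a n b) = pr (S i a) n b + (-1) ^+ p *: pr a n (S i b);
  mv_ST : forall i a, S i (T a) = T (S i a);
  mv_SS : forall i j a, S i (S j a) = - S j (S i a);
  mv_local : forall a p b q, par p a -> par q b ->
    zw_killed (fun v m l => pr a m (pr b l v) - (-1) ^+ (p && q) *: pr b l (pr a m v))
}.

Lemma susy_va_modes (k : fieldType) (N : nat) (V : lmodType k) (par : bool -> set V)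
    (vac : V) (T : V -> V) (S : 'I_N -> V -> V) (Y : V -> fseries N (V -> V)) :
  [pchar k] =i pred0 -> susy_va par vac T S Y ->
  mode_va par vac T S (coef_mode Y finset.set0).
Proof.
move=> k0 H; split; try by case: H.
- exact: (md_linl H).
- exact: (md_linr H).
- exact: (pr_par H).
- exact: (pr_trunc H).
- exact: (md_vac H).
- exact: (pr_vac H).
- exact: (md_T H).
- exact: (pr_T k0 H).
- by move=> a p i n b pa; apply: (pr_S k0 H).
- exact: (S_T_comm k0 H).
- exact: (S_anticomm H).
- by move=> a p b q pa qb; have := md_local H finset.set0 pa qb; rewrite cards0 addbF.
Qed.

(** A large exponent [K] for [z - w], and the exponent [i] of [z] such that the
    coefficient of [z^i] in [z^K Y(a, z) b] is [a_(m) b]. *)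
Lemma large_split (m : int) (n0 M : nat) : exists K i : nat,
    [/\ (n0 <= K)%N, -1 - i%:Z + K%:Z = m,
        forall s, (s <= i)%N -> -1 - (i - s)%N%:Z + K%:Z = m + s%:Z &
        forall s, (i < s)%N -> M%:Z <= m + s%:Z].
Proof.
case: m => m.
  by exists (n0 + M + m.+1)%N, (n0 + M)%N; split=> [||s|s]; lia.
by exists (n0 + M)%N, (n0 + M + m)%N; split=> [||s|s]; lia.
Qed.

Lemma large_shift (x y : int) (B M : nat) : exists I : nat,
  B%:Z <= x + I%:Z /\ forall j, (j < M)%N -> B%:Z <= y - j%:Z + I%:Z.
Proof.
by case: x => x; case: y => y; exists (x + y + B + M + 2)%N; split=> [|j]; lia.
Qed.

Lemma predN1 (j : nat) : -1 - j%:Z - 1 = -1 - j.+1%:Z.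
Proof. by lia. Qed.

Lemma oppN1 (j : nat) : - (-1 - j%:Z) = j.+1%:Z.
Proof. by lia. Qed.

Lemma signzB (R : fieldType) (i j : nat) :
  (-1) ^ (i%:Z - j%:Z) = (-1) ^+ i * (-1) ^+ j :> R.
Proof.
rewrite expfzDr ?oppr_eq0 ?oner_eq0 // -invr_expz.
by congr (_ * _); apply: invr_sign.
Qed.

Lemma signzD (R : fieldType) (m n : int) : (-1) ^ (m + n) = (-1) ^ m * (-1) ^ n :> R.
Proof. by rewrite expfzDr // oppr_eq0 oner_eq0. Qed.

Lemma signzN (R : fieldType) (m : int) : (-1) ^ (- m) = (-1) ^ m :> R.
Proof.
have h (n : nat) : (-1) ^ (- n%:Z) = (-1) ^ n%:Z :> R.
  by rewrite -invr_expz; apply: invr_sign.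
by case: m => n; rewrite ?NegzE ?opprK h.
Qed.

Lemma signzP (R : fieldType) (m : int) : (-1) ^ m = 1 :> R \/ (-1) ^ m = -1 :> R.
Proof.
have h (n : nat) : (-1) ^ n%:Z = 1 :> R \/ (-1) ^ n%:Z = -1 :> R.
  by rewrite -exprnP -signr_odd; case: (odd n); [right | left].
case: m => n; first exact: h.
by rewrite NegzE signzN; apply: h.
Qed.

Section Borcherds.
Variables (k : fieldType) (N : nat) (V : lmodType k) (par : bool -> set V).
Variables (vac : V) (T : V -> V) (S : 'I_N -> V -> V) (pr : V -> int -> V -> V).
Hypothesis k0 : [pchar k] =i pred0.
Hypothesis H : mode_va par vac T S pr.

Let T_lin := mv_T_lin H.
Let linr := mv_linr H.
Let linl := mv_linl H.
Local Notation binz := (binz k).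

(** ** The commutator formula *)

Section Commutator.
Variables (a b : V) (p q : bool) (pa : par p a) (qb : par q b) (M : nat).
Hypothesis aM : forall n : int, M%:Z <= n -> pr a n b = 0.

(** The failure of the commutator formula.  Both the commutator and the sum are
    killed by a power of [z - w], hence so is [D].  On the vacuum, covariance
    reduces the vanishing of [D m n] for [m >= 0] to the case [n = -1], and
    [zw_inj_l] then gives all [m]. *)
Let D (m n : int) (v : V) : V :=
  pr a m (pr b n v) - (-1) ^+ (p && q) *: pr b n (pr a m v)
  - \sum_(i < M) binz m i *: pr (pr a i%:Z b) (m + n - i%:Z) v.

Let D_lin m n : linear (D m n).
Proof.
move=> c u v; rewrite /D !(linr _ _ c).
rewrite (eq_bigr (fun i : 'I_M => c *: (binz m i *: pr (pr a i%:Z b) (m + n - i%:Z) u) +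
   binz m i *: pr (pr a i%:Z b) (m + n - i%:Z) v)); last first.
  by move=> i _; rewrite linr; linear_ring.
by rewrite big_split -scaler_sumr /=; linear_ring.
Qed.

Let TD m n v :
  T (D m n v) = D m n (T v) - m%:~R *: D (m - 1) n v - n%:~R *: D m (n - 1) v.
Proof.
rewrite /D !(linB T_lin) (linZ T_lin) (lin_sum T_lin) !(mv_T_der H).
rewrite (eq_bigr (fun i : 'I_M => binz m i *: pr (pr a i%:Z b) (m + n - i%:Z) (T v) -
   (m%:~R *: (binz (m - 1) i *: pr (pr a i%:Z b) (m - 1 + n - i%:Z) v) +
    n%:~R *: (binz m i *: pr (pr a i%:Z b) (m + (n - 1) - i%:Z) v)))); last first.
  move=> i _; rewrite (linZ T_lin) (mv_T_der H).
  rewrite (_ : m - 1 + n - i%:Z = m + n - i%:Z - 1); last by lia.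
  rewrite (_ : m + (n - 1) - i%:Z = m + n - i%:Z - 1); last by lia.
  rewrite [m%:~R *: (_ *: _)]scalerA -(binz_pred k0).
  rewrite (_ : m + n - i%:Z = (m - i%:Z) + n); last by lia.
  by linear_ring.
rewrite sumrB big_split -!scaler_sumr /=.
rewrite !(linB (linr _ _)) !(linZ (linr _ _)).
by linear_ring.
Qed.

Let D_killed v : zw_killed (fun (_ : unit) m n => D m n v).
Proof.
have loc : zw_killed (fun (_ : unit) m l =>
    pr a m (pr b l v) - (-1) ^+ (p && q) *: pr b l (pr a m v)).
  by have [n hn] := mv_local H pa qb; exists n => _; exact: hn v.
have del : zw_killed (fun (_ : unit) m n =>
    \sum_(i < M) binz m i *: pr (pr a i%:Z b) (m + n - i%:Z) v).
  apply: (zw_killed_sum _ (F := fun i _ m n => binz m i *: pr (pr a i%:Z b) (m + n - i%:Z) v)).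
  move=> j; move: (pr a j%:Z b) => u; exists j.+1 => _.
  elim: j => [|j IH] m n.
    by rewrite /= /zw !scale1r !subr0 (_ : m + 1 + n = m + (n + 1)) ?subrr //; lia.
  rewrite iterSr -(IH m n); congr (iter j.+1 (@zw k V) _ m n).
  apply/funext => x; apply/funext => y; rewrite /zw.
  rewrite (_ : x + 1 + y - _ = x + y - j%:Z); last by lia.
  rewrite (_ : x + (y + 1) - _ = x + y - j%:Z); last by lia.
  by rewrite -scalerBl (binz_pascal k0) addrAC subrr add0r.
apply: zw_killed_ext (zw_killed_lin (fun _ => -1) del loc) => _ m n.
by rewrite /D scaleN1r addrC.
Qed.

Let D_vac m n : D m n vac = 0.
Proof.
apply: (zw_inj_l (D_killed vac) _ tt) => _ {}m {}n; case: m => // m _.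
have D0 (m' : nat) (n' : int) : 0 <= n' -> D m' n' vac = 0.
  move=> n0; rewrite /D (mv_vac0 H _ n0) (mv_vac0 H a) // !(lin0 (linr _ _)).
  rewrite scaler0 subr0 sub0r big1 ?oppr0 // => i _.
  have [im|mi] := leqP i m'; last by rewrite binz_small ?scale0r.
  by rewrite (mv_vac0 H) ?scaler0 //; lia.
have D1 (m' : nat) : D m' (-1) vac = 0.
  rewrite /D (mv_vacr H) (mv_vac0 H a) // !(lin0 (linr _ _)) scaler0 subr0.
  have [mM|Mm] := ltnP m' M; last first.
    rewrite aM // sub0r big1 ?oppr0 // => i _.
    by rewrite (mv_vac0 H) ?scaler0 //; have := ltn_ord i; lia.
  rewrite (bigD1 (Ordinal mM)) //= (binzz k0) scale1r.
  rewrite (_ : m'%:Z - 1 - m'%:Z = -1) ?(mv_vacr H); last by lia.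
  rewrite big1 ?addr0 ?subrr // => i im.
  have [lt|lt|e] := ltngtP i m'; last by rewrite -val_eqE /= e eqxx in im.
    by rewrite (mv_vac0 H) ?scaler0 //; lia.
  by rewrite binz_small ?scale0r.
case: n => [n|n]; first exact: D0.
elim: n m => [|n IH] m; first exact: D1.
have := TD m (Negz n) vac; rewrite IH (mv_T_vac H) (lin0 (D_lin _ _)) (lin0 T_lin) sub0r.
rewrite (_ : m%:~R *: D (m%:Z - 1) (Negz n) vac = 0); last first.
  case: m => [|m]; first by rewrite scale0r.
  by rewrite (_ : m.+1%:Z - 1 = m) ?IH ?scaler0 //; lia.
rewrite oppr0 sub0r (_ : Negz n - 1 = Negz n.+1); last by lia.
rewrite NegzE mulrNz scaleNr opprK => /esym e.
by apply: (natS_inj k0); rewrite scaler0 -[RHS]e.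
Qed.

Let comm (x y : V) (r t : bool) v m n :=
  pr x m (pr y n v) - (-1) ^+ (r && t) *: pr y n (pr x m v).

(** Goddard's argument for two fields at once: in [D c(x) vac -+ c(x) D vac] the
    terms [g1] contain [[a(z), c(x)]] and are killed by a power of [z - x]; the
    terms [g2] contain [[b(w), c(x)]] or [[(a_(i) b)(w), c(x)]] and are killed by
    a power of [w - x]. *)
Let D0 m n v : D m n v = 0.
Proof.
move: v; apply: (par_ind (mv_super H)) => [u v hu hv|r c rc].
  by rewrite (linD (D_lin m n)) hu hv addr0.
have s_abc : (-1) ^+ ((p (+) q) && r) = (-1) ^+ (p && r) * (-1) ^+ (q && r) :> k.
  by rewrite andb_addl signr_addb.
have bc := mv_local H qb rc; have ac := mv_local H pa rc.
have abc i := mv_local H (mv_par H i%:Z pa qb) rc.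
rewrite -[c](mv_vacr H).
apply: (zw_inj2 (g := fun m n l => D m n (pr c l vac))
  (g1 := fun m n l => (-1) ^+ (q && r) *: comm a c p r (pr b n vac) m l -
     (-1) ^+ (p && q) *: pr b n (comm a c p r vac m l))
  (g2 := fun m n l => pr a m (comm b c q r vac n l) -
     ((-1) ^+ (p && q) * (-1) ^+ (p && r)) *: comm b c q r (pr a m vac) n l -
     \sum_(i < M) binz m i *: comm (pr a i%:Z b) c (p (+) q) r vac (m + n - i%:Z) l)).
- move=> x y l.
  have -> : D x y (pr c l vac) = D x y (pr c l vac) -
     ((-1) ^+ (p && r) * (-1) ^+ (q && r)) *: pr c l (D x y vac).
    by rewrite D_vac (lin0 (linr _ _)) scaler0 subr0.
  have -> : \sum_(i < M) binz x i *: comm (pr a i%:Z b) c (p (+) q) r vac (x + y - i%:Z) l =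
     \sum_(i < M) binz x i *: pr (pr a i%:Z b) (x + y - i%:Z) (pr c l vac) -
     ((-1) ^+ (p && r) * (-1) ^+ (q && r)) *:
       pr c l (\sum_(i < M) binz x i *: pr (pr a i%:Z b) (x + y - i%:Z) vac).
    rewrite (lin_sum (linr _ _)) scaler_sumr -sumrB; apply: eq_bigr => i _.
    by rewrite (linZ (linr _ _)) /comm s_abc; linear_ring.
  by rewrite /D /comm !(linB (linr _ _)) !(linZ (linr _ _)); linear_ring.
- pose G n m l := comm a c p r (pr b n vac) m l.
  have h1 : zw_killed G by apply: (zw_killed_map (fun n => pr b n vac) (L := fun _ => id)) ac.
  have h2 : zw_killed (fun n m l => pr b n (comm a c p r vac m l)).
    by apply: (zw_killed_map (fun=> vac) (L := pr b)) ac => n'; apply: linr.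
  apply: zw_killed_ext (zw_killed_lin (fun=> - (-1) ^+ (p && q)) h2
    (zw_killedZ (fun=> (-1) ^+ (q && r)) h1)) => n' m' l.
  by rewrite /G; linear_ring.
- have h1 : zw_killed (fun m n l => pr a m (comm b c q r vac n l)).
    by apply: (zw_killed_map (fun=> vac) (L := pr a)) bc => m'; apply: linr.
  have h2 : zw_killed (fun m n l => comm b c q r (pr a m vac) n l).
    by apply: (zw_killed_map (fun m => pr a m vac) (L := fun _ => id)) bc.
  have h3 : zw_killed (fun m n l => \sum_(i < M) binz m i *:
      comm (pr a i%:Z b) c (p (+) q) r vac (m - i%:Z + n) l).
    apply: (zw_killed_sum _ (F := fun i m n l => binz m i *:
      comm (pr a i%:Z b) c (p (+) q) r vac (m - i%:Z + n) l)) => i.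
    exact: (zw_killedZ _ (zw_killed_shift (fun=> vac) _ (abc i))).
  apply: zw_killed_ext (zw_killed_lin (fun=> -1) h3 (zw_killed_lin
    (fun=> - ((-1) ^+ (p && q) * (-1) ^+ (p && r))) h2 h1)) => m' n' l.
  rewrite (eq_bigr (fun i : 'I_M => binz m' i *:
      comm (pr a i%:Z b) c (p (+) q) r vac (m' + n' - i%:Z) l)); last first.
    by move=> i _; rewrite addrAC.
  by linear_ring.
- by move=> x y l l0; rewrite (mv_vac0 H) // (lin0 (D_lin _ _)).
Qed.

Lemma commutator_formula m n v :
  pr a m (pr b n v) = (-1) ^+ (p && q) *: pr b n (pr a m v) +
    \sum_(i < M) binz m i *: pr (pr a i%:Z b) (m + n - i%:Z) v.
Proof.
by have /eqP := D0 m n v; rewrite /D !subr_eq add0r addrC => /eqP.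
Qed.

End Commutator.

(** ** Skew-symmetry *)

Section SkewSymmetry.
Variables (a b : V) (p q : bool) (pa : par p a) (qb : par q b).

(** The equation [T G = (d_z + d_w) G] for a series in nonnegative powers of [z]
    and [w] expresses [G] by its value at [z = 0]. *)
Let taylor (G : nat -> nat -> V) :
  (forall i l, T (G i l) = i.+1%:R *: G i.+1 l + l.+1%:R *: G i l.+1) ->
  forall i l, G i l = \sum_(j < i.+1)
     ((-1) ^+ j * binz (l + j)%:Z j) *: dpow T (i - j) (G 0%N (l + j)%N).
Proof.
move=> TG; elim=> [|i IH] l.
  by rewrite big_ord1 addn0 dpow0 mulr1 scale1r.
apply: (@natS_inj _ k0 _ i).
have -> : i.+1%:R *: G i.+1 l = T (G i l) - l.+1%:R *: G i l.+1 by rewrite TG addrK.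
rewrite (conv_leibniz (fun j t => ((-1) ^+ j * binz (l + j)%:Z j) *:
  dpow T t (G 0%N (l + j)%N)) i).
rewrite !IH (lin_sum T_lin) scaler_sumr -sumrB; apply: eq_bigr => j _.
rewrite [RHS]addrC (linZ T_lin) -(dpowS k0 T_lin); congr (_ + _); first by linear_ring.
rewrite -scaleNr !scalerA addSnnS; congr (_ *: _).
rewrite exprS [RHS]mulrCA (binzS' k0) (_ : (l + j.+1)%N%:Z - j%:Z = l.+1%:Z); last by lia.
by rewrite -[(l.+1%:Z)%:~R]/(l.+1%:R : k); ring.
Qed.

Let covariant_zw (f : int -> int -> V) (n : nat) :
  (forall m l, T (f m l) = - m%:~R *: f (m - 1) l - l%:~R *: f m (l - 1)) ->
  forall m l, T (iter n (@zw k V) f m l) =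
    - m%:~R *: iter n (@zw k V) f (m - 1) l - l%:~R *: iter n (@zw k V) f m (l - 1).
Proof.
move=> Tf; elim: n => // n IH m l; rewrite !iterS.
move: (iter n _ f) IH => g Tg; rewrite /zw (linB T_lin) !Tg.
by rewrite ?addrK ?subrK; linear_ring.
Qed.

(** [G = (z - w)^K Y(a, z) Y(b, w) vac] equals
    [+- (z - w)^K Y(b, w) Y(a, z) vac] for large [K], so it has only nonnegative
    powers of [z] and of [w].  At [w = 0] it is [z^K Y(a, z) b]; at [z = 0] it is
    [+- (-w)^K Y(b, w) a]; [taylor] expresses the former by the latter. *)
Theorem skew_symmetry (m : int) (L : nat) :
  (forall n : int, m + L%:Z <= n -> pr b n a = 0) ->
  pr a m b = (-1) ^+ (p && q) *:
    \sum_(s < L) (-1) ^ (m + s%:Z + 1) *: dpow T s (pr b (m + s%:Z) a).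
Proof.
move=> hL; have [n0 hn0] := mv_local H pa qb.
have [M hM] := mv_trunc H b a.
have [K [i [n0K arith0 arith arith1]]] := large_split m n0 M.
pose F m l := pr a m (pr b l vac); pose F' m l := pr b l (pr a m vac).
pose g := iter K (@zw k V) F.
have gE m' l' : g m' l' = (-1) ^+ (p && q) *: iter K (@zw k V) F' m' l'.
  have /eqP := zw_kill_le (hn0 vac) n0K m' l'.
  have -> : (fun m l => F m l - (-1) ^+ (p && q) *: F' m l) =
     (fun m l => - (-1) ^+ (p && q) *: F' m l + F m l).
    by apply/funext => x; apply/funext => y; linear_ring.
  by rewrite iter_zw_lin addrC scaleNr subr_eq0 => /eqP.
have TF m' l' : T (F m' l') = - m'%:~R *: F (m' - 1) l' - l'%:~R *: F m' (l' - 1).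
  rewrite /F (mv_T_der H) (mv_T_der H) (mv_T_vac H) (lin0 (linr _ _)) sub0r.
  by rewrite (linN (linr _ _)) (linZ (linr _ _)); linear_ring.
pose G (i l : nat) : V := g (-1 - i%:Z) (-1 - l%:Z).
have TG (j l : nat) : T (G j l) = j.+1%:R *: G j.+1 l + l.+1%:R *: G j l.+1.
  rewrite /G (covariant_zw _ TF).
  by rewrite !predN1 -scaleNr -!mulrNz !oppN1.
have := taylor TG i 0%N.
rewrite {1}/G (_ : -1 - 0%N%:Z = -1) // /g.
rewrite iter_zw_top_r => [|x y y0]; last by rewrite /F (mv_vac0 H) ?(lin0 (linr _ _)).
rewrite {1}/F (mv_vacr H) arith0.
move=> ->; rewrite scaler_sumr.
rewrite (reindex_inj rev_ord_inj) /=.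
pose f (s : nat) := (-1) ^+ (p && q) *: ((-1) ^ (m + s%:Z + 1) *: dpow T s (pr b (m + s%:Z) a)).
rewrite (eq_bigr (fun s : 'I_i.+1 => f s)); last first.
  move=> s _; have si : (s <= i)%N by rewrite -ltnS.
  rewrite subKn // add0n (binzz k0) mulr1 subSS /G subr0 gE.
  rewrite iter_zw_top_l => [|x y x0]; last by rewrite /F' (mv_vac0 H) ?(lin0 (linr _ _)).
  rewrite /F' (mv_vacr H) (arith s si).
  rewrite !(linZ (dpow_lin T_lin s)) /f !scalerA; congr (_ *: _).
  have -> : m + s%:Z + 1 = K%:Z - (i - s)%N%:Z by rewrite -(arith s si); ring.
  by rewrite signzB; ring.
have f0 t : L%:Z <= t%:Z -> f t = 0.
  by move=> Lt; rewrite /f hL ?(lin0 (dpow_lin T_lin _)) ?scaler0 // lerD2l.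
apply: (sum_trunc (f := f)) => t le; last by apply: f0.
by rewrite /f hM ?(lin0 (dpow_lin T_lin _)) ?scaler0 // arith1.
Qed.

End SkewSymmetry.

Lemma dpow_mode_left t u n v :
  pr (dpow T t u) n v = ((-1) ^+ t * binz n t) *: pr u (n - t%:Z) v.
Proof.
elim: t n => [|t IH] n; first by rewrite dpow0 subr0 mulr1 scale1r.
apply: (@natS_inj _ k0 _ t).
have <- := linZ (linl n v) _ (dpow T t.+1 u).
rewrite (dpowS k0 T_lin) (mv_T_mode H) IH !scalerA.
rewrite (_ : n - 1 - t%:Z = n - t.+1%:Z); last by lia.
by congr (_ *: _); rewrite [RHS]mulrCA (binzS k0) exprS; ring.
Qed.

(** ** The associativity formula *)

Section Associativity.
Variables (a b c : V) (p q r : bool).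
Hypotheses (pa : par p a) (qb : par q b) (rc : par r c).
Variables (m n : int).

Let first_part I : (forall l : int, n + I%:Z <= l -> pr c l b = 0) ->
  \sum_(i < I) (-1) ^ (n + i%:Z + 1) *: dpow T i (pr a m (pr c (n + i%:Z) b)) =
  (-1) ^+ (q && r) *:
    \sum_(j < I) ((-1) ^+ j * binz m j) *: pr a (m - j%:Z) (pr b (n + j%:Z) c).
Proof.
move=> hI.
pose G j t := ((-1) ^ (n + (j + t)%N%:Z + 1) * ((-1) ^+ j * binz m j)) *:
  pr a (m - j%:Z) (dpow T t (pr c (n + (j + t)%N%:Z) b)).
transitivity (\sum_(j < I) \sum_(t < I - j) G j t).
  rewrite triangle_sum; apply: eq_bigr => i _.
  rewrite (dpow_mode k0 T_lin (linr a) (mv_T_der H a)) scaler_sumr.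
  by apply: eq_bigr => j _; rewrite /G subnKC 1?leq_ord // scalerA.
rewrite scaler_sumr; apply: eq_bigr => j _.
have bound (l : int) : n + j%:Z + (I - j)%N%:Z <= l -> pr c l b = 0.
  by move=> le; apply: hI; move: le (ltn_ord j); clear; lia.
rewrite (skew_symmetry qb rc bound) (linZ (linr _ _)) (lin_sum (linr _ _)).
rewrite !scaler_sumr; apply: eq_bigr => t _.
rewrite /G (linZ (linr _ _)) PoszD addrA !scalerA; congr (_ *: _).
by case: (q && r); ring.
Qed.

Let second_part I M :
  (forall l : int, M%:Z <= l -> pr c l a = 0) ->
  (forall (j : nat) (l : int), (j < M)%N -> m + n - j%:Z + I%:Z <= l ->
     pr (pr a j%:Z c) l b = 0) ->
  \sum_(j < M) ((-1) ^+ j * binz m j) *: pr b (m + n - j%:Z) (pr a j%:Z c) =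
  - ((-1) ^ m * (-1) ^+ (q && (p (+) r)) * (-1) ^+ (p && r)) *:
  \sum_(i < I) (-1) ^ (n + i%:Z + 1) *: dpow T i
    (\sum_(l < M) binz (n + i%:Z) l *: pr (pr c l%:Z a) (n + i%:Z + m - l%:Z) b).
Proof.
move=> hM hI.
pose X i l := dpow T i (pr (pr c l%:Z a) (n + i%:Z + m - l%:Z) b).
pose sg := (-1) ^ m * (-1) ^+ (q && (p (+) r)) * (-1) ^+ (p && r) : k.
pose G i j t := (- sg * (-1) ^ (n + i%:Z + 1) *
   ((-1) ^+ j * binz m j * binz (n + i%:Z + m - j%:Z) t)) *: X i (j + t)%N.
transitivity (\sum_(j < M) \sum_(i < I) \sum_(t < M - j) G i j t).
  apply: eq_bigr => j _.
  have bound (l : int) : m + n - j%:Z + I%:Z <= l -> pr (pr a j%:Z c) l b = 0.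
    by apply: hI.
  rewrite (skew_symmetry qb (mv_par H j%:Z pa rc) bound) !scaler_sumr.
  apply: eq_bigr => i _.
  have bound' (l : int) : j%:Z + (M - j)%N%:Z <= l -> pr c l a = 0.
    by move=> le; apply: hM; move: le (ltn_ord j); clear; lia.
  rewrite (skew_symmetry pa rc bound').
  rewrite (linZ (linl _ _)) (lin_sum (linl _ _)).
  rewrite (linZ (dpow_lin T_lin _)) (lin_sum (dpow_lin T_lin _)) !scaler_sumr.
  apply: eq_bigr => t _.
  rewrite (linZ (linl _ _)) dpow_mode_left !(linZ (dpow_lin T_lin _)) /G /X PoszD.
  rewrite (_ : m + n - j%:Z + i%:Z - t%:Z = n + i%:Z + m - (j%:Z + t%:Z)); last by ring.
  rewrite (_ : m + n - j%:Z + i%:Z = n + i%:Z + m - j%:Z); last by ring.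
  rewrite !scalerA; congr (_ *: _); rewrite /sg.
  rewrite !signzD !signzN -!exprnP.
  rewrite -[(-1) ^+ j]signr_odd -[(-1) ^+ t]signr_odd.
  by case: (odd j); case: (odd t); ring.
rewrite exchange_big scaler_sumr; apply: eq_bigr => i _ /=.
rewrite (triangle_sum (G i)) (lin_sum (dpow_lin T_lin _)) !scaler_sumr.
apply: eq_bigr => l _.
rewrite (linZ (dpow_lin T_lin _)) -/(X i l) -(addrK m (n + i%:Z)) -(binz_alt k0) addrK.
rewrite scaler_suml !scaler_sumr; apply: eq_bigr => j _.
by rewrite /G subnKC 1?leq_ord // !scalerA.
Qed.

(** Skew-symmetry turns [(a_(m) b)_(n) c] into a sum of [T^(i) c_(l) a_(m) b], and
    the commutator formula moves [c_(l)] past [a_(m)].  By skew-symmetry again,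
    the terms [a_(m) c_(l) b] give the [a_(m-i) b_(n+i) c] ([first_part]) and the
    terms with [c_(l) a] give the [b_(m+n-i) a_(i) c] ([second_part]). *)
Theorem associativity L :
  (forall l : int, n + L%:Z <= l -> pr b l c = 0) ->
  (forall l : int, L%:Z <= l -> pr a l c = 0) ->
  pr (pr a m b) n c = \sum_(i < L) ((-1) ^+ i * binz m i) *:
    (pr a (m - i%:Z) (pr b (n + i%:Z) c) -
     ((-1) ^ m * (-1) ^+ (p && q)) *: pr b (m + n - i%:Z) (pr a i%:Z c)).
Proof.
move=> hLb hLa.
have [M1 hM1] := mv_trunc H c a; have [M2 hM2] := mv_trunc H a c.
have [B1 hB1] := mv_trunc H c b; have [B2 hB2] := mv_trunc H c (pr a m b).
have [B4 hB4] := mv_trunc H b c.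
pose M := (M1 + M2)%N.
have hM1' (l : int) : M%:Z <= l -> pr c l a = 0.
  by move=> le; apply/hM1/(le_trans _ le); rewrite lez_nat leq_addr.
have hM2' (l : int) : M%:Z <= l -> pr a l c = 0.
  by move=> le; apply/hM2/(le_trans _ le); rewrite lez_nat leq_addl.
have [B3 hB3] : exists B : nat, forall (j : nat) (l : int), (j < M)%N -> B%:Z <= l ->
    pr (pr a j%:Z c) l b = 0.
  elim: M {hM1' hM2'} => [|M' [B hB]]; first by exists 0%N.
  have [B' hB'] := mv_trunc H (pr a M'%:Z c) b; exists (B + B')%N => j l.
  rewrite ltnS leq_eqVlt => /orP[/eqP ->|lt] le.
    by apply/hB'/(le_trans _ le); rewrite lez_nat leq_addl.
  by apply: hB => //; apply: (le_trans _ le); rewrite lez_nat leq_addr.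
have [I [hI1 hI2]] := large_shift n (m + n) (B1 + B2 + B4 + B3) M.
have e1 : B1%:Z <= n + I%:Z by apply: le_trans hI1; rewrite lez_nat -!addnA leq_addr.
have e2 : B2%:Z <= n + I%:Z by apply: le_trans hI1; rewrite lez_nat -!addnA addnCA leq_addr.
have e4 : B4%:Z <= n + I%:Z.
  by apply: le_trans hI1; rewrite lez_nat addnAC leq_addl.
rewrite (skew_symmetry (L := I) (mv_par H m pa qb) rc); last first.
  by move=> l le; apply/hB2/(le_trans e2).
rewrite (eq_bigr (fun i : 'I_I => (-1) ^+ (p && r) *:
    ((-1) ^ (n + i%:Z + 1) *: dpow T i (pr a m (pr c (n + i%:Z) b))) +
    (-1) ^ (n + i%:Z + 1) *: dpow T i
    (\sum_(l < M) binz (n + i%:Z) l *: pr (pr c l%:Z a) (n + i%:Z + m - l%:Z) b))); last first.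
  move=> i _; rewrite (commutator_formula rc pa hM1') (linD (dpow_lin T_lin _)).
  by rewrite (linZ (dpow_lin T_lin _)) andbC; linear_ring.
rewrite big_split -scaler_sumr /= first_part; last first.
  by move=> l le; apply/hB1/(le_trans e1).
set F2 := (X in _ + X).
have F2E : F2 = - ((-1) ^ m * (-1) ^+ (q && (p (+) r)) * (-1) ^+ (p && r)) *:
  \sum_(j < M) ((-1) ^+ j * binz m j) *: pr b (m + n - j%:Z) (pr a j%:Z c).
  rewrite (@second_part I M) // -/F2 => [|j l jM le]; last first.
    apply: hB3 => //; apply: (le_trans _ le); apply: le_trans (hI2 j jM).
    by rewrite lez_nat leq_addl.
  case: (signzP k m) => ->; case: (p); case: (q); case: (r) => /=; linear_ring.
have -> : \sum_(j < I) ((-1) ^+ j * binz m j) *: pr a (m - j%:Z) (pr b (n + j%:Z) c) =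
    \sum_(j < L) ((-1) ^+ j * binz m j) *: pr a (m - j%:Z) (pr b (n + j%:Z) c).
  apply: (sum_trunc (f := fun j =>
    ((-1) ^+ j * binz m j) *: pr a (m - j%:Z) (pr b (n + j%:Z) c))) => j le.
    by rewrite hB4 ?(lin0 (linr _ _)) ?scaler0 //; apply: (le_trans e4); rewrite lerD2l.
  by rewrite hLb ?(lin0 (linr _ _)) ?scaler0 // lerD2l.
have -> : F2 = - ((-1) ^ m * (-1) ^+ (q && (p (+) r)) * (-1) ^+ (p && r)) *:
  \sum_(j < L) ((-1) ^+ j * binz m j) *: pr b (m + n - j%:Z) (pr a j%:Z c).
  rewrite F2E; congr (_ *: _).
  apply: (sum_trunc (f := fun j =>
    ((-1) ^+ j * binz m j) *: pr b (m + n - j%:Z) (pr a j%:Z c))) => j le.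
    by rewrite hM2' ?lez_nat // (lin0 (linr _ _)) scaler0.
  by rewrite hLa ?lez_nat // (lin0 (linr _ _)) scaler0.
rewrite [RHS](eq_bigr (fun i : 'I_L =>
   ((-1) ^+ i * binz m i) *: pr a (m - i%:Z) (pr b (n + i%:Z) c) -
   ((-1) ^ m * (-1) ^+ (p && q)) *: (((-1) ^+ i * binz m i) *:
     pr b (m + n - i%:Z) (pr a i%:Z c)))); last by move=> i _; linear_ring.
rewrite sumrB -scaler_sumr.
by case: (p); case: (q); case: (r) => /=; linear_ring.
Qed.

End Associativity.

End Borcherds.

(** * Li's filtration *)

Local Notation span := Defs.span.

Section Span.
Variables (k : fieldType) (V W : lmodType k).

Lemma span_gen (A : set V) v : A v -> span A v.
Proof.
move=> Av; exists [:: (1, v)]; rewrite big_seq1 scale1r; split=> // t.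
by rewrite inE => /eqP ->.
Qed.

Lemma subspace_sum (B : set V) (I : eqType) (r : seq I) (F : I -> V) :
  subspace B -> (forall i, i \in r -> B (F i)) -> B (\sum_(i <- r) F i).
Proof.
move=> sB; elim: r => [|i r IH] h; first by rewrite big_nil; apply: subspace0.
rewrite big_cons; apply: subspaceD => //; first by apply: h; rewrite mem_head.
by apply: IH => j jr; apply: h; rewrite inE jr orbT.
Qed.

Lemma subspace_sum_ord (B : set V) n (F : 'I_n -> V) :
  subspace B -> (forall i, B (F i)) -> B (\sum_i F i).
Proof. by move=> sB h; apply: subspace_sum. Qed.

Lemma span_sub (A B : set V) : subspace B -> A `<=` B -> span A `<=` B.
Proof.
move=> sB AB v [s [sA ->]]; apply: subspace_sum => // t /sA At.
by apply: subspaceZ => //; apply: AB.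
Qed.

Lemma subspace_preimage (B : set W) (f : V -> W) :
  linear f -> subspace B -> subspace (fun v => B (f v)).
Proof.
move=> f_lin [B0 BD]; split=> [|c u v Bu Bv]; first by rewrite (lin0 f_lin).
by rewrite f_lin; apply: BD.
Qed.

End Span.

Lemma span_map (k : fieldType) (V W : lmodType k) (A : set V) (B : set W) (f : V -> W) :
  linear f -> subspace B -> (forall v, A v -> B (f v)) ->
  forall v, span A v -> B (f v).
Proof. by move=> f_lin sB AB; apply: span_sub => //; apply: subspace_preimage. Qed.

Section VacuumModes.
Variables (k : fieldType) (N : nat) (V : lmodType k) (par : bool -> set V).
Variables (vac : V) (T : V -> V) (S : 'I_N -> V -> V) (pr : V -> int -> V -> V).
Hypothesis k0 : [pchar k] =i pred0.
Hypothesis H : mode_va par vac T S pr.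

Lemma mv_T_pr a : T a = pr a (-2) vac.
Proof.
rewrite -{1}[a](mv_vacr H) (mv_T_der H) (mv_T_vac H) (lin0 (mv_linr H _ _)).
by rewrite sub0r mulrN1z scaleN1r opprK.
Qed.

Lemma mv_vacl b : pr vac (-1) b = b.
Proof.
move: b; apply: (par_ind (mv_super H)) => [u v hu hv|q b qb].
  by rewrite (linD (mv_linr H _ _)) hu hv.
rewrite (skew_symmetry k0 H (L := 1) (mv_vac_par H) qb); last first.
  by move=> n n0; rewrite (mv_vac0 H).
by rewrite big_ord1 dpow0 !addr0 (mv_vacr H) !scale1r.
Qed.

End VacuumModes.

Section LiFiltration.
Variables (k : fieldType) (N : nat) (V : lmodType k) (par : bool -> set V).
Variables (vac : V) (T : V -> V) (S : 'I_N -> V -> V).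
Variable Y : V -> fseries N (V -> V).
Hypothesis k0 : [pchar k] =i pred0.
Hypothesis Hva : susy_va par vac T S Y.

Local Notation pr := (coef_mode Y finset.set0).
Local Notation E := (li_filtration Y).
Let H := susy_va_modes k0 Hva.

Lemma pr_mode a n v : pr a n v = mode (Y a) n [set: 'I_N]%SET v.
Proof. by rewrite /mode /coef_mode finset.setCT. Qed.

Lemma mode_pr a n K v : mode (Y a) n K v = pr (oddmono S (~: K)%SET a) n v.
Proof. exact: (md_oddmono k0 Hva). Qed.

Lemma li_sub n : subspace (E n).
Proof. exact: fil_sub. Qed.

Lemma li_decr m n : m <= n -> E n `<=` E m.
Proof.
move=> mn; apply: span_sub; first exact: li_sub.
move=> v [s [b [s0 ns ->]]]; apply: span_gen; exists s, b; split=> //.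
exact: le_trans ns.
Qed.

Lemma li_le m n v : E n v -> m <= n -> E m v.
Proof. by move=> Ev mn; apply: li_decr Ev. Qed.

Lemma li_le0 n v : n <= 0 -> E n v.
Proof.
move=> n0; apply: span_gen; exists [:: (vac, 0%N, [set: 'I_N]%SET)], v.
by split; rewrite ?big_seq1 //= -pr_mode subr0 (mv_vacl k0 H).
Qed.

Lemma li_neg_mode a n m u : E n u -> m < 0 -> E (n - 1 - m) (pr a m u).
Proof.
case: m => // j + _; apply: span_map; [exact: (mv_linr H) | exact: li_sub |].
move=> v [s [b [s0 ns ->]]]; apply: span_gen.
exists ((a, j, [set: 'I_N]%SET) :: s), b; split=> //.
  by rewrite big_cons /=; move: ns; clear; lia.
by rewrite pr_mode /=; congr (mode _ _ _ _); lia.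
Qed.

(** As [mode_pr] replaces each [a_(-1-j|K)] by a mode of an even field, the
    generators of [E_n] may be taken to be built by such modes, from vectors of
    pure parity.  The commutator and associativity formulas apply to these. *)
Lemma li_ind_pure (Q : int -> set V) :
  (forall n v, n <= 0 -> Q n v) ->
  (forall p a q u (j : nat) n, par p a -> par q u -> E (n - j%:Z) u -> Q (n - j%:Z) u ->
     Q n (pr a (-1 - j%:Z) u)) ->
  forall n v, E n v -> span [set x | [/\ E n x, Q n x & exists q, par q x]] v.
Proof.
move=> Q0 QS n; apply: span_sub; first exact: span_subspace.
move=> _ [s [b [_ ns ->]]].
elim: s n ns => [|[[a j] K] s IH] n /= ns.
  rewrite big_nil in ns.
  have [b0 [b1 [pb0 pb1 ->]]] := super_sum (mv_super H) b.
  apply: subspaceD; first exact: span_subspace.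
    by apply: span_gen; split; [exact: li_le0 | exact: Q0 | exists false].
  by apply: span_gen; split; [exact: li_le0 | exact: Q0 | exists true].
rewrite big_cons /= in ns.
have ns' : n - j%:Z <= (\sum_(t <- s) t.1.2)%N%:Z by move: ns; clear; lia.
rewrite mode_pr; move: (oddmono _ _ a) => {}a.
move: (IH _ ns'); apply: span_map; [exact: (mv_linr H) | exact: span_subspace |].
move=> u [Eu Qu [q qu]].
have [a0 [a1 [pa0 pa1 ->]]] := super_sum (mv_super H) a.
rewrite (linD (mv_linl H _ _)).
have e : n = n - j%:Z - 1 - (-1 - j%:Z) by move: ns; clear; lia.
have neg : -1 - j%:Z < 0 by clear; lia.
apply: subspaceD; first exact: span_subspace.
  apply: span_gen; split; first by rewrite e; apply: li_neg_mode.
    exact: (QS _ _ _ _ _ _ pa0 qu Eu Qu).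
  by exists (false (+) q); apply: (mv_par H).
apply: span_gen; split; first by rewrite e; apply: li_neg_mode.
  exact: (QS _ _ _ _ _ _ pa1 qu Eu Qu).
by exists (true (+) q); apply: (mv_par H).
Qed.

Lemma li_ind (Q : int -> set V) :
  (forall n, subspace (Q n)) -> (forall n v, n <= 0 -> Q n v) ->
  (forall p a q u (j : nat) n, par p a -> par q u -> E (n - j%:Z) u -> Q (n - j%:Z) u ->
     Q n (pr a (-1 - j%:Z) u)) ->
  forall n v, E n v -> Q n v.
Proof.
move=> Qsub Q0 QS n v /(li_ind_pure Q0 QS); apply: span_sub => //.
by move=> u [].
Qed.

Lemma li_super n : subsuperspace par (E n).
Proof.
split; first exact: li_sub.
pose B v := exists v0 v1, [/\ E n v0 /\ par false v0, E n v1 /\ par true v1 & v = v0 + v1].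
have sp p : subspace (par p) by exact: super_sub (mv_super H) p.
have sB : subspace B.
  split.
    exists 0, 0; rewrite addr0; split=> //; split;
      by [exact: subspace0 (li_sub n) | exact: subspace0 (sp _)].
  move=> c _ _ [u0 [u1 [[? ?] [? ?] ->]]] [v0 [v1 [[? ?] [? ?] ->]]].
  exists (c *: u0 + v0), (c *: u1 + v1); split.
  - by split; [apply: (li_sub n).2 | apply: (sp false).2].
  - by split; [apply: (li_sub n).2 | apply: (sp true).2].
  - by linear_ring.
move=> v Ev; have := @li_ind_pure (fun _ => setT) (fun _ _ _ => I)
  (fun _ _ _ _ _ _ _ _ _ _ => I) n v Ev.
apply: (@span_sub _ _ _ B) => // u [Eu _ [[] pu]]; [exists 0, u | exists u, 0];
  rewrite ?add0r ?addr0; split=> //; split;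
  by [exact: subspace0 (li_sub n) | exact: subspace0 (sp _)].
Qed.

Lemma li_pure_ind n (B : set V) : subspace B ->
  (forall q v, E n v -> par q v -> B v) -> E n `<=` B.
Proof.
move=> sB h v /(li_super n).2[v0 [v1 [[? ?] [? ?] ->]]].
by apply: subspaceD => //; [apply: (h false) | apply: (h true)].
Qed.

(** Induction on the generators [b_(-1-j) u]: in
    [a_(m) b_(-1-j) u = +- b_(-1-j) a_(m) u + sum_i C(m, i) (a_(i) b)_(m-1-j-i) u]
    the modes of [a_(i) b] are either negative, and bounded by
    [li_neg_mode], or nonnegative, and bounded by induction on [u]. *)
Lemma li_nonneg_mode a n m u : E n u -> 0 <= m -> E (n - m) (pr a m u).
Proof.
move: a; apply: (par_ind (mv_super H)) => [a b ha hb Eu m0|p a pa].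
  by rewrite (linD (mv_linl H _ _)); apply: subspaceD; [exact: li_sub | apply: ha | apply: hb].
move=> Eu m0.
pose Q n u := forall p a (m : nat), par p a -> E (n - m%:Z) (pr a m%:Z u).
suff QE: Q n u by case: m m0 => // m _; exact: QE pa.
move: n u Eu {p a pa m m0}; apply: li_ind.
- move=> n; split=> [p a m pa|c u v hu hv p a m pa].
    by rewrite (lin0 (mv_linr H _ _)); apply: subspace0; apply: li_sub.
  rewrite (mv_linr H _ _ c); apply: (li_sub _).2; [exact: hu pa | exact: hv pa].
- by move=> n v n0 p a m pa; apply: li_le0; rewrite lerBlDr add0r (le_trans n0).
move=> q b t u j n qb tu Eu Qu p a m pa.
have [M hM] := mv_trunc H a b.
rewrite (commutator_formula k0 H pa qb hM); apply: subspaceD; first exact: li_sub.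
  apply: subspaceZ; first exact: li_sub.
  have -> : n - m%:Z = (n - j%:Z - m%:Z) - 1 - (-1 - j%:Z) by clear; lia.
  by apply: li_neg_mode; [exact: Qu pa | clear; lia].
apply: subspace_sum_ord => [|i]; first exact: li_sub.
apply: subspaceZ; first exact: li_sub.
have [neg|] := ltrP (m%:Z + (-1 - j%:Z) - i%:Z) 0.
  by apply: (li_le (li_neg_mode (pr a i b) Eu neg)); clear; lia.
case e : (m%:Z + (-1 - j%:Z) - i%:Z) => [m'|//] _.
apply: (li_le (Qu _ _ m' (mv_par H i pa qb))).
by move: e; clear; lia.
Qed.

(** Induction on the generators [a_(-1-j) u] of [E_r]: associativity expands
    [(a_(-1-j) u)_(m) v] in [a_(-1-j-i) u_(m+i) v] and
    [u_(-1-j+m-i) a_(i) v].  The extra step for [m >= 0] comes from [m + i >= 0]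
    in the first, and from the nonnegative mode [a_(i)] in the second. *)
Lemma li_mode r s u v m : E r u -> E s v ->
  E (r + s - m - 1) (pr u m v) /\ (0 <= m -> E (r + s - m) (pr u m v)).
Proof.
pose Q r u := forall s v m, E s v ->
  E (r + s - m - 1) (pr u m v) /\ (0 <= m -> E (r + s - m) (pr u m v)).
suff h : forall r u, E r u -> Q r u by move=> Eu Ev; exact: h Ev.
move=> {r s u v m}; apply: li_ind.
- move=> r; split=> [s v m _|c u u' hu hu' s v m Ev].
    by rewrite (lin0 (mv_linl H _ _)); split=> *; apply: subspace0; apply: li_sub.
  rewrite (mv_linl H _ _ c); have [h1 h2] := hu s v m Ev; have [h3 h4] := hu' s v m Ev.
  by split=> [|m0]; apply: (li_sub _).2; auto.
- move=> r u r0 s v m Ev; have [m0|m0] := ltrP m 0.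
    split=> [|m0']; last by move: m0 m0'; clear; lia.
    by apply: (li_le (li_neg_mode u Ev m0)); move: r0; clear; lia.
  by have h := li_nonneg_mode u Ev m0; split=> [|_]; apply: (li_le h);
    move: r0; clear; lia.
move=> p a q u j r pa qu Eu Qu s v m.
pose B v := E (r + s - m - 1) (pr (pr a (-1 - j%:Z) u) m v) /\
   (0 <= m -> E (r + s - m) (pr (pr a (-1 - j%:Z) u) m v)).
rewrite -/(B v).
move: v; apply: li_pure_ind.
  split=> [|c x y [h1 h2] [h3 h4]].
    by rewrite /B (lin0 (mv_linr H _ _)); split=> *; apply: subspace0; apply: li_sub.
  by rewrite /B (mv_linr H _ _ c); split=> [|m0]; apply: (li_sub _).2; auto.
move=> t v Ev tv; rewrite /B.
have [L [hL1 hL2]] : exists L : nat, (forall l : int, m + L%:Z <= l -> pr u l v = 0) /\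
    (forall l : int, L%:Z <= l -> pr a l v = 0).
  have [L1 h1] := mv_trunc H u v; have [L2 h2] := mv_trunc H a v.
  have [L [hL _]] := large_shift m 0 (L1 + L2) 0.
  exists (L + L2)%N; split=> l le; [apply: h1 | apply: h2];
    by move: hL le; clear; lia.
rewrite (associativity k0 H pa qu tv _ hL1 hL2); split=> [|m0].
all: apply: subspace_sum_ord => [|i]; first exact: li_sub.
all: apply: subspaceZ; first exact: li_sub.
all: apply: subspaceD; [exact: li_sub | | apply: subspaceN; [exact: li_sub|
   apply: subspaceZ; first exact: li_sub]].
- have [Ex _] := Qu s v (m + i%:Z) Ev.
  have neg : -1 - j%:Z - i%:Z < 0 by clear; lia.
  by apply: (li_le (li_neg_mode a Ex neg)); clear; lia.
- have Ex := li_nonneg_mode a Ev (isT : 0 <= i%:Z).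
  have [Ey _] := Qu _ _ (-1 - j%:Z + m - i%:Z) Ex.
  by apply: (li_le Ey); clear; lia.
- have [_ Ex] := Qu s v (m + i%:Z) Ev.
  have neg : -1 - j%:Z - i%:Z < 0 by clear; lia.
  have mi : 0 <= m + i%:Z by rewrite addr_ge0.
  by apply: (li_le (li_neg_mode a (Ex mi) neg)); clear; lia.
- have Ex := li_nonneg_mode a Ev (isT : 0 <= i%:Z).
  have [Ey _] := Qu _ _ (-1 - j%:Z + m - i%:Z) Ex.
  by apply: (li_le Ey); clear; lia.
Qed.

Lemma li_T n u : E n u -> E (n + 1) (T u).
Proof.
move=> Eu; rewrite (mv_T_pr H).
have [h _] := li_mode (-2) Eu (li_le0 vac (lexx 0)).
by apply: (li_le h); clear; lia.
Qed.

Lemma li_S i n u : E n u -> E n (S i u).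
Proof.
move: n u; apply: li_ind => [n|n v n0|p a q u j n pa qu Eu ESu].
- by apply: subspace_preimage; [exact: (mv_S_lin H) | exact: li_sub].
- exact: li_le0.
have e : n = n - j%:Z - 1 - (-1 - j%:Z) by clear; lia.
have neg : -1 - j%:Z < 0 by clear; lia.
rewrite (mv_S_der H _ _ _ pa); apply: subspaceD; first exact: li_sub.
  by rewrite e; apply: li_neg_mode.
by apply: subspaceZ; [exact: li_sub | rewrite e; apply: li_neg_mode].
Qed.

End LiFiltration.

(** * The associated graded space *)

Section AssociatedGraded.
Variables (k : fieldType) (V : lmodType k) (F : filtration V).
Hypothesis F_le0 : forall (n : int) v, n <= 0 -> F n v.
Hypothesis F_le : forall (m n : int) v, F n v -> m <= n -> F m v.

Let sF (n : int) : subspace (F n) := fil_sub F n.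

Lemma graded_ext (x y : graded F) :
  (forall n : nat, exists u v, [/\ gval x n = coset (F n.+1) u,
     gval y n = coset (F n.+1) v & F n.+1 (u - v)]) -> x = y.
Proof.
move=> h; apply: graded_eq; apply: funext => n.
by have [u [v [-> -> uv]]] := h n; apply/coset_eq.
Qed.

Lemma gval_add (x y : graded F) (n : nat) u v :
  gval x n = coset (F n.+1) u -> gval y n = coset (F n.+1) v ->
  gval (x + y) n = coset (F n.+1) (u + v).
Proof. exact: gaddE. Qed.

Lemma gval_scale c (x : graded F) (n : nat) u :
  gval x n = coset (F n.+1) u -> gval (c *: x) n = coset (F n.+1) (c *: u).
Proof. exact: gscaleE. Qed.

Lemma gval0 (n : nat) : gval (0 : graded F) n = coset (F n.+1) 0.
Proof. by []. Qed.

Lemma gval_sum (X : nat -> graded F) (u : nat -> V) (n M : nat) :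
  (forall i, gval (X i) n = coset (F n.+1) (u i)) ->
  gval (\sum_(i < M) X i) n = coset (F n.+1) (\sum_(i < M) u i).
Proof.
move=> h; elim: M => [|M IH]; first by rewrite !big_ord0 gval0.
by rewrite !big_ord_recr; apply: gval_add.
Qed.

Definition class_rep (m : int) (v : V) (n : nat) : V :=
  if (n%:Z == m) && `[< F m v >] then v else 0.

Lemma class_rep_in m v (n : nat) : F n (class_rep m v n).
Proof.
by rewrite /class_rep; case: ifP => [/andP[/eqP -> /asboolP]|_] //; apply: subspace0.
Qed.

Lemma class_rep_fin m v :
  exists M : nat, forall n, (M <= n)%N -> F n.+1 (class_rep m v n).
Proof.
exists (absz m).+1 => n le; rewrite /class_rep; case: ifP => [/andP[/eqP e _]|_].
  by move: e le; clear; case: m => //= m [->]; rewrite ltnn.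
exact: subspace0.
Qed.

(** The class [v + E_{m+1}] of a vector [v] of [E_m], placed in degree [m].  For
    [m < 0] it is 0, in accordance with [E_m = E_{m+1} = V]; the degrees may
    therefore be arbitrary integers in what follows. *)
Definition gcl (m : int) (v : V) : graded F :=
  mk_graded (class_rep_in m v) (class_rep_fin m v).

Lemma gclE m v (n : nat) : F m v ->
  gval (gcl m v) n = coset (F n.+1) (if n%:Z == m then v else 0).
Proof. by move=> Fv; rewrite /= /class_rep asboolT // andbT. Qed.

Lemma is_classE x m v : is_class x m v <-> F m v /\ x = gcl m v.
Proof.
split=> [[Fv e]|[Fv ->]]; split=> //.
  by apply: graded_eq; rewrite e; apply: funext => n; rewrite gclE.
by apply: funext => n; rewrite gclE.
Qed.

Lemma gcl_lin m c u v : F m u -> F m v ->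
  gcl m (c *: u + v) = c *: gcl m u + gcl m v.
Proof.
move=> Fu Fv; apply: graded_ext => n.
exists (if n%:Z == m then c *: u + v else 0).
exists (c *: (if n%:Z == m then u else 0) + (if n%:Z == m then v else 0)).
rewrite gclE; last by apply: (sF m).2.
split=> //; first by apply: gval_add; [apply: gval_scale; rewrite gclE | rewrite gclE].
by case: eqP => _; rewrite ?scaler0 ?addr0 subrr; apply: subspace0.
Qed.

Lemma gcl_eq0 m v : F (m + 1) v -> gcl m v = 0.
Proof.
move=> Fv; apply: graded_ext => n; exists (if n%:Z == m then v else 0), 0.
rewrite gval0 gclE; last by apply: F_le Fv _; rewrite lerDl.
split=> //; rewrite subr0; case: eqP => [e|_]; last by apply: subspace0.
by rewrite -addn1 PoszD e.
Qed.

Lemma gcl_neg m v : m < 0 -> gcl m v = 0.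
Proof. by move=> m0; apply/gcl_eq0/F_le0; move: m0; clear; lia. Qed.

Lemma gcl0 m : gcl m 0 = 0.
Proof. by apply: gcl_eq0; apply: subspace0. Qed.

Lemma gclD m u v : F m u -> F m v -> gcl m (u + v) = gcl m u + gcl m v.
Proof. by move=> Fu Fv; have := gcl_lin 1 Fu Fv; rewrite !scale1r. Qed.

Lemma gclZ m c u : F m u -> gcl m (c *: u) = c *: gcl m u.
Proof.
by move=> Fu; have := gcl_lin c Fu (subspace0 (sF m)); rewrite gcl0 !addr0.
Qed.

Lemma gcl_sum m M (u : nat -> V) : (forall i, F m (u i)) ->
  gcl m (\sum_(i < M) u i) = \sum_(i < M) gcl m (u i).
Proof.
move=> Fu; elim: M => [|M IH]; first by rewrite !big_ord0 gcl0.
by rewrite !big_ord_recr gclD ?IH //; apply: subspace_sum_ord.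
Qed.

Lemma gcl_eq m u v : F m u -> F (m + 1) (u - v) -> gcl m u = gcl m v.
Proof.
move=> Fu Fuv; have Fuv' : F m (u - v) by apply: F_le Fuv _; rewrite lerDl.
have Fv : F m v.
  have -> : v = u + - (u - v) by rewrite opprB addrCA subrr addr0.
  by apply: subspaceD => //; apply: subspaceN.
by apply/eqP; rewrite -subr_eq0 -[X in _ - X]scale1r -scaleNr addrC -gcl_lin //
   scaleN1r addrC gcl_eq0.
Qed.

Lemma graded_decomp (x : graded F) (v : nat -> V) (M : nat) :
  (forall n : nat, F n (v n)) -> (forall n, gval x n = coset (F n.+1) (v n)) ->
  (forall n, (M <= n)%N -> F n.+1 (v n)) ->
  x = \sum_(n < M) gcl n (v n).
Proof.
move=> vF xv hM; apply: graded_ext => n; exists (v n).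
exists (\sum_(i < M) if n%:Z == i%:Z then v i else 0); split=> //.
  by apply: (gval_sum (X := fun i => gcl i (v i))
    (u := fun i => if n%:Z == i%:Z then v i else 0)) => i; rewrite gclE.
have [nM|Mn] := ltnP n M.
  rewrite (bigD1 (Ordinal nM)) //= eqxx big1 ?addr0 ?subrr => [|i]; first exact: subspace0.
  by rewrite -val_eqE eq_sym /= eqz_nat => /negPf ->.
rewrite big1 ?subr0 => [|i _]; first exact: hM.
by rewrite eqz_nat; case: eqP => // e; move: (ltn_ord i) Mn; rewrite -e ltnNge => /negPf ->.
Qed.

Lemma coset_fin (x : graded F) (v : nat -> V) :
  (forall n, gval x n = coset (F n.+1) (v n)) ->
  exists M : nat, forall n, (M <= n)%N -> F n.+1 (v n).
Proof.
move=> xv; have [M hM] := (gvalP x).2; exists M => n /hM.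
by rewrite xv => /coset_eq; rewrite subr0; apply.
Qed.

Lemma graded_ind (P : graded F -> Prop) :
  (forall x y, P x -> P y -> P (x + y)) ->
  (forall (n : nat) v, F n v -> P (gcl n v)) -> forall x, P x.
Proof.
move=> PD Pcl x; have [M hM] := coset_fin (greprE x).
rewrite (graded_decomp (@grepr_in _ _ _ x) (greprE x) hM).
elim: M {hM} => [|M IH]; first by rewrite big_ord0 -(gcl0 0); exact: Pcl (subspace0 (sF 0%N)).
by rewrite big_ord_recr; apply: PD IH _; apply/Pcl/grepr_in.
Qed.

Lemma graded_ind_pure (par : bool -> set V) p (P : graded F -> Prop) :
  (forall p, subspace (par p)) ->
  (forall x y, P x -> P y -> P (x + y)) ->
  (forall (n : nat) v, F n v -> par p v -> P (gcl n v)) ->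
  forall x, graded_par par p x -> P x.
Proof.
move=> spar PD Pcl x px.
have [v hv] : exists v : nat -> V, forall n : nat,
    [/\ F n (v n), par p (v n) & gval x n = coset (F n.+1) (v n)].
  by have [v hv] := choice px; exists v.
have [M hM] := coset_fin (fun n => let: And3 _ _ e := hv n in e).
rewrite (@graded_decomp x v M) //; try by move=> n; case: (hv n).
elim: M {hM} => [|M IH].
  by rewrite big_ord0 -(gcl0 0); apply: (Pcl 0%N); apply: subspace0.
by rewrite big_ord_recr; apply: PD IH _; apply: Pcl; case: (hv M).
Qed.

Lemma gcl_par (par : bool -> set V) p m v :
  (forall p, subspace (par p)) -> F m v -> par p v -> graded_par par p (gcl m v).
Proof.
move=> spar Fv pv n; exists (if n%:Z == m then v else 0); split; last exact: gclE.
  by case: eqP => [->|_] //; apply: subspace0.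
by case: eqP => // _; apply: subspace0.
Qed.

Lemma graded_par_sub (par : bool -> set V) p :
  (forall p, subspace (par p)) -> subspace (@graded_par _ _ F par p).
Proof.
move=> spar; split=> [n|c x y hx hy n].
  by exists 0; split; [apply: subspace0 | apply: subspace0 | rewrite gval0].
have [u [Fu pu xu]] := hx n; have [v [Fv pv yv]] := hy n.
exists (c *: u + v); split; [exact: (sF n).2 | exact: (spar p).2 |].
by apply: gval_add => //; apply: gval_scale.
Qed.

Lemma graded_superspace (par : bool -> set V) :
  superspace par -> (forall n : int, subsuperspace par (F n)) ->
  superspace (@graded_par _ _ F par).
Proof.
move=> spar Fpar; have sp p := super_sub spar p; split.
- by move=> p; apply: graded_par_sub.
- apply: graded_ind => [x y|n v Fv].
    move=> [x0 [x1 [px0 px1 ->]]] [y0 [y1 [py0 py1 ->]]].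
    exists (x0 + y0), (x1 + y1); rewrite addrACA; split=> //.
      exact: subspaceD (graded_par_sub _ sp) px0 py0.
    exact: subspaceD (graded_par_sub _ sp) px1 py1.
  have [v0 [v1 [[Fv0 pv0] [Fv1 pv1] ->]]] := (Fpar n).2 v Fv.
  by exists (gcl n v0), (gcl n v1); rewrite gclD //; split=> //; apply: gcl_par.
move=> x p0 p1; apply: graded_ext => n.
have [u [Fu pu xu]] := p0 n; have [v [Fv pv xv]] := p1 n.
exists u, 0; rewrite subr0 gval0; split=> //.
have Fuv : F n.+1 (u - v) by apply/(coset_eq _ _ (sF _)); rewrite -xu -xv.
have [w0 [w1 [[Fw0 pw0] [_ pw1] e]]] := (Fpar n.+1).2 _ Fuv.
suff -> : u = w0 by [].
apply/eqP; rewrite -subr_eq0; apply/eqP/(super_disj spar).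
  by apply: subspaceD => //; apply: subspaceN.
have -> : u - w0 = w1 + v.
  by rewrite -[u](subrK v) e; linear_ring.
by apply: subspaceD.
Qed.

(** ** Maps out of the associated graded space *)

Section Extension.
Variable W : lmodType k.
Implicit Type Phi : nat -> V -> W.

(** The data of a linear map out of a direct sum of quotients. *)
Definition gadmissible Phi :=
  (forall (n : nat) c u v, F n u -> F n v -> Phi n (c *: u + v) = c *: Phi n u + Phi n v) /\
  (forall (n : nat) v, F n.+1 v -> Phi n v = 0).

(** The map with [gext Phi (gcl n v) = Phi n v] ([gext_gcl]), computed on chosen
    representatives of the components. *)
Definition gext Phi (x : graded F) : W :=
  \sum_(n < sval (cid (grepr_fin x))) Phi n (grepr x n).

Lemma gextE Phi x (v : nat -> V) (M : nat) :
  gadmissible Phi ->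
  (forall n : nat, F n (v n)) -> (forall n, gval x n = coset (F n.+1) (v n)) ->
  (forall n, (M <= n)%N -> F n.+1 (v n)) ->
  gext Phi x = \sum_(n < M) Phi n (v n).
Proof.
move=> [Phi_lin Phi0] vF xv hM; rewrite /gext; case: cid => M' hM' /=.
have e n : Phi n (grepr x n) = Phi n (v n).
  have Fd : F n.+1 (grepr x n - v n) by apply/coset_eq; rewrite -?greprE.
  rewrite -[grepr x n](subrK (v n)) -[_ - v n]scale1r Phi_lin //; last first.
    by apply: F_le Fd _; rewrite lez_nat.
  by rewrite scale1r (Phi0 _ _ Fd) add0r.
rewrite (eq_bigr (fun n : 'I_M' => Phi n (v n))) //.
apply: (sum_trunc (f := fun n => Phi n (v n))) => n le; last by apply/Phi0/hM.
by rewrite -e; apply/Phi0/hM'.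
Qed.

Lemma gext_lin Phi : gadmissible Phi -> linear (gext Phi).
Proof.
move=> aPhi c x y.
have [M1 h1] := grepr_fin x; have [M2 h2] := grepr_fin y.
have h1' n : (M1 + M2 <= n)%N -> F n.+1 (grepr x n).
  by move=> le; apply/h1/(leq_trans _ le); rewrite leq_addr.
have h2' n : (M1 + M2 <= n)%N -> F n.+1 (grepr y n).
  by move=> le; apply/h2/(leq_trans _ le); rewrite leq_addl.
rewrite (@gextE _ _ (fun n => c *: grepr x n + grepr y n) (M1 + M2)) //; first last.
- by move=> n le; apply: (sF _).2; [apply: h1' | apply: h2'].
- by move=> n; apply: gval_add; [apply: gval_scale|]; apply: greprE.
- by move=> n; apply: (sF _).2; apply: grepr_in.
rewrite (@gextE _ x (grepr x) (M1 + M2)) //; try by [exact: grepr_in|exact: greprE].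
rewrite (@gextE _ y (grepr y) (M1 + M2)) //; try by [exact: grepr_in|exact: greprE].
rewrite scaler_sumr -big_split; apply: eq_bigr => n _ /=.
by rewrite aPhi.1 //; apply: grepr_in.
Qed.

Lemma gext_gcl Phi (n : nat) v : gadmissible Phi -> F n v -> gext Phi (gcl n v) = Phi n v.
Proof.
move=> aPhi Fv; pose u (i : nat) := if i%:Z == n%:Z then v else 0.
have uF (i : nat) : F i (u i) by rewrite /u; case: eqP => [->|_] //; apply: subspace0.
rewrite (@gextE _ _ u n.+1) // => [|i|i le]; last 1 first.
- by rewrite /u eqz_nat gtn_eqF //; apply: subspace0.
- rewrite big_ord_recr /= {2}/u eqxx big1 ?add0r // => i _.
  by rewrite /u eqz_nat ltn_eqF //; apply: aPhi.2; apply: subspace0.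
- by rewrite gclE.
Qed.

End Extension.

Definition gop (e : int) (U : V -> V) : graded F -> graded F :=
  gext (fun n v => gcl (n%:Z + e) (U v)).

Definition gbil (e : int) (B : V -> V -> V) (x y : graded F) : graded F :=
  gext (fun r a => gext (fun s b => gcl (r%:Z + s%:Z + e) (B a b)) y) x.

Section InducedOperator.
Variables (e : int) (U : V -> V).
Hypotheses (U_lin : linear U) (U_fil : forall (n : int) v, F n v -> F (n + e) (U v)).

Lemma gop_adm : gadmissible (fun n v => gcl (n%:Z + e) (U v)).
Proof.
split=> [n c u v Fu Fv|n v Fv]; first by rewrite U_lin gcl_lin //; apply: U_fil.
by apply: gcl_eq0; rewrite addrAC; apply: U_fil; rewrite -addn1 PoszD in Fv.
Qed.

Lemma gop_lin : linear (gop e U).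
Proof. exact/gext_lin/gop_adm. Qed.

Lemma gop_gcl m v : F m v -> gop e U (gcl m v) = gcl (m + e) (U v).
Proof.
case: m => m Fv; first exact: gext_gcl gop_adm Fv.
rewrite gcl_neg // (lin0 gop_lin) gcl_eq0 //.
by rewrite addrAC; apply/U_fil/F_le0; clear; lia.
Qed.

End InducedOperator.

Section InducedProduct.
Variables (e : int) (B : V -> V -> V).
Hypotheses (B_linl : forall b, linear (B^~ b)) (B_linr : forall a, linear (B a)).
Hypothesis B_fil : forall (r s : int) a b, F r a -> F s b -> F (r + s + e) (B a b).

Let inner_adm (r : nat) a : F r a ->
  gadmissible (fun (s : nat) b => gcl (r%:Z + s%:Z + e) (B a b)).
Proof.
move=> Fa; split=> [n c u v Fu Fv|n v Fv].
  by rewrite B_linr gcl_lin //; apply: B_fil.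
apply: gcl_eq0; rewrite (_ : _ + 1 = r%:Z + n.+1%:Z + e); first exact: B_fil.
by clear; lia.
Qed.

Let outer_adm y :
  gadmissible (fun r a => gext (fun (s : nat) b => gcl (r%:Z + s%:Z + e) (B a b)) y).
Proof.
split=> [n c u v Fu Fv|n v Fv]; rewrite /gext.
  rewrite scaler_sumr -big_split; apply: eq_bigr => s _ /=.
  by rewrite B_linl gcl_lin //; apply: B_fil => //; apply: grepr_in.
rewrite big1 // => s _; apply: gcl_eq0.
rewrite (_ : _ + 1 = n.+1%:Z + s%:Z + e); last by clear; lia.
by apply: B_fil => //; apply: grepr_in.
Qed.

Lemma gbil_linl y : linear ((gbil e B)^~ y).
Proof. by move=> c x x'; apply: (gext_lin (outer_adm y)). Qed.

Lemma gbil_linr x : linear (gbil e B x).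
Proof.
move=> c y y'; rewrite /gbil /gext scaler_sumr -big_split; apply: eq_bigr => r _ /=.
exact: (gext_lin (inner_adm (grepr_in x r))).
Qed.

Lemma gbil_gcl r s a b : F r a -> F s b ->
  gbil e B (gcl r a) (gcl s b) = gcl (r + s + e) (B a b).
Proof.
case: r => r Fa; last first.
  rewrite gcl_neg // (lin0 (gbil_linl _)) => Fb; rewrite gcl_eq0 //.
  rewrite (_ : _ + 1 = (Negz r + 1) + s + e); last by clear; lia.
  by apply: B_fil => //; apply: F_le0; clear; lia.
case: s => s Fb; last first.
  rewrite (@gcl_neg (Negz s)) // (lin0 (gbil_linr _)) gcl_eq0 //.
  rewrite (_ : _ + 1 = r%:Z + (Negz s + 1) + e); last by clear; lia.
  by apply: B_fil => //; apply: F_le0; clear; lia.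
by rewrite /gbil (gext_gcl (outer_adm _) Fa) (gext_gcl (inner_adm Fa) Fb).
Qed.

End InducedProduct.

End AssociatedGraded.

(** * The vertex Poisson superalgebra gr_E V *)

(** The even part of an [N_W = N] SUSY vertex Poisson algebra: a vertex Poisson
    superalgebra with product [mul] and brackets [br a n b = a_(n) b], [n >= 0],
    and odd derivations [S^i].  The brackets are extended by 0 to [n < 0].
    Skew-symmetry is stated for all large truncations [L], a form that is stable
    under sums of arguments. *)
Record mode_vpa (k : fieldType) (N : nat) (V : lmodType k) (par : bool -> set V)
    (vac : V) (T : V -> V) (S : 'I_N -> V -> V) (mul : V -> V -> V)
    (br : V -> int -> V -> V) : Prop := ModeVPA {
  mp_super : superspace par;
  mp_vac_par : par false vac;
  mp_T_lin : linear T;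
  mp_T_par : pure_op par false T;
  mp_S_lin : forall i, linear (S i);
  mp_S_par : forall i, pure_op par true (S i);
  mp_ST : forall i a, S i (T a) = T (S i a);
  mp_SS : forall i j a, S i (S j a) = - S j (S i a);
  mp_mul_linl : forall b, linear (mul^~ b);
  mp_mul_linr : forall a, linear (mul a);
  mp_mul_par : forall a p b q, par p a -> par q b -> par (p (+) q) (mul a b);
  mp_mul1 : forall a, mul vac a = a;
  mp_mulC : forall a p b q, par p a -> par q b -> mul a b = (-1) ^+ (p && q) *: mul b a;
  mp_mulA : forall a b c, mul (mul a b) c = mul a (mul b c);
  mp_T_mul : forall a b, T (mul a b) = mul (T a) b + mul a (T b);
  mp_S_mul : forall a p i b, par p a ->
    S i (mul a b) = mul (S i a) b + (-1) ^+ p *: mul a (S i b);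
  mp_br_linl : forall n b, linear (fun a => br a n b);
  mp_br_linr : forall a n, linear (br a n);
  mp_br_par : forall a p n b q, par p a -> par q b -> par (p (+) q) (br a n b);
  mp_br_neg : forall a n b, n < 0 -> br a n b = 0;
  mp_br_trunc : forall a b, exists M : nat, forall n : int, M%:Z <= n -> br a n b = 0;
  mp_T_br : forall a n b, T (br a n b) = br a n (T b) - n%:~R *: br a (n - 1) b;
  mp_br_T : forall a n b, br (T a) n b = - n%:~R *: br a (n - 1) b;
  mp_S_br : forall a p i n b, par p a ->
    S i (br a n b) = br (S i a) n b + (-1) ^+ p *: br a n (S i b);
  mp_skew : forall a p b q (m : nat), par p a -> par q b ->
    exists L0 : nat, forall L, (L0 <= L)%N ->
    br a m b = (-1) ^+ (p && q) *:
      \sum_(s < L) (-1) ^ (m%:Z + s%:Z + 1) *: dpow T s (br b (m%:Z + s%:Z) a);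
  mp_jacobi : forall a p b q (m n : nat) c, par p a -> par q b ->
    br a m (br b n c) = (-1) ^+ (p && q) *: br b n (br a m c) +
      \sum_(i < m.+1) binz k m i *: br (br a i%:Z b) (m%:Z + n%:Z - i%:Z) c;
  mp_leibniz : forall a p n b q c, par p a -> par q b ->
    br a n (mul b c) = mul (br a n b) c + (-1) ^+ (p && q) *: mul b (br a n c)
}.

Section GradedLi.
Variables (k : fieldType) (N : nat) (V : lmodType k) (par : bool -> set V).
Variables (vac : V) (T : V -> V) (S : 'I_N -> V -> V).
Variable Y : V -> fseries N (V -> V).
Hypothesis k0 : [pchar k] =i pred0.
Hypothesis Hva : susy_va par vac T S Y.

Local Notation pr := (coef_mode Y finset.set0).
Local Notation E := (li_filtration Y).
Local Notation G := (graded E).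
Local Notation gpar := (@graded_par _ _ E par).
Let H := susy_va_modes k0 Hva.
Let spar := super_sub (mv_super H).
Let E_le0 : forall (n : int) v, n <= 0 -> E n v := li_le0 k0 Hva.
Let E_le : forall (m n : int) v, E n v -> m <= n -> E m v := @li_le _ _ _ Y.
Let sE (n : int) : subspace (E n) := fil_sub E n.

Let linr := mv_linr H.
Let linl := mv_linl H.

Let E_nonneg r s (n : nat) a b : E r a -> E s b -> E (r + s - n%:Z) (pr a n%:Z b).
Proof. by move=> Ea Eb; have [_ h] := li_mode k0 Hva n%:Z Ea Eb; apply: h. Qed.

Let E_any r s n a b : E r a -> E s b -> E (r + s - n - 1) (pr a n b).
Proof. by move=> Ea Eb; have [h _] := li_mode k0 Hva n Ea Eb. Qed.

Let E_mul r s a b : E r a -> E s b -> E (r + s) (pr a (-1) b).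
Proof. by move=> Ea Eb; apply: E_le (E_any _ Ea Eb) _; clear; lia. Qed.

Let E_dpow n i v : E n v -> E (n + i%:Z) (dpow T i v).
Proof.
elim: i => [|i IH] Ev; first by rewrite dpow0 addr0.
have -> : dpow T i.+1 v = i.+1%:R^-1 *: T (dpow T i v).
  by rewrite -(dpowS k0 (mv_T_lin H)) scalerA mulVf ?scale1r // natS_neq0.
apply: subspaceZ; first exact: sE.
by apply: E_le (li_T k0 Hva (IH Ev)) _; clear; lia.
Qed.

Definition gr_one : G := gcl E 0 vac.
Definition gr_T : G -> G := gop 1 T.
Definition gr_S (i : 'I_N) : G -> G := gop 0 (S i).
Definition gr_mul : G -> G -> G := gbil 0 (fun a b => pr a (-1) b).
Definition gr_br (x : G) (n : int) (y : G) : G :=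
  if n is Posz j then gbil (- j%:Z) (fun a b => pr a j b) x y else 0.
Arguments gr_br : simpl never.

Lemma gr_br_neg x n y : gr_br x (Negz n) y = 0.
Proof. by []. Qed.

Let mul_fil (r s : int) a b : E r a -> E s b -> E (r + s + 0) (pr a (-1) b).
Proof. by rewrite addr0; apply: E_mul. Qed.

Let T_fil (n : int) v : E n v -> E (n + 1) (T v). Proof. exact: (li_T k0 Hva). Qed.
Let S_fil i (n : int) v : E n v -> E (n + 0) (S i v).
Proof. by rewrite addr0; apply: (li_S k0 Hva). Qed.

Lemma gr_T_gcl m v : E m v -> gr_T (gcl E m v) = gcl E (m + 1) (T v).
Proof. exact: (gop_gcl E_le0 E_le (mv_T_lin H) T_fil). Qed.

Lemma gr_S_gcl i m v : E m v -> gr_S i (gcl E m v) = gcl E m (S i v).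
Proof.
by move=> Ev; rewrite [LHS](gop_gcl E_le0 E_le (mv_S_lin H i) (@S_fil i)) // addr0.
Qed.

Lemma gr_mul_gcl r s a b : E r a -> E s b ->
  gr_mul (gcl E r a) (gcl E s b) = gcl E (r + s) (pr a (-1) b).
Proof.
move=> Ea Eb; rewrite [LHS](gbil_gcl E_le0 E_le (linl (-1)) (linr^~ (-1)) mul_fil) //.
by rewrite addr0.
Qed.

Lemma gr_br_gcl r s (n : nat) a b : E r a -> E s b ->
  gr_br (gcl E r a) n (gcl E s b) = gcl E (r + s - n%:Z) (pr a n b).
Proof.
move=> Ea Eb; apply: (gbil_gcl E_le0 E_le (linl n) (linr^~ n)) => //.
by move=> *; apply: E_nonneg.
Qed.

Lemma gr_T_lin : linear gr_T.
Proof. exact: (gop_lin E_le (mv_T_lin H) T_fil). Qed.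

Lemma gr_S_lin i : linear (gr_S i).
Proof. exact: (gop_lin E_le (mv_S_lin H i) (@S_fil i)). Qed.

Lemma gr_mul_linl y : linear (gr_mul^~ y).
Proof. exact: (gbil_linl E_le (linl (-1)) mul_fil). Qed.

Lemma gr_mul_linr x : linear (gr_mul x).
Proof. exact: (gbil_linr E_le (linr^~ (-1)) mul_fil). Qed.

Lemma gr_br_linl n y : linear (fun x => gr_br x n y).
Proof.
case: n => n; last by move=> c x x'; rewrite !gr_br_neg scaler0 addr0.
by apply: (gbil_linl E_le (linl n)) => r s a b; apply: E_nonneg.
Qed.

Lemma gr_br_linr x n : linear (gr_br x n).
Proof.
case: n => n; last by move=> c y y'; rewrite !gr_br_neg scaler0 addr0.
by apply: (gbil_linr E_le (linr^~ n)) => r s a b; apply: E_nonneg.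
Qed.

Let Gind (P : G -> Prop) :
  (forall x y, P x -> P y -> P (x + y)) ->
  (forall (n : nat) v, E n v -> P (gcl E n v)) -> forall x, P x.
Proof. exact: (graded_ind E_le). Qed.

Let Gindp p (P : G -> Prop) :
  (forall x y, P x -> P y -> P (x + y)) ->
  (forall (n : nat) v, E n v -> par p v -> P (gcl E n v)) ->
  forall x, gpar p x -> P x.
Proof. exact: (graded_ind_pure E_le spar). Qed.

Let gparD p x y : gpar p x -> gpar p y -> gpar p (x + y).
Proof. by move=> px py; exact: subspaceD (graded_par_sub E _ spar) px py. Qed.

Let gpar_cl p m v : E m v -> par p v -> gpar p (gcl E m v).
Proof. exact: gcl_par. Qed.

Lemma gr_T_par : pure_op gpar false gr_T.
Proof.
move=> q; apply: Gindp => [x y hx hy|n v Ev pv].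
  by rewrite (linD gr_T_lin); apply: gparD.
by rewrite gr_T_gcl //; apply: gpar_cl; [apply: T_fil | apply: (mv_T_par H)].
Qed.

Lemma gr_S_par i : pure_op gpar true (gr_S i).
Proof.
move=> q; apply: Gindp => [x y hx hy|n v Ev pv].
  by rewrite (linD (gr_S_lin i)); apply: gparD.
by rewrite gr_S_gcl //; apply: gpar_cl; [apply: (li_S k0 Hva) | apply: (mv_S_par H)].
Qed.

Lemma gr_mul_par x p y q : gpar p x -> gpar q y -> gpar (p (+) q) (gr_mul x y).
Proof.
move=> + py; move: x; apply: Gindp => [x x' hx hx'|r a Ea pa].
  by rewrite (linD (gr_mul_linl y)); apply: gparD.
move: y py; apply: Gindp => [y y' hy hy'|s b Eb pb].
  by rewrite (linD (gr_mul_linr _)); apply: gparD.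
by rewrite gr_mul_gcl //; apply: gpar_cl; [apply: E_mul | apply: (mv_par H)].
Qed.

Lemma gr_br_par x p n y q : gpar p x -> gpar q y -> gpar (p (+) q) (gr_br x n y).
Proof.
case: n => n; last by move=> _ _; exact: (subspace0 (graded_par_sub E _ spar)).
move=> + py; move: x; apply: Gindp => [x x' hx hx'|r a Ea pa].
  by rewrite (linD (gr_br_linl n y)); apply: gparD.
move: y py; apply: Gindp => [y y' hy hy'|s b Eb pb].
  by rewrite (linD (gr_br_linr _ n)); apply: gparD.
by rewrite gr_br_gcl //; apply: gpar_cl; [apply: E_nonneg | apply: (mv_par H)].
Qed.

Lemma gr_br_trunc x y : exists M : nat, forall n : int, M%:Z <= n -> gr_br x n y = 0.
Proof.
move: x y; apply: (Gind (P := fun x => forall y, _)) => [x x' hx hx' y|r a Ea].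
  have [M hM] := hx y; have [M' hM'] := hx' y; exists (M + M')%N => n le.
  rewrite (linD (gr_br_linl n y)) hM ?hM' ?addr0 //; apply: le_trans le;
    by rewrite lez_nat ?leq_addr ?leq_addl.
apply: Gind => [y y' [M hM] [M' hM']|s b Eb].
  exists (M + M')%N => n le.
  rewrite (linD (gr_br_linr _ n)) hM ?hM' ?addr0 //; apply: le_trans le;
    by rewrite lez_nat ?leq_addr ?leq_addl.
have [M hM] := mv_trunc H a b; exists M => -[n|//] le.
by rewrite gr_br_gcl // hM // gcl0.
Qed.

(** By skew-symmetry [a_(-1) b -+ b_(-1) a] is a sum of [T^(i+1) b_(i) a], one step
    deeper. *)
Lemma gr_mulC x p y q : gpar p x -> gpar q y ->
  gr_mul x y = (-1) ^+ (p && q) *: gr_mul y x.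
Proof.
move=> + py; move: x; apply: Gindp => [x x' hx hx'|r a Ea pa].
  by rewrite (linD (gr_mul_linl y)) (linD (gr_mul_linr y)) hx hx' scalerDr.
move: y py; apply: Gindp => [y y' hy hy'|s b Eb pb].
  by rewrite (linD (gr_mul_linr _)) (linD (gr_mul_linl _)) hy hy' scalerDr.
have Eba := E_mul Eb Ea; rewrite addrC in Eba.
rewrite !gr_mul_gcl // [s%:Z + _]addrC -(gclZ E_le) //.
apply: gcl_eq => //; first exact: E_mul.
have [M hM] := mv_trunc H b a.
have bound (n : int) : -1 + M.+1%:Z <= n -> pr b n a = 0.
  by move=> le; apply: hM; move: le; clear; lia.
rewrite (skew_symmetry k0 H pa pb bound) big_ord_recl /= !addr0 dpow0 scale1r.
rewrite scalerDr [_ *: _ + _]addrC addrK; apply: subspaceZ; first exact: sE.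
apply: subspace_sum_ord => [|i]; first exact: sE.
apply: subspaceZ; first exact: sE.
rewrite /bump /= (_ : -1 + (1 + i)%N%:Z = i%:Z); last by clear; lia.
by apply: E_le (E_dpow _ (E_nonneg i Eb Ea)) _; clear; lia.
Qed.

Let Gsuper : superspace gpar :=
  graded_superspace E_le (mv_super H) (li_super k0 Hva).

Let Gind_all (P : G -> Prop) :
  (forall x y, P x -> P y -> P (x + y)) ->
  (forall p (n : nat) v, E n v -> par p v -> P (gcl E n v)) -> forall x, P x.
Proof.
by move=> PD Pcl; apply: (par_ind Gsuper PD) => p x; apply: Gindp => // n v; apply: Pcl.
Qed.

(** By associativity [(a_(-1) b)_(-1) c - a_(-1) b_(-1) c] is a sum of
    [a_(-2-i) b_(i) c] and [b_(-2-i) a_(i) c], one step deeper. *)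
Lemma gr_mulA x y z : gr_mul (gr_mul x y) z = gr_mul x (gr_mul y z).
Proof.
move: x; apply: Gind_all => [x x' hx hx'|p r a Ea pa].
  by rewrite (linD (gr_mul_linl _)) !(linD (gr_mul_linl z)) (linD (gr_mul_linl _)) hx hx'.
move: y; apply: Gind_all => [y y' hy hy'|q s b Eb qb].
  rewrite (linD (gr_mul_linr _)) !(linD (gr_mul_linl z)).
  by rewrite (linD (gr_mul_linr _)) hy hy'.
move: z; apply: Gind_all => [z z' hz hz'|t u c Ec tc].
  by rewrite !(linD (gr_mul_linr _)) hz hz'.
have Eab := E_mul Ea Eb; have Ebc := E_mul Eb Ec.
rewrite !gr_mul_gcl // addrA; apply: gcl_eq => //; first exact: E_mul.
have [M1 h1] := mv_trunc H b c; have [M2 h2] := mv_trunc H a c.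
rewrite (associativity k0 H pa qb tc (-1) (n := -1) (L := (M1 + M2).+1)); first last.
- by move=> l le; apply: h2; move: le; clear; lia.
- by move=> l le; apply: h1; move: le; clear; lia.
rewrite big_ord_recl /= subr0 addr0 mul1r scale1r.
set y0 := (_ *: pr b (-1 - 1) _); set rest := (\sum_(i < _) _).
have -> : pr a (-1) (pr b (-1) c) - y0 + rest - pr a (-1) (pr b (-1) c) = rest - y0.
  by linear_ring.
have second (i : nat) : E (r%:Z + s%:Z + u%:Z + 1) (pr b (-1 + -1 - i%:Z) (pr a i%:Z c)).
  by apply: E_le (E_any _ Eb (E_nonneg i Ea Ec)) _; clear; lia.
have sE' := sE (r%:Z + s%:Z + u%:Z + 1).
apply: subspaceD => //; last first.
  by apply: subspaceN => //; apply: subspaceZ => //; apply: (second 0%N).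
apply: subspace_sum_ord => // i; apply: subspaceZ => //; apply: subspaceD => //.
  rewrite /bump /= (_ : -1 + (1 + i)%N%:Z = i%:Z); last by clear; lia.
  by apply: E_le (E_any _ Ea (E_nonneg i Eb Ec)) _; clear; lia.
by apply: subspaceN => //; apply: subspaceZ => //; apply: second.
Qed.

Lemma gr_T_mul x y : gr_T (gr_mul x y) = gr_mul (gr_T x) y + gr_mul x (gr_T y).
Proof.
move: x; apply: Gind => [x x' hx hx'|r a Ea].
  rewrite (linD gr_T_lin) !(linD (gr_mul_linl _)) (linD gr_T_lin) hx hx'.
  by rewrite addrACA.
move: y; apply: Gind => [y y' hy hy'|s b Eb].
  rewrite (linD gr_T_lin) !(linD (gr_mul_linr _)) (linD gr_T_lin) hy hy'.
  by rewrite addrACA.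
have ETa := T_fil Ea; have ETb := T_fil Eb; have Eab := E_mul Ea Eb.
rewrite !gr_T_gcl // !gr_mul_gcl // gr_T_gcl // [r%:Z + 1 + _]addrAC [r%:Z + (_ + _)]addrA.
rewrite -gclD; first last.
- by rewrite -addrA; apply: E_mul.
- by rewrite addrAC; apply: E_mul.
by rewrite (mv_T_der H) (mv_T_mode H); congr (gcl E _ _); linear_ring.
Qed.

Lemma gr_S_mul x p i y : gpar p x ->
  gr_S i (gr_mul x y) = gr_mul (gr_S i x) y + (-1) ^+ p *: gr_mul x (gr_S i y).
Proof.
move: x; apply: Gindp => [x x' hx hx'|r a Ea pa].
  rewrite (linD (gr_S_lin i)) !(linD (gr_mul_linl _)) (linD (gr_S_lin i)) hx hx'.
  by linear_ring.
move: y; apply: Gind => [y y' hy hy'|s b Eb].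
  rewrite (linD (gr_S_lin i)) !(linD (gr_mul_linr _)) (linD (gr_S_lin i)) hy hy'.
  by linear_ring.
have ESa := li_S k0 Hva i Ea; have ESb := li_S k0 Hva i Eb; have Eab := E_mul Ea Eb.
rewrite !gr_S_gcl // !gr_mul_gcl // gr_S_gcl // -(gclZ E_le); last exact: E_mul.
rewrite -gclD; [|exact: E_mul|by apply: subspaceZ; [exact: sE | exact: E_mul]].
by rewrite (mv_S_der H _ _ _ pa).
Qed.

Lemma gr_T_br x n y : gr_T (gr_br x n y) = gr_br x n (gr_T y) - n%:~R *: gr_br x (n - 1) y.
Proof.
case: n => n; last first.
  rewrite (_ : Negz n - 1 = Negz n.+1); last by clear; lia.
  by rewrite ?gr_br_neg ?(lin0 gr_T_lin) ?scaler0 ?subr0.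
move: x; apply: Gind => [x x' hx hx'|r a Ea].
  rewrite !(linD (gr_br_linl _ _)) (linD gr_T_lin) hx hx'; by linear_ring.
move: y; apply: Gind => [y y' hy hy'|s b Eb].
  rewrite (linD gr_T_lin) !(linD (gr_br_linr _ _)) (linD gr_T_lin) hy hy'; by linear_ring.
have ETb := T_fil Eb; have Eab := E_nonneg n Ea Eb.
rewrite gr_T_gcl // !gr_br_gcl // gr_T_gcl // (mv_T_der H).
case: n Eab => [|n] Eab.
  by rewrite !scale0r !subr0 addrA.
rewrite (_ : n.+1%:Z - 1 = n); last by clear; lia.
have e : r%:Z + s%:Z - n%:Z = r%:Z + s%:Z - n.+1%:Z + 1 by clear; lia.
have e' : r%:Z + (s%:Z + 1) - n.+1%:Z = r%:Z + s%:Z - n.+1%:Z + 1 by clear; lia.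
rewrite gr_br_gcl // e e' -[in RHS]scaleNr -(gclZ E_le); last by rewrite -e; apply: E_nonneg.
rewrite -gclD ?scaleNr //; first by rewrite -e'; apply: E_nonneg.
by rewrite -scaleNr; apply: subspaceZ; [exact: sE | rewrite -e; apply: E_nonneg].
Qed.

Lemma gr_br_T x n y : gr_br (gr_T x) n y = - n%:~R *: gr_br x (n - 1) y.
Proof.
case: n => n; last first.
  by rewrite (_ : Negz n - 1 = Negz n.+1) ?gr_br_neg ?scaler0 //; clear; lia.
move: x; apply: Gind => [x x' hx hx'|r a Ea].
  rewrite (linD gr_T_lin) !(linD (gr_br_linl _ _)) hx hx'; by linear_ring.
move: y; apply: Gind => [y y' hy hy'|s b Eb].
  rewrite !(linD (gr_br_linr _ _)) hy hy'; by linear_ring.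
have ETa := T_fil Ea.
rewrite gr_T_gcl // gr_br_gcl // (mv_T_mode H).
case: n => [|n]; first by rewrite mulr0z !oppr0 !scale0r gcl0.
rewrite (_ : n.+1%:Z - 1 = n); last by clear; lia.
rewrite gr_br_gcl // -(gclZ E_le); last exact: E_nonneg.
by congr (gcl E _ _); clear; lia.
Qed.

Lemma gr_S_br x p i n y : gpar p x ->
  gr_S i (gr_br x n y) = gr_br (gr_S i x) n y + (-1) ^+ p *: gr_br x n (gr_S i y).
Proof.
case: n => n; last by rewrite !gr_br_neg (lin0 (gr_S_lin i)) scaler0 addr0.
move: x; apply: Gindp => [x x' hx hx'|r a Ea pa].
  rewrite (linD (gr_S_lin i)) !(linD (gr_br_linl _ _)) (linD (gr_S_lin i)) hx hx'.
  by linear_ring.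
move: y; apply: Gind => [y y' hy hy'|s b Eb].
  rewrite (linD (gr_S_lin i)) !(linD (gr_br_linr _ _)) (linD (gr_S_lin i)) hy hy'.
  by linear_ring.
have ESa := li_S k0 Hva i Ea; have ESb := li_S k0 Hva i Eb; have Eab := E_nonneg n Ea Eb.
rewrite !gr_S_gcl // !gr_br_gcl // gr_S_gcl // -(gclZ E_le); last exact: E_nonneg.
rewrite -gclD; [|exact: E_nonneg|by apply: subspaceZ; [exact: sE | exact: E_nonneg]].
by rewrite (mv_S_der H _ _ _ pa).
Qed.

Lemma gr_dpow_gcl i m v : E m v -> dpow gr_T i (gcl E m v) = gcl E (m + i%:Z) (dpow T i v).
Proof.
move=> Ev; elim: i => [|i IH]; first by rewrite !dpow0 addr0.
apply: (@natS_inj _ k0 _ i); rewrite (dpowS k0 gr_T_lin) IH gr_T_gcl; last exact: E_dpow.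
rewrite -(dpowS k0 (mv_T_lin H)) -(gclZ E_le); last exact: E_dpow.
by congr (gcl E _ _); clear; lia.
Qed.

Lemma gr_skew x p y q (m : nat) : gpar p x -> gpar q y ->
  exists L0 : nat, forall L, (L0 <= L)%N ->
  gr_br x m y = (-1) ^+ (p && q) *:
    \sum_(s < L) (-1) ^ (m%:Z + s%:Z + 1) *: dpow gr_T s (gr_br y (m%:Z + s%:Z) x).
Proof.
have D := fun i => linD (dpow_lin gr_T_lin i).
move=> + py; move: x; apply: Gindp => [x x' [L h] [L' h']|r a Ea pa].
  exists (L + L')%N => L'' le; rewrite (linD (gr_br_linl _ _)).
  rewrite (h L'') ?(h' L'') ?(leq_trans _ le) ?leq_addl ?leq_addr //.
  rewrite -scalerDr -big_split; congr (_ *: _); apply: eq_bigr => s _ /=.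
  by rewrite (linD (gr_br_linr _ _)) D scalerDr.
move: y py; apply: Gindp => [y y' [L h] [L' h']|s b Eb qb].
  exists (L + L')%N => L'' le; rewrite (linD (gr_br_linr _ _)).
  rewrite (h L'') ?(h' L'') ?(leq_trans _ le) ?leq_addl ?leq_addr //.
  rewrite -scalerDr -big_split; congr (_ *: _); apply: eq_bigr => s _ /=.
  by rewrite (linD (gr_br_linl _ _)) D scalerDr.
have [M hM] := mv_trunc H b a; exists M => L le.
have bound (n : int) : m%:Z + L%:Z <= n -> pr b n a = 0.
  by move=> le'; apply: hM; move: le le'; clear; lia.
have Et (i : nat) : E (r%:Z + s%:Z - m%:Z) (dpow T i (pr b (m%:Z + i%:Z) a)).
  by apply: E_le (E_dpow _ (E_nonneg (m + i) Eb Ea)) _; clear; lia.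
rewrite gr_br_gcl // (skew_symmetry k0 H pa qb bound) (gclZ E_le); last first.
  by apply: subspace_sum_ord => [|i]; [exact: sE | apply: subspaceZ; [exact: sE | exact: Et]].
congr (_ *: _); rewrite (gcl_sum E_le _
  (u := fun i : nat => (-1) ^ (m%:Z + i%:Z + 1) *: dpow T i (pr b (m%:Z + i%:Z) a))); last first.
  by move=> i; apply: subspaceZ; [exact: sE | exact: Et].
apply: eq_bigr => i _; rewrite (gclZ E_le) // -PoszD gr_br_gcl // gr_dpow_gcl; last exact: E_nonneg.
have -> // : s%:Z + r%:Z - (m + i)%N%:Z + i%:Z = r%:Z + s%:Z - m%:Z.
by clear; lia.
Qed.

(** For [m, n >= 0] all the terms of the commutator formula have the degree
    [r + s + t - m - n]. *)
Lemma gr_jacobi x p y q (m n : nat) z : gpar p x -> gpar q y ->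
  gr_br x m (gr_br y n z) = (-1) ^+ (p && q) *: gr_br y n (gr_br x m z) +
    \sum_(i < m.+1) binz k m i *: gr_br (gr_br x i%:Z y) (m%:Z + n%:Z - i%:Z) z.
Proof.
move=> + qy; move: x; apply: Gindp => [x x' hx hx'|r a Ea pa].
  rewrite (linD (gr_br_linl _ _)) hx hx' (linD (gr_br_linl _ z)) (linD (gr_br_linr _ _)).
  rewrite scalerDr addrACA -big_split; congr (_ + _); apply: eq_bigr => i _ /=.
  by rewrite (linD (gr_br_linl _ y)) (linD (gr_br_linl _ z)) scalerDr.
move: y qy; apply: Gindp => [y y' hy hy'|s b Eb qb].
  rewrite (linD (gr_br_linl _ z)) (linD (gr_br_linr _ m)) hy hy' (linD (gr_br_linl _ _)).
  rewrite scalerDr addrACA -big_split; congr (_ + _); apply: eq_bigr => i _ /=.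
  by rewrite (linD (gr_br_linr _ _)) (linD (gr_br_linl _ z)) scalerDr.
move: z; apply: Gind => [z z' hz hz'|t c Ec].
  rewrite (linD (gr_br_linr _ n)) (linD (gr_br_linr _ m)) hz hz'.
  rewrite (linD (gr_br_linr _ m)) (linD (gr_br_linr _ n)).
  rewrite scalerDr addrACA -big_split; congr (_ + _); apply: eq_bigr => i _ /=.
  by rewrite (linD (gr_br_linr _ _)) scalerDr.
have Ebc := E_nonneg n Eb Ec; have Eac := E_nonneg m Ea Ec.
have [M hM] := mv_trunc H a b.
set d := r%:Z + (s%:Z + t%:Z - n%:Z) - m%:Z.
have Ei (i : nat) : (i < m.+1)%N -> E d (pr (pr a i%:Z b) (m%:Z + n%:Z - i%:Z) c).
  move=> im; rewrite (_ : m%:Z + n%:Z - i%:Z = (m + n - i)%N); last by move: im; clear; lia.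
  by apply: E_le (E_nonneg _ (E_nonneg i Ea Eb) Ec) _; rewrite /d; move: im; clear; lia.
have Eba : E d (pr b n (pr a m c)).
  by apply: E_le (E_nonneg _ Eb Eac) _; rewrite /d; clear; lia.
rewrite !gr_br_gcl // (commutator_formula k0 H pa qb hM).
have -> : \sum_(i < M) binz k m i *: pr (pr a i%:Z b) (m%:Z + n%:Z - i%:Z) c =
    \sum_(i < m.+1) binz k m i *: pr (pr a i%:Z b) (m%:Z + n%:Z - i%:Z) c.
  apply: (sum_trunc (f := fun i : nat => binz k m i *: pr (pr a i%:Z b) (m%:Z + n%:Z - i%:Z) c)).
    by move=> i le; rewrite hM ?lez_nat // (lin0 (linl _ _)) scaler0.
  by move=> i le; rewrite binz_small ?scale0r.
rewrite -/d gclD; first last.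
- by apply: subspace_sum_ord => [|i]; [exact: sE | apply: subspaceZ; [exact: sE | exact: Ei]].
- by apply: subspaceZ; first exact: sE.
rewrite (gclZ E_le) //.
have -> : s%:Z + (r%:Z + t%:Z - m%:Z) - n%:Z = d by rewrite /d; clear; lia.
set A := _ *: gcl E d _; apply: (congr1 (+%R A)).
pose u (i : nat) := if (i < m.+1)%N then
  binz k m i *: pr (pr a i%:Z b) (m%:Z + n%:Z - i%:Z) c else 0.
rewrite (eq_bigr (fun i : 'I_m.+1 => u i)) => [|i _]; last by rewrite /u ltn_ord.
rewrite (gcl_sum E_le); last first.
  move=> i; rewrite /u; case: ifP => im; last exact: subspace0 (sE _).
  by apply: subspaceZ; [exact: sE | exact: Ei].
apply: eq_bigr => i _; have im := ltn_ord i.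
rewrite /u im (gclZ E_le); last exact: Ei.
rewrite (_ : m%:Z + n%:Z - i%:Z = (m + n - i)%N); last by move: im; clear; lia.
rewrite (gr_br_gcl i Ea Eb) (gr_br_gcl _ (E_nonneg i Ea Eb) Ec).
have -> // : r%:Z + s%:Z - i%:Z + t%:Z - (m + n - i)%N%:Z = d.
by rewrite /d; move: im; clear; lia.
Qed.

(** In the commutator formula for [a_(n)] and [b_(-1)] the term [i = n] is
    [(a_(n) b)_(-1) c]; in the terms [i < n] both modes are nonnegative, so they
    lie one step deeper. *)
Lemma gr_leibniz x p n y q z : gpar p x -> gpar q y ->
  gr_br x n (gr_mul y z) =
  gr_mul (gr_br x n y) z + (-1) ^+ (p && q) *: gr_mul y (gr_br x n z).
Proof.
case: n => n; last first.
  by rewrite !gr_br_neg (lin0 (gr_mul_linl z)) (lin0 (gr_mul_linr y)) scaler0 addr0.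
move=> + qy; move: x; apply: Gindp => [x x' hx hx'|r a Ea pa].
  rewrite !(linD (gr_br_linl _ _)) hx hx' (linD (gr_mul_linl z)) (linD (gr_mul_linr y)).
  by linear_ring.
move: y qy; apply: Gindp => [y y' hy hy'|s b Eb qb].
  rewrite (linD (gr_mul_linl z)) !(linD (gr_br_linr _ n)) hy hy'.
  by rewrite (linD (gr_mul_linl z)) (linD (gr_mul_linl _)); linear_ring.
move: z; apply: Gind => [z z' hz hz'|t c Ec].
  rewrite (linD (gr_mul_linr _)) !(linD (gr_br_linr _ n)) hz hz'.
  by rewrite !(linD (gr_mul_linr _)); linear_ring.
have Ebc := E_mul Eb Ec; have Eab := E_nonneg n Ea Eb; have Eac := E_nonneg n Ea Ec.
have [M hM] := mv_trunc H a b.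
rewrite gr_mul_gcl // !gr_br_gcl // !gr_mul_gcl //.
set d := r%:Z + (s%:Z + t%:Z) - n%:Z.
rewrite (_ : r%:Z + s%:Z - n%:Z + t%:Z = d); last by rewrite /d; clear; lia.
rewrite (_ : s%:Z + (r%:Z + t%:Z - n%:Z) = d); last by rewrite /d; clear; lia.
have E1 : E d (pr (pr a n b) (-1) c).
  by apply: E_le (E_mul Eab Ec) _; rewrite /d; clear; lia.
have E2 : E d (pr b (-1) (pr a n c)).
  by apply: E_le (E_mul Eb Eac) _; rewrite /d; clear; lia.
rewrite -(gclZ E_le) // -gclD //; last by apply: subspaceZ; first exact: sE.
apply: gcl_eq => //; first exact: E_nonneg.
rewrite (commutator_formula k0 H pa qb hM).
have -> : \sum_(i < M) binz k n i *: pr (pr a i%:Z b) (n%:Z + -1 - i%:Z) c =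
    \sum_(i < n.+1) binz k n i *: pr (pr a i%:Z b) (n%:Z + -1 - i%:Z) c.
  apply: (sum_trunc (f := fun i : nat => binz k n i *: pr (pr a i%:Z b) (n%:Z + -1 - i%:Z) c)).
    by move=> i le; rewrite hM ?lez_nat // (lin0 (linl _ _)) scaler0.
  by move=> i le; rewrite binz_small ?scale0r.
rewrite big_ord_recr /= (binzz k0) scale1r (_ : n%:Z - 1 - n%:Z = -1); last by clear; lia.
set rest := \sum_(i < n) _.
have -> : (-1) ^+ (p && q) *: pr b (-1) (pr a n c) + (rest + pr (pr a n b) (-1) c) -
  (pr (pr a n b) (-1) c + (-1) ^+ (p && q) *: pr b (-1) (pr a n c)) = rest by linear_ring.
apply: subspace_sum_ord => [|i]; first exact: sE.
apply: subspaceZ; first exact: sE.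
rewrite (_ : n%:Z - 1 - i%:Z = (n - i.+1)%N); last by move: (ltn_ord i); clear; lia.
apply: E_le (E_nonneg _ (E_nonneg i Ea Eb) Ec) _.
by rewrite /d; move: (ltn_ord i); clear; lia.
Qed.

Theorem gr_mode_vpa : mode_vpa gpar gr_one gr_T gr_S gr_mul gr_br.
Proof.
have one_in : E 0 vac by apply: E_le0.
split.
- exact: Gsuper.
- by apply: gpar_cl => //; apply: (mv_vac_par H).
- exact: gr_T_lin.
- exact: gr_T_par.
- exact: gr_S_lin.
- exact: gr_S_par.
- move=> i; apply: Gind => [x y hx hy|n v Ev].
    by rewrite (linD gr_T_lin) !(linD (gr_S_lin i)) (linD gr_T_lin) hx hy.
  have ETv := T_fil Ev; have ESv := li_S k0 Hva i Ev.
  by rewrite gr_T_gcl // !gr_S_gcl // gr_T_gcl // (mv_ST H).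
- move=> i j; apply: Gind => [x y hx hy|n v Ev].
    by rewrite !(linD (gr_S_lin _)) hx hy opprD.
  have ESv l := li_S k0 Hva l Ev.
  rewrite !gr_S_gcl // (mv_SS H) -scaleN1r (gclZ E_le) ?scaleN1r //.
  exact: (li_S k0 Hva).
- exact: gr_mul_linl.
- exact: gr_mul_linr.
- by move=> *; apply: gr_mul_par.
- apply: Gind => [x y hx hy|n v Ev]; first by rewrite (linD (gr_mul_linr _)) hx hy.
  by rewrite gr_mul_gcl // add0r (mv_vacl k0 H).
- by move=> *; apply: gr_mulC.
- exact: gr_mulA.
- exact: gr_T_mul.
- by move=> *; apply: gr_S_mul.
- exact: gr_br_linl.
- exact: gr_br_linr.
- by move=> *; apply: gr_br_par.
- by move=> a [].
- exact: gr_br_trunc.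
- exact: gr_T_br.
- exact: gr_br_T.
- by move=> *; apply: gr_S_br.
- by move=> *; apply: gr_skew.
- by move=> *; apply: gr_jacobi.
- by move=> *; apply: gr_leibniz.
Qed.

End GradedLi.

(** * Series in a supervariable *)

Section Inversions.
Variable N : nat.
Implicit Types (i j : 'I_N) (I J L M : {set 'I_N}).

Lemma inversionsE J L :
  inversions J L = (\sum_(x in J) \sum_(y in L) (y < x)%N)%N.
Proof.
rewrite /inversions -sum1_card pair_big /= [RHS](bigID (fun x : 'I_N * 'I_N => (x.2 < x.1)%N)) /=.
rewrite [X in (_ + X)%N]big1 ?addn0; last by move=> x /andP[_ /negPf ->].
rewrite [RHS](eq_bigr (fun=> 1%N)); last by move=> x /andP[_ ->].
by apply: eq_bigl => x; rewrite inE andbA.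
Qed.

Lemma inversions_setU1l i I L : i \notin I ->
  inversions (i |: I)%SET L = (inversions [set i]%SET L + inversions I L)%N.
Proof. by move=> iI; rewrite !inversionsE big_setU1 //= big_set1. Qed.

Lemma inversions_setD1l i I L : i \in I ->
  inversions I L = (inversions [set i]%SET L + inversions (I :\ i)%SET L)%N.
Proof. by move=> iI; rewrite -{1}(finset.setD1K iI) inversions_setU1l ?finset.setD11. Qed.

Lemma inversions_setU1r L i M : i \notin M ->
  inversions L (i |: M)%SET = (inversions L [set i]%SET + inversions L M)%N.
Proof.
move=> iM; rewrite !inversionsE -big_split; apply: eq_bigr => x _.
by rewrite big_setU1 //= big_set1.
Qed.

Lemma inversions_setIDr L M I :
  inversions L M = (inversions L (M :&: I)%SET + inversions L (M :\: I)%SET)%N.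
Proof.
rewrite !inversionsE -big_split; apply: eq_bigr => x _.
by rewrite (big_setID I).
Qed.

Lemma inversions_swap i J : i \notin J ->
  (inversions [set i]%SET J + inversions J [set i]%SET = #|J|)%N.
Proof.
move=> iJ; rewrite !inversionsE big_set1.
rewrite [X in (_ + X)%N](eq_bigr (fun x : 'I_N => (i < x)%N : nat)) => [|x _];
  last by rewrite big_set1.
rewrite -big_split -sum1_card; apply: eq_bigr => x xJ /=.
have : x != i :> nat by apply: contraNneq iJ => /val_inj <-.
by case: ltngtP.
Qed.

Lemma inversions_set0l L : inversions finset.set0 L = 0%N.
Proof. by rewrite inversionsE big_set0. Qed.

Lemma inversions_set0r L : inversions L finset.set0 = 0%N.
Proof. by rewrite inversionsE big1 // => i _; rewrite big_set0. Qed.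

End Inversions.

Section SeriesCalculus.
Variables (k : fieldType) (N : nat) (U : lmodType k).
Implicit Types (f g h : fseries N U) (j l : int) (i : 'I_N) (I J L : {set 'I_N}).

Lemma series_ext f g : (forall j J, f j J = g j J) -> f = g.
Proof. by move=> e; apply: funext => j; apply: funext. Qed.

Lemma dzeta_in i f j J : i \in J -> dzeta i f j J = 0.
Proof. by move=> iJ; rewrite /dzeta iJ. Qed.

Lemma dzeta_notin i f j J : i \notin J ->
  dzeta i f j J = (-1) ^+ inversions [set i]%SET J *: f j (i |: J)%SET.
Proof. by move=> /negPf iJ; rewrite /dzeta iJ. Qed.

(** Applied repeatedly, this reduces an identity of series to identities between
    the values at [zeta = 0] of their derivatives. *)
Lemma coef_dzeta i f j J : i \notin J ->
  f j (i |: J)%SET = (-1) ^+ inversions [set i]%SET J *: dzeta i f j J.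
Proof.
by move=> iJ; rewrite dzeta_notin // scalerA -expr2 sqrr_sign scale1r.
Qed.

Lemma monom_mul0 j f l L : monom_mul j finset.set0 f l L = f (l - j) L.
Proof. by rewrite /monom_mul finset.sub0set finset.setD0 inversions_set0l scale1r. Qed.

(** The Leibniz rule for the odd derivation [d/dzeta^i]. *)
Lemma dzeta_monom i j I f l L :
  dzeta i (monom_mul j I f) l L =
  (if i \in I then (-1) ^+ inversions [set i]%SET (I :\ i)%SET *: monom_mul j (I :\ i)%SET f l L
   else 0) + (-1) ^+ #|I| *: monom_mul j I (dzeta i f) l L.
Proof.
have [iL|iL] := boolP (i \in L).
  rewrite dzeta_in //; have [iI|iI] := boolP (i \in I); last first.
    rewrite add0r /monom_mul; case: ifP => _; last by rewrite scaler0.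
    by rewrite dzeta_in ?scaler0 // inE iI.
  have I'L : (I :\ i \subset L)%SET = (I \subset L).
    by rewrite -{2}(finset.setD1K iI) finset.subUset finset.sub1set iL.
  rewrite /monom_mul I'L; case: ifP => IL; last by rewrite !scaler0 addr0.
  have iM : i \notin (L :\: I)%SET by rewrite inE iI.
  have -> : (L :\: (I :\ i) = i |: L :\: I)%SET.
    by apply/setP => x; rewrite !inE; case: eqVneq => [->|]; rewrite ?iL.
  rewrite dzeta_notin // (inversions_setD1l _ iI) inversions_setU1r //.
  rewrite (cardsD1 i I) iI add1n exprS.
  rewrite -(inversions_swap (i := i) (J := (I :\ i)%SET)) ?finset.setD11 //.
  rewrite !scalerA -scalerDl !exprD.
  set a := (-1) ^+ inversions [set i]%SET (I :\ i)%SET.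
  set b := (-1) ^+ inversions (I :\ i)%SET [set i]%SET.
  set c := (-1) ^+ inversions (I :\ i)%SET _.
  set d := (-1) ^+ inversions [set i]%SET (L :\: I)%SET.
  have dd : d * d = 1 by rewrite -expr2 sqrr_sign.
  rewrite (_ : _ + _ = a * b * c * (1 - d * d)); last by ring.
  by rewrite dd subrr mulr0 scale0r.
rewrite dzeta_notin //; have [iI|iI] := boolP (i \in I).
  have IiL : (I \subset i |: L)%SET = (I :\ i \subset L)%SET.
    by rewrite finset.subDset.
  have IL : I \subset L = false by apply/negbTE/subsetPn; exists i.
  rewrite {1}/monom_mul IiL [X in _ = _ + _ *: X]/monom_mul IL scaler0 addr0 /monom_mul.
  case: ifP => I'L; last by rewrite !scaler0.
  have -> : ((i |: L) :\: I = L :\: (I :\ i))%SET.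
    apply/setP => x; rewrite !inE; case: eqVneq => [->|_] //=.
    by rewrite iI (negPf iL).
  rewrite (inversions_setIDr [set i]%SET L (I :\ i)%SET) (finset.setIidPr I'L).
  rewrite (inversions_setD1l _ iI) !scalerA !exprD.
  set a := (-1) ^+ inversions [set i]%SET (I :\ i)%SET.
  set b := (-1) ^+ inversions [set i]%SET (L :\: _)%SET.
  have bb : b * b = 1 by rewrite -expr2 sqrr_sign.
  by congr (_ *: _); rewrite mulrA -[a * b * b]mulrA bb mulr1.
rewrite add0r /monom_mul.
have -> : (I \subset i |: L)%SET = (I \subset L).
  rewrite -finset.subDset (_ : I :\ i = I)%SET //; apply/setP => x; rewrite !inE.
  by case: eqVneq => [->|]; rewrite ?(negPf iI).
case: ifP => IL; last by rewrite !scaler0.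
have iM : i \notin (L :\: I)%SET by rewrite inE (negPf iL) andbF.
have -> : ((i |: L) :\: I = i |: L :\: I)%SET.
  by apply/setP => x; rewrite !inE; case: eqVneq => [->|]; rewrite ?iI.
rewrite dzeta_notin // (inversions_setU1r _ iM) (inversions_setIDr [set i]%SET L I).
rewrite (finset.setIidPr IL) -(inversions_swap iI) !scalerA !exprD.
by congr (_ *: _); ring.
Qed.

End SeriesCalculus.

(** * The exponential of Z nabla *)

Lemma fsum_nat_trunc (V : zmodType) (g : nat -> V) (M : nat) :
  (forall n, (M <= n)%N -> g n = 0) ->
  \sum_(n \in [set: nat]) g n = \sum_(n < M) g n.
Proof.
move=> hM; rewrite (fsbigE (iota 0 M)) ?iota_uniq //=; last first.
  move=> n _; rewrite mem_iota add0n /= -leqNgt; exact: hM.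
rewrite big_mkcond -[M in iota 0 M]subn0 -/(index_iota 0 M) big_mkord.
by apply: eq_bigr => n _; rewrite in_setT.
Qed.

Lemma weight_step (j n0 : int) (c n : nat) :
  j + c.+1%:Z < n0 + n.+1%:Z -> j + c%:Z < n0 + n%:Z.
Proof. by lia. Qed.

Section ExpZnabla.
Variables (k : fieldType) (N : nat) (V : lmodType k).
Variables (T : V -> V) (S : 'I_N -> V -> V).
Hypothesis k0 : [pchar k] =i pred0.
Hypothesis T_lin : linear T.
Hypothesis S_lin : forall i, linear (S i).
Hypothesis S_anti : forall i j v, S i (S j v) = - S j (S i v).
Hypothesis ST : forall i v, S i (T v) = T (S i v).
Implicit Types (f g : fseries N V) (j : int) (i : 'I_N) (J L : {set 'I_N}).

Local Notation D := (Znabla T S).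
Local Notation Sact i := (op_act true (S i)).

Lemma ZnablaE f j J :
  D f j J = T (f (j - 1) J) +
  \sum_(i < N) (if i \in J then (-1) ^+ inversions [set i]%SET (J :\ i)%SET *:
      ((-1) ^+ #|(J :\ i)%SET| *: S i (f j (J :\ i)%SET)) else 0).
Proof.
rewrite /Znabla monom_mul0 /op_act /= expr0 scale1r; congr (_ + _).
apply: eq_bigr => i _; rewrite /monom_mul finset.sub1set subr0.
by case: ifP => // _; rewrite signr_odd.
Qed.

Lemma Znabla_lin c f g j J :
  D (fun j J => c *: f j J + g j J) j J = c *: D f j J + D g j J.
Proof.
rewrite !ZnablaE T_lin scalerDr scaler_sumr addrACA -big_split; congr (_ + _).
apply: eq_bigr => i _ /=; case: ifP => _; last by rewrite scaler0 addr0.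
by rewrite (S_lin i); linear_ring.
Qed.

Lemma iter_Znabla_lin n c f g j J :
  iter n D (fun j J => c *: f j J + g j J) j J = c *: iter n D f j J + iter n D g j J.
Proof.
elim: n j J => // n IH j J; rewrite !iterS -Znabla_lin.
by congr (D _ j J); apply: series_ext => j' J'; apply: IH.
Qed.

(** Each factor of [D^n] raises either the exponent of [z] or the number of odd
    variables. *)
Lemma iter_Znabla_bound (n0 : int) n f j J :
  (forall l L, l < n0 -> f l L = 0) -> j + #|J|%:Z < n0 + n%:Z -> iter n D f j J = 0.
Proof.
move=> f0; elim: n j J => [|n IH] j J lt.
  by rewrite /= f0 //; move: lt; clear; lia.
rewrite iterS ZnablaE IH ?(lin0 T_lin) ?add0r; last by move: lt; clear; lia.
apply: big1 => i _; case: ifP => // iJ.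
rewrite IH ?(lin0 (S_lin i)) ?scaler0 //.
by apply: weight_step; move: lt; rewrite (cardsD1 i J) iJ.
Qed.

Lemma exp_ZnablaE (n0 : int) f j J M :
  (forall l L, l < n0 -> f l L = 0) -> j + #|J|%:Z < n0 + M%:Z ->
  exp_Znabla T S f j J = \sum_(n < M) (n`!%:R : k)^-1 *: iter n D f j J.
Proof.
move=> f0 lt; apply: (fsum_nat_trunc (g := fun n => (n`!%:R : k)^-1 *: iter n D f j J)).
move=> n le; rewrite (iter_Znabla_bound f0) ?scaler0 //.
by apply: lt_le_trans lt _; rewrite lerD2l lez_nat.
Qed.

Lemma exp_Znabla_lin (n0 : int) c f g j J :
  (forall l L, l < n0 -> f l L = 0) -> (forall l L, l < n0 -> g l L = 0) ->
  exp_Znabla T S (fun j J => c *: f j J + g j J) j J =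
  c *: exp_Znabla T S f j J + exp_Znabla T S g j J.
Proof.
move=> f0 g0; have [M [lt _]] := large_shift n0 0 (absz (j + #|J|%:Z)).+1 0.
have {}lt : j + #|J|%:Z < n0 + M%:Z by move: lt; clear; lia.
rewrite !(exp_ZnablaE _ lt) // => [|l L ln0]; last by rewrite f0 ?g0 // scaler0 addr0.
rewrite scaler_sumr -big_split; apply: eq_bigr => n _ /=.
by rewrite iter_Znabla_lin; linear_ring.
Qed.

Lemma exp_Znabla_set0 (n0 : int) f j M :
  (forall l L, l < n0 -> f l L = 0) -> j < n0 + M%:Z ->
  exp_Znabla T S f j finset.set0 = \sum_(n < M) dpow T n (f (j - n%:Z) finset.set0).
Proof.
move=> f0 lt; rewrite (exp_ZnablaE (M := M) f0) ?cards0 ?addr0 //.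
apply: eq_bigr => n _; rewrite dpow.unlock; congr (_ *: _).
elim: (n : nat) j {lt} => [|m IH] j; first by rewrite subr0.
rewrite iterS ZnablaE IH big1 ?addr0 => [|i _]; last by rewrite inE.
by rewrite iterS; congr (T (iter m T (f _ _))); clear; lia.
Qed.

Lemma dzeta_act i (l : 'I_N) f j J : dzeta i (Sact l f) j J = - Sact l (dzeta i f) j J.
Proof.
have [iJ|iJ] := boolP (i \in J).
  by rewrite /op_act !dzeta_in // (lin0 (S_lin l)) scaler0 oppr0.
rewrite /op_act !dzeta_notin // !andTb !signr_odd cardsU1 iJ add1n exprS.
by rewrite (linZ (S_lin l)); linear_ring.
Qed.

Lemma dzeta_Znabla i f j J :
  dzeta i (D f) j J = D (dzeta i f) j J + Sact i f j J.
Proof.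
have -> : dzeta i (D f) j J = dzeta i (monom_mul 1 finset.set0 (op_act false T f)) j J +
    \sum_(l < N) dzeta i (monom_mul 0 [set l]%SET (Sact l f)) j J.
  have [iJ|iJ] := boolP (i \in J).
    by rewrite !dzeta_in // add0r big1 // => l _; rewrite dzeta_in.
  rewrite !dzeta_notin // /Znabla scalerDr scaler_sumr; congr (_ + _).
  by apply: eq_bigr => l _; rewrite dzeta_notin.
rewrite dzeta_monom finset.in_set0 add0r cards0 expr0 scale1r.
have -> : dzeta i (op_act false T f) = op_act false T (dzeta i f).
  apply: series_ext => l L; rewrite /op_act /=.
  have [iL|iL] := boolP (i \in L); first by rewrite !dzeta_in // (lin0 T_lin) scaler0.
  by rewrite !dzeta_notin // (linZ T_lin) !expr0 !scale1r.
rewrite /Znabla -addrA; congr (_ + _).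
rewrite (eq_bigr (fun l => (if l == i then Sact i f j J else 0) +
   monom_mul 0 [set l]%SET (Sact l (dzeta i f)) j J)) => [|l _].
  by rewrite big_split -big_mkcond big_pred1_eq addrC.
rewrite dzeta_monom finset.in_set1 cards1 expr1 eq_sym; congr (_ + _).
  case: eqP => // ->; rewrite (_ : ([set i] :\ i)%SET = finset.set0); last first.
    by apply/setP => x; rewrite !inE andNb.
  by rewrite inversions_set0r monom_mul0 subr0 scale1r.
rewrite (_ : dzeta i (Sact l f) = fun j J => -1 *: Sact l (dzeta i f) j J + 0); last first.
  by apply: series_ext => j' J'; rewrite dzeta_act scaleN1r addr0.
by rewrite /monom_mul; case: ifP => _; [linear_ring | rewrite scaler0].
Qed.

Lemma act_Znabla i f j J : Sact i (D f) j J = D (Sact i f) j J.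
Proof.
rewrite {1}/op_act andTb signr_odd !ZnablaE (linD (S_lin i)) (lin_sum (S_lin i)).
rewrite scalerDr scaler_sumr /op_act !andTb; congr (_ + _).
  by rewrite ST (linZ T_lin) signr_odd.
apply: eq_bigr => l _; case: ifP => lJ; last by rewrite (lin0 (S_lin i)) scaler0.
rewrite andTb !(linZ (S_lin _)) S_anti (cardsD1 l J) lJ add1n exprS signr_odd.
by linear_ring.
Qed.

Lemma dzeta_iter i n f j J :
  dzeta i (iter n D f) j J =
  iter n D (dzeta i f) j J + n%:R *: iter n.-1 D (Sact i f) j J.
Proof.
elim: n j J => [|n IH] j J; first by rewrite scale0r addr0.
rewrite iterS dzeta_Znabla.
rewrite (_ : dzeta i (iter n D f) = fun j J =>
  n%:R *: iter n.-1 D (Sact i f) j J + iter n D (dzeta i f) j J); last first.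
  by apply: series_ext => j' J'; rewrite IH addrC.
rewrite Znabla_lin.
have -> : Sact i (iter n D f) j J = iter n D (Sact i f) j J.
  elim: n {IH} j J => // n IH j J; rewrite !iterS act_Znabla.
  by congr (D _ j J); apply: series_ext.
rewrite -iterS addrAC addrC; congr (_ + _).
case: n {IH} => [|n]; first by rewrite scale0r add0r scale1r.
by rewrite -[n.+2%:R]natr1 scalerDl scale1r.
Qed.

(** [d/dzeta^i e^{Z nabla} f = e^{Z nabla} (d/dzeta^i + S^i) f], because the
    commutator [S^i] of [d/dzeta^i] and [Z nabla] commutes with [Z nabla]. *)
Lemma dzeta_exp (n0 : int) i f j J :
  (forall l L, l < n0 -> f l L = 0) ->
  dzeta i (exp_Znabla T S f) j J =
  exp_Znabla T S (fun j J => dzeta i f j J + Sact i f j J) j J.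
Proof.
move=> f0.
have df0 l L : l < n0 -> dzeta i f l L = 0.
  by move=> lt; rewrite /dzeta; case: ifP => // _; rewrite f0 ?scaler0.
have Sf0 l L : l < n0 -> Sact i f l L = 0.
  by move=> lt; rewrite /op_act f0 ?(lin0 (S_lin i)) ?scaler0.
have [M [lt _]] := large_shift n0 0 (absz (j + #|J|%:Z)).+2 0.
have {}lt : j + #|J|%:Z + 1 < n0 + M%:Z by move: lt; clear; lia.
have lt1 : j + #|J|%:Z < n0 + M%:Z by move: lt; clear; lia.
have lt2 : j + #|J|%:Z < n0 + M.+1%:Z by move: lt; clear; lia.
have -> : dzeta i (exp_Znabla T S f) j J =
    \sum_(n < M.+1) (n`!%:R : k)^-1 *: dzeta i (iter n D f) j J.
  have [iJ|iJ] := boolP (i \in J).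
    by rewrite dzeta_in // big1 // => n _; rewrite dzeta_in // scaler0.
  rewrite dzeta_notin // (exp_ZnablaE (M := M.+1) f0); last first.
    by rewrite cardsU1 iJ add1n; move: lt; clear; lia.
  rewrite scaler_sumr; apply: eq_bigr => n _.
  by rewrite dzeta_notin // !scalerA mulrC.
rewrite (_ : (fun j J => _) = fun j J => 1 *: dzeta i f j J + Sact i f j J); last first.
  by apply: series_ext => j' J'; rewrite scale1r.
rewrite (exp_Znabla_lin _ _ _ df0 Sf0) scale1r (exp_ZnablaE df0 lt2) (exp_ZnablaE Sf0 lt1).
rewrite (eq_bigr (fun n : 'I_M.+1 => (n`!%:R : k)^-1 *: iter n D (dzeta i f) j J +
   (n`!%:R : k)^-1 *: (n%:R *: iter n.-1 D (Sact i f) j J))) => [|n _]; last first.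
  by rewrite dzeta_iter scalerDr.
rewrite big_split /=; congr (_ + _).
rewrite big_ord_recl scale0r scaler0 add0r; apply: eq_bigr => n _.
rewrite !lift0 scalerA factS natrM invfM mulrAC mulVf ?mul1r //.
exact: natS_neq0.
Qed.

End ExpZnabla.

Lemma binz_nat (k : fieldType) (k0 : [pchar k] =i pred0) (m i : nat) :
  binz k m i = 'C(m, i)%:R.
Proof.
elim: m i => [|m IH] [|i]; rewrite ?bin0 ?bin0n //.
  by rewrite binz_small.
by rewrite -addn1 PoszD (binz_pascal k0) !IH addn1 binS natrD.
Qed.

Lemma oddmono_commute (k : fieldType) (N : nat) (V : lmodType k)
    (S : 'I_N -> V -> V) (f : V -> V) J a :
  (forall i v, S i (f v) = f (S i v)) -> oddmono S J (f a) = f (oddmono S J a).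
Proof.
move=> Sf; rewrite /oddmono; elim: (enum _) a => //= i s IH a.
by case: (i \in J); rewrite ?Sf IH.
Qed.

Lemma exp_opp_ZnablaE (k : fieldType) (N : nat) (V : lmodType k) (T : V -> V)
    (S : 'I_N -> V -> V) (f : fseries N V) :
  exp_opp_Znabla T S f = exp_Znabla (fun v => - T v) (fun i v => - S i v) f.
Proof.
rewrite /exp_opp_Znabla /exp_Znabla; congr (exp_op _ f).
apply: funext => s; apply: series_ext => j J.
rewrite !ZnablaE opprD -sumrN; congr (_ + _); apply: eq_bigr => i _.
by case: ifP => _; rewrite ?oppr0 // !scalerN.
Qed.

Lemma dpowN (k : fieldType) (V : lmodType k) (T : V -> V) n v : linear T ->
  dpow (fun v => - T v) n v = (-1) ^+ n *: dpow T n v.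
Proof.
move=> T_lin; rewrite dpow.unlock scalerA mulrC -scalerA; congr (_ *: _).
elim: n => [|n IH]; first by rewrite scale1r.
by rewrite !iterS IH (linZ T_lin) exprS mulN1r scaleNr.
Qed.

(** * From vertex Poisson superalgebras with odd derivations to SUSY ones *)

Section SusyVPA.
Variables (k : fieldType) (N : nat) (V : lmodType k) (par : bool -> set V).
Variables (vac : V) (T : V -> V) (S : 'I_N -> V -> V) (mul : V -> V -> V).
Variable br : V -> int -> V -> V.
Hypothesis k0 : [pchar k] =i pred0.
Hypothesis H : mode_vpa par vac T S mul br.
Implicit Types (a b c v : V) (p q : bool) (i : 'I_N) (I J L : {set 'I_N}) (j l : int).

Let T_lin := mp_T_lin H.
Let S_lin := mp_S_lin H.
Let S_anti := mp_SS H.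
Let ST := mp_ST H.
Let mul_linl := mp_mul_linl H.
Let mul_linr := mp_mul_linr H.
Let br_linl := mp_br_linl H.
Let br_linr := mp_br_linr H.
Let odd_lin J := oddmono_lin S_lin J.

(** The coefficients of [(e^{zT} (1 + zeta^1 S^1) ... (1 + zeta^N S^N) a) . b]. *)
Definition vpa_Yp (a : V) : fseries N (V -> V) := fun j J =>
  if j is Posz n then mul (dpow T n (oddmono S J a)) else fun _ => 0.

Definition vpa_Ym (a : V) : fseries N (V -> V) := fun j J =>
  br (oddmono S J a) (-1 - j).

Let dpow_par p n a : par p a -> par p (dpow T n a).
Proof.
move=> pa; rewrite dpow.unlock; apply: subspaceZ; first exact: super_sub (mp_super H) p.
by elim: n => // n IH; exact: (mp_T_par H IH).
Qed.

Let odd_par J p a : par p a -> par (p (+) odd #|J|) (oddmono S J a).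
Proof. exact: (oddmono_par (mp_S_par H)). Qed.

Let S_dpow i n v : S i (dpow T n v) = dpow T n (S i v).
Proof.
rewrite dpow.unlock (linZ (S_lin i)); congr (_ *: _).
by elim: n => // n IH; rewrite !iterS ST IH.
Qed.

Let S_oddU J i a : i \notin J -> oddmono S (i |: J)%SET a =
  ((-1) ^+ inversions [set i]%SET J * (-1) ^+ #|J|) *: S i (oddmono S J a).
Proof. exact: oddmonoUl. Qed.

Let S_odd_in J i a : i \in J -> S i (oddmono S J a) = 0.
Proof. by move=> iJ; apply: oddmono_in_l. Qed.

Lemma mp_mulr1 a : mul a vac = a.
Proof.
move: a; apply: (par_ind (mp_super H)) => [a b ha hb|p a pa].
  by rewrite (linD (mul_linl _)) ha hb.
by rewrite (mp_mulC H pa (mp_vac_par H)) andbF scale1r (mp_mul1 H).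
Qed.

Lemma mp_T_vac : T vac = 0.
Proof.
have := mp_T_mul H vac vac; rewrite (mp_mul1 H) mp_mulr1 (mp_mul1 H) => /eqP.
by rewrite -subr_eq0 opprD addrA subrr sub0r oppr_eq0 => /eqP.
Qed.

Lemma mp_S_vac i : S i vac = 0.
Proof.
have := mp_S_mul H i vac (mp_vac_par H); rewrite (mp_mul1 H) mp_mulr1 (mp_mul1 H) scale1r => /eqP.
by rewrite -subr_eq0 opprD addrA subrr sub0r oppr_eq0 => /eqP.
Qed.

Lemma mp_mulCA a p b q v : par p a -> par q b ->
  mul a (mul b v) = (-1) ^+ (p && q) *: mul b (mul a v).
Proof.
by move=> pa qb; rewrite -!(mp_mulA H) (mp_mulC H pa qb) (linZ (mul_linl v)).
Qed.

(** ** The commutative vertex algebra *)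

Lemma vpa_Yp_par p a j J : par p a -> pure_op par (p (+) odd #|J|) (vpa_Yp a j J).
Proof.
case: j => n pa q v qv /=; last exact: subspace0 (super_sub (mp_super H) _).
by apply: (mp_mul_par H) => //; apply/dpow_par/odd_par.
Qed.

Lemma vpa_Yp_comm : susy_comm par vpa_Yp.
Proof.
move=> p a q b pa qb v; apply: series_ext => j J; apply: series_ext => l L.
rewrite /field_comm /op_comm /op_act /fapp /vpa_Yp.
have zr x : mul x 0 = 0 by exact: lin0 (mul_linr x).
case: j => [n|n]; last first.
  by case: l => m /=; rewrite ?zr !scaler0 subrr.
case: l => [m|m] /=; last by rewrite zr !scaler0 subrr.
have pA := dpow_par n (odd_par J pa); have qB := dpow_par m (odd_par L qb).
rewrite (mp_mulCA v pA qB) scalerA -scalerBl.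
suff -> : (-1) ^+ ((p (+) odd #|J|) && odd #|L|) *
   (-1) ^+ ((p (+) odd #|J|) && (q (+) odd #|L|)) - (-1) ^+ ((p (+) odd #|J|) && q) = 0 :> k.
  by rewrite scale0r.
by case: (p (+) odd #|J|); case: (odd #|L|); case: q {qb qB} => /=; ring.
Qed.

Lemma vpa_Yp_va : susy_va par vac T S vpa_Yp.
Proof.
split.
- exact: mp_super H.
- exact: mp_vac_par H.
- exact: T_lin.
- exact: mp_T_par H.
- exact: S_lin.
- exact: mp_S_par H.
- move=> c a b [n|n] J v /=; last by rewrite scaler0 addr0.
  by rewrite (odd_lin J) (dpow_lin T_lin n) (mul_linl v).
- by move=> a [n|n] J c u v /=; [exact: mul_linr | rewrite scaler0 addr0].
- by move=> p a pa j J; apply: vpa_Yp_par.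
- by move=> a v; exists 0 => -[n|n] J.
- move=> a; split; first by case.
  by rewrite /= oddmono0 dpow0 mp_mulr1.
- exact: mp_T_vac.
- exact: mp_S_vac.
- move=> p a pa v; apply: series_ext => j J; rewrite /op_comm /op_act /fapp /dz /= !scale1r.
  case: j => [n|n].
    rewrite /vpa_Yp (_ : n%:Z + 1 = n.+1); last by clear; lia.
    rewrite (mp_T_mul H) addrK -(linZ (mul_linl v)).
    by rewrite -(dpowS k0 T_lin).
  rewrite /= (lin0 T_lin) subr0; case: n => [|n]; first by rewrite scale0r.
  by rewrite (_ : Negz n.+1 + 1 = Negz n) ?scaler0 //; clear; lia.
- move=> p a pa i v; apply: series_ext => -[n|n] J; last first.
    rewrite /op_comm /op_act /fapp /dzeta /= (lin0 (S_lin i)) !scaler0 subr0.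
    by case: ifP => // _; rewrite scaler0.
  rewrite /op_comm /op_act /fapp /= signr_odd.
  have pA := dpow_par n (odd_par J pa).
  have -> : (-1) ^+ #|J| *: S i (mul (dpow T n (oddmono S J a)) v) -
      (-1) ^+ p *: mul (dpow T n (oddmono S J a)) (S i v) =
      (-1) ^+ #|J| *: mul (dpow T n (S i (oddmono S J a))) v.
    rewrite (mp_S_mul H _ _ pA) S_dpow -signr_odd.
    by case: (odd #|J|); case: (p) => /=; linear_ring.
  have [iJ|iJ] := boolP (i \in J).
    by rewrite dzeta_in // S_odd_in // (lin0 (dpow_lin T_lin n)) (lin0 (mul_linl v)) scaler0.
  rewrite dzeta_notin // /fapp /= S_oddU // (linZ (dpow_lin T_lin n)) (linZ (mul_linl v)).
  by rewrite scalerA mulrA -expr2 sqrr_sign mul1r.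
- move=> p a q b pa qb; exists 0%N => v /=; exact: vpa_Yp_comm.
Qed.

Lemma vpa_prod a b : susy_prod vpa_Yp a b = mul a b.
Proof.
rewrite /susy_prod /mode finset.setCT subrr.
by rewrite -[LHS]/(mul (dpow T 0 (oddmono S finset.set0 a)) b) oddmono0 dpow0.
Qed.

(** ** The vertex Lie algebra *)

Lemma vpa_Ym_nonneg a j J v : 0 <= j -> vpa_Ym a j J v = 0.
Proof. by move=> j0; apply: (mp_br_neg H); move: j0; clear; lia. Qed.

Lemma vpa_Ym_linl j J v : linear (fun a => vpa_Ym a j J v).
Proof. by move=> c a b; rewrite /vpa_Ym (odd_lin J) (br_linl _ v). Qed.

Lemma vpa_Ym_laurent a v : laurent (fapp (vpa_Ym a) v).
Proof.
have [M hM] : exists M : {set 'I_N} -> nat, forall J (n : int), (M J)%:Z <= n ->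
    br (oddmono S J a) n v = 0.
  by have [M hM] := choice (fun J => mp_br_trunc H (oddmono S J a) v); exists M.
exists (- (\max_J M J)%N%:Z - 1) => j J lt; apply: (hM J).
have : (M J <= \max_J M J)%N by apply: leq_bigmax.
by move: lt; clear; lia.
Qed.

Lemma vpa_Ym_S i a v : fapp (vpa_Ym (S i a)) v = dzeta i (fapp (vpa_Ym a) v).
Proof.
apply: series_ext => j J; have [iJ|iJ] := boolP (i \in J).
  by rewrite dzeta_in // /fapp /vpa_Ym (oddmono_in S_lin S_anti k0) // (lin0 (br_linl _ v)).
rewrite dzeta_notin // /fapp /vpa_Ym (oddmonoU S_lin S_anti) // (linZ (br_linl _ v)).
by rewrite scalerA -expr2 sqrr_sign scale1r.
Qed.

Lemma vpa_Ym_U i a j J v : i \notin J ->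
  vpa_Ym a j (i |: J)%SET v = (-1) ^+ inversions [set i]%SET J *: vpa_Ym (S i a) j J v.
Proof.
move=> iJ; rewrite -[vpa_Ym a _ _ _]/(fapp (vpa_Ym a) v j (i |: J)%SET).
by rewrite (coef_dzeta _ _ iJ) -vpa_Ym_S.
Qed.

Lemma vpa_Ym_par p a j J : par p a -> pure_op par (p (+) odd #|J|) (vpa_Ym a j J).
Proof. by move=> pa q v qv; apply: (mp_br_par H) => //; apply: odd_par. Qed.

Let set_ind (P : {set 'I_N} -> Prop) :
  P finset.set0 -> (forall i J, i \notin J -> P J -> P (i |: J)%SET) -> forall J, P J.
Proof.
move=> P0 PU J; move e: #|J| => n; elim: n J e => [|n IH] J cJ.
  by rewrite (cards0_eq cJ).
have /card_gt0P[i iJ] : (0 < #|J|)%N by rewrite cJ.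
rewrite -(finset.setD1K iJ); apply: PU; first by rewrite finset.setD11.
by apply: IH; move: cJ; rewrite (finset.cardsD1 i) iJ => -[].
Qed.

(** [(d/dzeta^i + S^i) (Y(b, -Z) a) = (-1)^q Y(b, -Z) S^i a].  As [S^i] is a
    derivation of the brackets, [S^i Y(b, -Z) a] has a term with [S^i b]; it
    cancels the derivative, since [Y(S^i b, Z) = d/dzeta^i Y(b, Z)]. *)
Lemma vpa_skew_step i q a b : par q b ->
  (fun j J => dzeta i (subst_opp (fapp (vpa_Ym b) a)) j J +
     op_act true (S i) (subst_opp (fapp (vpa_Ym b) a)) j J) =
  (fun j J => (-1) ^+ q *: subst_opp (fapp (vpa_Ym b) (S i a)) j J + 0).
Proof.
move=> qb; apply: series_ext => j J; rewrite addr0 /op_act /subst_opp /fapp andTb.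
rewrite (linZ (S_lin i)) /vpa_Ym (mp_S_br H _ _ _ (odd_par J qb)).
have [iJ|iJ] := boolP (i \in J).
  rewrite dzeta_in // S_odd_in // (lin0 (br_linl _ _)) !add0r !scalerA; congr (_ *: _).
  by rewrite -[(-1) ^+ #|J|]signr_odd; case: (odd #|J|); case: (q) => /=; ring.
rewrite dzeta_notin // cardsU1 iJ add1n exprS S_oddU // (linZ (br_linl _ _)).
have ss : (-1) ^+ inversions [set i]%SET J * (-1) ^+ inversions [set i]%SET J = 1 :> k.
  by rewrite -expr2 sqrr_sign.
rewrite !scalerA -[(-1) ^+ #|J|]signr_odd.
set s := (-1) ^+ inversions [set i]%SET J in ss *.
have -> : s * ((-1) ^ j * (-1 * (-1) ^+ odd #|J|)) * (s * (-1) ^+ odd #|J|) =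
    - ((-1) ^ j) * (s * s) * ((-1) ^+ odd #|J| * (-1) ^+ odd #|J|) by ring.
by rewrite ss; case: (odd #|J|); case: (q) => /=; linear_ring.
Qed.

(** Induction on the number of odd variables: by [dzeta_exp] and [vpa_skew_step],
    [d/dzeta^i] turns either side into the same expression with [S^i a] for
    [a].  At [zeta = 0] it is the skew-symmetry of the brackets. *)
Lemma vpa_skew p a q b : par p a -> par q b ->
  fapp (vpa_Ym a) b =
  sing (fun j J => (-1) ^+ (p && q) *:
                   exp_Znabla T S (subst_opp (fapp (vpa_Ym b) a)) j J).
Proof.
move=> pa qb; apply: series_ext => j J; rewrite /sing; case: ltrP => [|j0]; last first.
  exact: vpa_Ym_nonneg.
case: j => // m _; rewrite {1}/fapp.
elim/set_ind: J p a pa => [|i J iJ IH] p a pa.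
  rewrite /vpa_Ym oddmono0.
  have [n0 hn0] := vpa_Ym_laurent b a.
  have [L0 hL0] := mp_skew H m pa qb.
  have sub0 l L : l < n0 -> subst_opp (fapp (vpa_Ym b) a) l L = 0.
    by move=> lt; rewrite /subst_opp hn0 ?scaler0.
  have [M [lt _]] := large_shift n0 0 (L0 + m) 0.
  have lt1 : Negz m < n0 + (M + L0)%N%:Z by move: lt; clear; lia.
  rewrite (exp_Znabla_set0 T_lin S_lin sub0 lt1) (_ : -1 - Negz m = m); last by clear; lia.
  rewrite (hL0 (M + L0)%N (leq_addl _ _)); congr (_ *: _); apply: eq_bigr => s _.
  rewrite -(linZ (dpow_lin T_lin s)) /subst_opp cards0 mulr1 /fapp /vpa_Ym oddmono0.
  rewrite (_ : -1 - (Negz m - s%:Z) = m%:Z + s%:Z); last by clear; lia.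
  rewrite (_ : Negz m - s%:Z = - (m%:Z + s%:Z + 1)); last by clear; lia.
  by rewrite signzN.
have pSa : par (true (+) p) (S i a) by apply: (mp_S_par H).
have [n0 hn0] := vpa_Ym_laurent b a; have [n1 hn1] := vpa_Ym_laurent b (S i a).
have sub0 l L : l < n0 -> subst_opp (fapp (vpa_Ym b) a) l L = 0.
  by move=> lt; rewrite /subst_opp hn0 ?scaler0.
have sub1 l L : l < n1 -> subst_opp (fapp (vpa_Ym b) (S i a)) l L = 0.
  by move=> lt; rewrite /subst_opp hn1 ?scaler0.
rewrite vpa_Ym_U // (IH _ _ pSa) (coef_dzeta _ _ iJ).
rewrite (dzeta_exp k0 T_lin S_lin S_anti ST _ _ _ sub0) (vpa_skew_step _ _ qb).
rewrite (exp_Znabla_lin T_lin S_lin (g := fun _ _ => 0) _ _ _ sub1) //.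
have -> : exp_Znabla T S (fun _ _ => 0) (Negz m) J = 0.
  rewrite (exp_ZnablaE T_lin S_lin (n0 := Negz m) (M := #|J|.+1)) //; last by clear; lia.
  rewrite big1 // => n _.
  rewrite (iter_Znabla_bound T_lin S_lin (n0 := Negz m + #|J|%:Z + 1)) ?scaler0 //.
  by clear; lia.
by case: (p); case: (q) => /=; linear_ring.
Qed.

Lemma exp_const b j J :
  exp_Znabla T S (const_series b) j J =
  if j is Posz n then dpow T n (oddmono S J b) else 0.
Proof.
have c0 u l L : l < 0 -> (const_series u : fseries N V) l L = 0.
  by move=> l0; rewrite /const_series lt_eqF.
elim/set_ind: J b => [|i J iJ IH] b.
  have [M [lt _]] := large_shift 0 0 (absz j).+1 0.
  have {}lt : j < 0 + M%:Z by move: lt; clear; lia.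
  rewrite (exp_Znabla_set0 T_lin S_lin (c0 b) lt).
  have const0 (n : nat) : j != n%:Z ->
      dpow T n (const_series b (j - n%:Z) (finset.set0 : {set 'I_N})) = 0.
    by move=> jn; rewrite /const_series subr_eq0 (negPf jn) (lin0 (dpow_lin T_lin n)).
  case: j lt const0 => j lt const0; last by rewrite big1 // => n _; apply: const0.
  have jM : (j < M)%N by move: lt; clear; lia.
  rewrite (bigD1 (Ordinal jM)) //= {1}/const_series subrr !eqxx oddmono0.
  rewrite big1 ?addr0 // => n; rewrite -val_eqE eq_sym /= => nj.
  by apply: const0; rewrite eqz_nat.
rewrite (coef_dzeta _ _ iJ) (dzeta_exp k0 T_lin S_lin S_anti ST _ _ _ (c0 b)).
have -> : (fun j J => dzeta i (const_series b) j J + op_act true (S i) (const_series b) j J) =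
    const_series (S i b).
  apply: series_ext => l L; rewrite /op_act /const_series /=.
  have -> : dzeta i (const_series b : fseries N V) l L = 0.
    rewrite /dzeta; case: ifP => // _; rewrite /const_series andbC.
    case: eqP => [e|_]; last by rewrite scaler0.
    by have := setU11 i L; rewrite e inE.
  rewrite add0r; case: eqP => _ /=; last by rewrite (lin0 (S_lin i)) scaler0.
  by case: eqP => [->|_]; rewrite ?cards0 ?scale1r // (lin0 (S_lin i)) scaler0.
rewrite IH; case: j {IH} => // n; last by rewrite scaler0.
by rewrite (oddmonoU S_lin S_anti) // (linZ (dpow_lin T_lin n)).
Qed.

Lemma exp_Znabla0 (T' : V -> V) (S' : 'I_N -> V -> V) j J :
  linear T' -> (forall i, linear (S' i)) -> exp_Znabla T' S' (fun _ _ => 0) j J = 0.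
Proof.
move=> T'_lin S'_lin; rewrite (exp_ZnablaE T'_lin S'_lin (n0 := j) (M := #|J|.+1)) //; last first.
  by clear; lia.
rewrite big1 // => n _.
rewrite (iter_Znabla_bound T'_lin S'_lin (n0 := j + #|J|%:Z + 1)) ?scaler0 //.
by clear; lia.
Qed.

Section Conjugate.
Variables (m : nat).

Let conj_arg p a b : fseries N V :=
  op_act p (br a m) (exp_Znabla T S (const_series b)).

Let conj_argE p a b (n : nat) J :
  conj_arg p a b n J =
  (-1) ^+ (p && odd #|J|) *: br a m (dpow T n (oddmono S J b)).
Proof. by rewrite /conj_arg /op_act exp_const. Qed.

Let conj_arg_neg p a b l L : l < 0 -> conj_arg p a b l L = 0.
Proof.
by case: l => // n _; rewrite /conj_arg /op_act exp_const (lin0 (br_linr a m)) scaler0.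
Qed.

(** [(d/dzeta^i - S^i) (A e^{Z nabla} b) = - [S^i, A] e^{Z nabla} b] for
    [A = a_(m)] *)
Let conj_step p i a b : par p a ->
  (fun j J => dzeta i (conj_arg p a b) j J +
     op_act true (fun v => - S i v) (conj_arg p a b) j J) =
  (fun j J => -1 *: conj_arg (true (+) p) (S i a) b j J + 0).
Proof.
move=> pa; apply: series_ext => -[n|n] J; last first.
  rewrite /op_act !conj_arg_neg // (lin0 (S_lin i)) oppr0 !scaler0 !addr0.
  by rewrite /dzeta; case: ifP; rewrite ?conj_arg_neg ?scaler0.
rewrite addr0 /op_act andTb !conj_argE (linZ (S_lin i)) (mp_S_br H _ _ _ pa).
rewrite S_dpow.
have [iJ|iJ] := boolP (i \in J).
  rewrite dzeta_in // S_odd_in // (lin0 (dpow_lin T_lin n)) (lin0 (br_linr a m)).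
  rewrite scaler0 addr0 add0r; move: (br (S i a) m _) => u.
  by case: (odd #|J|); case: (p) => /=; linear_ring.
rewrite dzeta_notin // conj_argE cardsU1 iJ add1n /= S_oddU //.
rewrite (linZ (dpow_lin T_lin n)) (linZ (br_linr a m)).
have ss : (-1) ^+ inversions [set i]%SET J * (-1) ^+ inversions [set i]%SET J = 1 :> k.
  by rewrite -expr2 sqrr_sign.
set s := (-1) ^+ inversions [set i]%SET J in ss *.
rewrite !scalerA -[(-1) ^+ #|J|]signr_odd.
have -> : s * (-1) ^+ (p && ~~ odd #|J|) * (s * (-1) ^+ odd #|J|) =
  (s * s) * ((-1) ^+ (p && ~~ odd #|J|) * (-1) ^+ odd #|J|) by ring.
rewrite ss; move: (br (S i a) m _) (br a m _) => u w.
by case: (odd #|J|); case: (p) => /=; linear_ring.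
Qed.

(** Induction on the number of odd variables: by [conj_step], [d/dzeta^i] of
    [e^{-Z nabla} a_(m) e^{Z nabla} b] is the opposite of the same expression with
    [S^i a] for [a].  At [zeta = 0] the formula is [dpow_conj]. *)
Lemma conj_coef p a b j J : par p a ->
  conj_Znabla T S p (br a m) b j J =
  if j is Posz n then ((-1) ^+ #|J| * binz k m n) *: br (oddmono S J a) (m%:Z - n%:Z) b else 0.
Proof.
move=> pa; rewrite /conj_Znabla exp_opp_ZnablaE -/(conj_arg p a b).
pose T' v := - T v; pose S' i v := - S i v; rewrite -/T' -/S'.
have T'_lin : linear T' by move=> c u v; rewrite /T' T_lin; linear_ring.
have S'_lin i : linear (S' i) by move=> c u v; rewrite /S' S_lin; linear_ring.
have S'_anti i i' v : S' i (S' i' v) = - S' i' (S' i v).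
  by rewrite /S' !(linN (S_lin _)) !opprK S_anti.
have ST' i v : S' i (T' v) = T' (S' i v).
  by rewrite /S' /T' (linN (S_lin _)) (linN T_lin) ST.
have arg0 q a' l L : l < 0 -> conj_arg q a' b l L = 0 by exact: conj_arg_neg.
elim/set_ind: J p a pa => [|i J iJ IH] p a pa.
  case: j => t.
    have lt : t%:Z < 0 + t.+1%:Z by clear; lia.
    rewrite (exp_Znabla_set0 T'_lin S'_lin (@arg0 p a) lt) cards0 mul1r oddmono0.
    rewrite -(dpow_conj k0 T_lin (br_linr a) (fun n v => mp_T_br H a n v)).
    apply: eq_bigr => n _; have nt : (n <= t)%N by rewrite -ltnS.
    by rewrite subzn // conj_argE cards0 andbF scale1r oddmono0 (dpowN _ _ T_lin).
  have lt : Negz t < 0 + 0%N%:Z by [].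
  by rewrite (exp_Znabla_set0 T'_lin S'_lin (@arg0 p a) lt) big_ord0.
rewrite (coef_dzeta _ _ iJ) (dzeta_exp k0 T'_lin S'_lin S'_anti ST' _ _ _ (@arg0 p a)).
rewrite (conj_step _ _ pa) (exp_Znabla_lin T'_lin S'_lin (g := fun _ _ => 0) _ _ _ (@arg0 _ _)) //.
have pSa : par (true (+) p) (S i a) by apply: (mp_S_par H).
rewrite (exp_Znabla0 _ _ T'_lin S'_lin) addr0 (IH _ _ pSa).
case: j {IH} => [n|n]; last by rewrite !scaler0.
rewrite cardsU1 iJ add1n exprS (oddmonoU S_lin S_anti) // (linZ (br_linl _ b)).
by linear_ring.
Qed.

End Conjugate.

(** ** The Jacobi identity *)

Lemma subst_term0 (x : fseries N V) v l L j :
  (forall I, x j I = 0) -> subst_term vpa_Ym x v l L j = 0.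
Proof.
move=> x0; apply: big1 => I _; rewrite /monom_mul x0 /fapp.
by case: ifP => // _; rewrite (lin0 (vpa_Ym_linl _ _ v)) scaler0.
Qed.

Lemma subst_termZ (c : k) (x : fseries N V) v l L j :
  subst_term vpa_Ym (fun j J => c *: x j J) v l L j = c *: subst_term vpa_Ym x v l L j.
Proof.
rewrite /subst_term scaler_sumr; apply: eq_bigr => I _; rewrite /monom_mul /fapp.
by case: ifP => _; rewrite ?scaler0 // (linZ (vpa_Ym_linl _ _ v)) !scalerA mulrC.
Qed.

(** The chain rule [d/dzeta^i Y(x(Z), Z) = Y((d/dzeta^i + S^i) x(Z), Z)], where
    the second term comes from [d/dzeta^i Y(u, Z) = Y(S^i u, Z)]. *)
Lemma subst_term_U i (x : fseries N V) v l L j : i \notin L ->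
  subst_term vpa_Ym x v l (i |: L)%SET j =
  (-1) ^+ inversions [set i]%SET L *:
  subst_term vpa_Ym (fun j J => dzeta i x j J + op_act true (S i) x j J) v l L j.
Proof.
move=> iL; pose f (u : V) := fapp (vpa_Ym u) v.
rewrite /subst_term (eq_bigr (fun I : {set 'I_N} => (-1) ^+ inversions [set i]%SET L *:
    dzeta i (monom_mul j I (f (x j I))) l L)) => [|I _]; last exact: coef_dzeta.
rewrite -scaler_sumr; congr (_ *: _).
rewrite (eq_bigr _ (fun I _ => dzeta_monom i j I (f (x j I)) l L)) big_split /=.
have monomD I u w : monom_mul j I (f (u + w)) l L =
    monom_mul j I (f u) l L + monom_mul j I (f w) l L.
  rewrite /monom_mul /f /fapp; case: ifP => _; last by rewrite addr0.
  by rewrite (linD (vpa_Ym_linl _ _ v)) scalerDr.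
have monomZ (e : k) I u : monom_mul j I (f (e *: u)) l L = e *: monom_mul j I (f u) l L.
  rewrite /monom_mul /f /fapp; case: ifP => _; last by rewrite scaler0.
  by rewrite (linZ (vpa_Ym_linl _ _ v)) !scalerA mulrC.
rewrite [RHS](eq_bigr (fun I : {set 'I_N} => monom_mul j I (f (dzeta i x j I)) l L +
   monom_mul j I (f (op_act true (S i) x j I)) l L)) => [|I _]; last exact: monomD.
rewrite big_split /=; congr (_ + _); last first.
  apply: eq_bigr => I _; rewrite /op_act andTb signr_odd monomZ; congr (_ *: _).
  by rewrite /f -vpa_Ym_S.
(* The terms are paired by adding or removing [i]. *)
pose t (I : {set 'I_N}) := if i \in I then (I :\ i)%SET else (i |: I)%SET.
have tK : involutive t.
  move=> I; rewrite /t; case: (boolP (i \in I)) => iI.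
    by rewrite finset.setD11 finset.setD1K.
  by rewrite setU11 finset.setU1K.
rewrite (reindex_inj (inv_inj tK)) /=; apply: eq_bigr => I _.
rewrite /t; have [iI|iI] := boolP (i \in I).
  rewrite finset.setD11 dzeta_in // /monom_mul /f /fapp; case: ifP => // _.
  by rewrite (lin0 (vpa_Ym_linl _ _ v)) scaler0.
by rewrite setU11 finset.setU1K // dzeta_notin // monomZ.
Qed.

Lemma conj_subst_support p a b v (m : nat) l L j : par p a ->
  (m%:Z < j) || (j < 0) -> subst_term vpa_Ym (conj_Znabla T S p (br a m) b) v l L j = 0.
Proof.
move=> pa jm; apply: subst_term0 => I; rewrite conj_coef //.
by case: j jm => // n; rewrite orbF ltz_nat => lt; rewrite binz_small // mulr0 scale0r.
Qed.

Lemma conj_field_subst p a b v (m : nat) l L : par p a ->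
  field_subst vpa_Ym (conj_Znabla T S p (br a m) b) v l L =
  \sum_(n < m.+1) subst_term vpa_Ym (conj_Znabla T S p (br a m) b) v l L n%:Z.
Proof.
move=> pa; rewrite /field_subst (fsbigE [seq n%:Z | n <- iota 0 m.+1]).
- rewrite big_map -[X in iota 0 X]subn0 -/(index_iota 0 m.+1) big_mkord.
  by apply: eq_bigl => n; exact: in_setT.
- by rewrite map_inj_uniq ?iota_uniq // => x y [].
- by [].
move=> j _ jm; apply: conj_subst_support => //.
case: j jm => [n|//] jm; rewrite orbF ltz_nat ltnNge; apply: contra jm => nm.
by rewrite map_f // mem_iota.
Qed.

(** Let [x = e^{-Z nabla} a_(m) e^{Z nabla} b].  As [S^i] is a derivation of the
    brackets, [S^i x] is the sum of a term with [S^i a], which cancels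
    [d/dzeta^i x], and of a term with [S^i b]. *)
Lemma conj_chain p a b (m : nat) i : par p a ->
  (fun j J => dzeta i (conj_Znabla T S p (br a m) b) j J +
     op_act true (S i) (conj_Znabla T S p (br a m) b) j J) =
  (fun j J => (-1) ^+ p *: conj_Znabla T S p (br a m) (S i b) j J).
Proof.
move=> pa; apply: series_ext => j J; rewrite /op_act andTb.
have [iJ|iJ] := boolP (i \in J).
  rewrite dzeta_in // !conj_coef //; case: j => [n|n]; last first.
    by rewrite (lin0 (S_lin i)) !scaler0 addr0.
  rewrite (linZ (S_lin i)) (mp_S_br H _ _ _ (odd_par J pa)) S_odd_in // (lin0 (br_linl _ b)).
  rewrite -[(-1) ^+ #|J|]signr_odd.
  by case: (odd #|J|); case: (p) => /=; linear_ring.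
rewrite dzeta_notin // !conj_coef //; case: j => [n|n]; last first.
  by rewrite (lin0 (S_lin i)) !scaler0 addr0.
rewrite (linZ (S_lin i)) (mp_S_br H _ _ _ (odd_par J pa)) S_oddU // (linZ (br_linl _ b)).
rewrite cardsU1 iJ add1n exprS -[(-1) ^+ #|J|]signr_odd !scalerA.
have ss : (-1) ^+ inversions [set i]%SET J * (-1) ^+ inversions [set i]%SET J = 1 :> k.
  by rewrite -expr2 sqrr_sign.
set s := (-1) ^+ inversions [set i]%SET J in ss *; set e := (-1) ^+ odd #|J|.
have -> : s * (-1 * e * binz k m n) * (s * e) = - (s * s) * (e * e) * binz k m n by ring.
by rewrite ss /e; case: (odd #|J|); case: (p) => /=; linear_ring.
Qed.

(** Induction on the number of odd variables: by the chain rule and [conj_chain],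
    [d/dzeta^i] turns the right-hand side into the same expression with [S^i b]
    for [b], and it does so with the left-hand side because
    [Y(S^i b, Z) = d/dzeta^i Y(b, Z)].  At [zeta = 0] it is the Jacobi identity of
    the brackets, with the sum in the reverse order. *)
Lemma vpa_jacobi p a q b (m : nat) v : par p a -> par q b ->
  op_comm p (br a m) q (vpa_Ym b) v =
  sing (field_subst vpa_Ym (conj_Znabla T S p (br a m) b) v).
Proof.
move=> pa qb; apply: series_ext => l L; rewrite /sing; case: ltrP => [|l0]; last first.
  rewrite /op_comm /op_act /fapp !vpa_Ym_nonneg // (lin0 (br_linr a m)).
  by rewrite !scaler0 subrr.
case: l => // t _; rewrite conj_field_subst //.
elim/set_ind: L q b qb => [|i L iL IH] q b qb.
  rewrite /op_comm /op_act /fapp /vpa_Ym cards0 andbF scale1r oddmono0.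
  rewrite (_ : -1 - Negz t = t); last by clear; lia.
  rewrite (mp_jacobi H m t v pa qb) addrC addKr (reindex_inj rev_ord_inj) /=.
  apply: eq_bigr => n _; have nm : (n <= m)%N by rewrite -ltnS.
  rewrite /subst_term (bigD1 finset.set0) //= big1 ?addr0 => [|I I0]; last first.
    by rewrite /monom_mul finset.subset0 (negPf I0).
  rewrite monom_mul0 conj_coef // cards0 mul1r /fapp /vpa_Ym !oddmono0 (linZ (br_linl _ v)).
  rewrite subSS !binz_nat // bin_sub // subzn //; congr (_ *: br _ _ v).
  by move: nm; clear; lia.
have qSb : par (true (+) q) (S i b) by apply: (mp_S_par H).
rewrite (eq_bigr (fun n : 'I_m.+1 => ((-1) ^+ inversions [set i]%SET L * (-1) ^+ p) *:
   subst_term vpa_Ym (conj_Znabla T S p (br a m) (S i b)) v (Negz t) L n%:Z)); last first.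
  by move=> n _; rewrite subst_term_U // conj_chain // subst_termZ scalerA.
rewrite -scaler_sumr -(IH _ _ qSb) /op_comm /op_act /fapp !vpa_Ym_U //.
rewrite (linZ (br_linr a m)) cardsU1 iL add1n /=.
by case: (odd #|L|); case: (p); case: (q) => /=; linear_ring.
Qed.

Lemma vpa_mode a (m : nat) M : mode (vpa_Ym a) m M = br (oddmono S (~: M)%SET a) m.
Proof.
by rewrite /mode /vpa_Ym; apply: funext => v; congr (br _ _ v); clear; lia.
Qed.

Lemma vpa_Ym_vla : susy_vla par T S vpa_Ym.
Proof.
split.
- exact: mp_super H.
- exact: T_lin.
- exact: mp_T_par H.
- exact: S_lin.
- exact: mp_S_par H.
- by move=> c a b j J v; apply: vpa_Ym_linl.
- by move=> a j J; apply: br_linr.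
- by move=> p a pa j J; apply: vpa_Ym_par.
- move=> a v; split; first exact: vpa_Ym_laurent.
  by move=> j J; apply: vpa_Ym_nonneg.
- move=> a v; apply: series_ext => j J; rewrite /fapp /dz /vpa_Ym.
  rewrite (oddmono_commute J a ST) (mp_br_T H) -mulrNz.
  rewrite (_ : -1 - j - 1 = -1 - (j + 1)); last by ring.
  by rewrite (_ : - (-1 - j) = j + 1) //; ring.
- exact: vpa_Ym_S.
- exact: vpa_skew.
- move=> p a q b pa qb m M v l L; rewrite vpa_mode.
  have pA := odd_par (~: M)%SET pa.
  apply: (@sub_finite_set _ _ [set n%:Z | n in `I_m.+1]); last exact/finite_image/finite_II.
  move=> j /=; case: j => [n|n]; last by rewrite conj_subst_support // eqxx.
  move=> nz; exists n => //=; rewrite ltnS leqNgt; apply: contraNN nz => lt.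
  by rewrite conj_subst_support // ltz_nat lt.
- move=> p a q b pa qb m M v; rewrite vpa_mode.
  by apply: vpa_jacobi => //; apply: odd_par.
Qed.

Theorem mode_vpa_susy : susy_vpa par vac T S vpa_Yp vpa_Ym.
Proof.
split.
- exact: vpa_Yp_va.
- exact: vpa_Yp_comm.
- exact: vpa_Ym_vla.
move=> p a q b r c pa qb rc; apply: series_ext => j K.
rewrite /dual_lmul !vpa_prod /fapp /vpa_Ym (mp_leibniz H _ _ (odd_par K pa) qb).
rewrite scalerA; congr (_ + _ *: _).
have -> : odd #|(~: K)%SET| = odd N (+) odd #|K|.
  have /(congr1 odd) : (#|K| + #|(~: K)%SET|)%N = N by rewrite cardsC card_ord.
  by rewrite oddD => <-; rewrite addbAC addbb addFb.
by case: (odd #|K|); case: (odd N); case: (p); case: (q) => /=; ring.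
Qed.

End SusyVPA.

(** * Classes in gr_E V *)

Section GradedOddMonomials.
Variables (k : fieldType) (N : nat) (V : lmodType k) (par : bool -> set V).
Variables (vac : V) (T : V -> V) (S : 'I_N -> V -> V).
Variable Y : V -> fseries N (V -> V).
Hypothesis k0 : [pchar k] =i pred0.
Hypothesis Hva : susy_va par vac T S Y.

Lemma li_oddmono J n u :
  li_filtration Y n u -> li_filtration Y n (oddmono S J u).
Proof.
rewrite /oddmono; elim: (enum _) u => //= i s IH u Eu; apply: IH.
by case: ifP => // _; apply: (li_S k0 Hva).
Qed.

Lemma gr_oddmono J n u : li_filtration Y n u ->
  oddmono (@gr_S _ _ _ S Y) J (gcl (li_filtration Y) n u) = gcl (li_filtration Y) n (oddmono S J u).
Proof.
rewrite /oddmono; elim: (enum _) u => //= i s IH u Eu.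
case: ifP => _; last exact: IH.
by rewrite (gr_S_gcl k0 Hva) // IH //; apply: (li_S k0 Hva).
Qed.

End GradedOddMonomials.

Theorem theorem3p2p6 (k : fieldType) (N : nat) (V : lmodType k)
    (par : bool -> set V) (vac : V) (T : V -> V) (S : 'I_N -> V -> V)
    (Y : V -> fseries N (V -> V)) :
  [pchar k] =i pred0 -> (0 < N)%N -> susy_va par vac T S Y ->
  let E := li_filtration Y in
  [/\ forall n : int, subsuperspace par (E n),
      forall n : int, n <= 0 -> E n = setT,
      forall n : int, E (n + 1) `<=` E n &
      exists (one : graded E) (d : graded E -> graded E)
             (delta : 'I_N -> graded E -> graded E)
             (Yp Ym : graded E -> fseries N (graded E -> graded E)),
        susy_vpa (graded_par par) one d delta Yp Ym /\
        [/\ forall (r s : nat) (a b : V) (x y : graded E),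
              is_class x r a -> is_class y s b ->
              is_class (susy_prod Yp x y) (r%:Z + s%:Z) (susy_prod Y a b),
            is_class one 0 vac,
            forall (r : nat) (a : V) (x : graded E),
              is_class x r a -> is_class (d x) (r%:Z + 1) (T a),
            forall (i : 'I_N) (r : nat) (a : V) (x : graded E),
              is_class x r a -> is_class (delta i x) r (S i a) &
            forall (r s : nat) (a b : V) (x y : graded E),
              is_class x r a -> is_class y s b ->
              forall (j : nat) (J : {set 'I_N}),
                is_class (mode (Ym x) j J y) (r%:Z + s%:Z - j%:Z)
                         (mode (Y a) j J b)]].
Proof.
move=> k0 _ Hva E; have H := gr_mode_vpa k0 Hva.
have E_le0 := li_le0 k0 Hva.
split.
- exact: (li_super k0 Hva).
- by move=> n n0; apply/seteqP; split=> v // _; apply: E_le0.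
- by move=> n; apply: li_decr; rewrite lerDl.
exists (gr_one vac Y), (@gr_T _ _ _ T Y), (@gr_S _ _ _ S Y).
exists (vpa_Yp (@gr_T _ _ _ T Y) (@gr_S _ _ _ S Y) (@gr_mul _ _ _ Y)).
exists (vpa_Ym (@gr_S _ _ _ S Y) (@gr_br _ _ _ Y)).
split; first exact: (mode_vpa_susy k0 H).
split.
- move=> r s a b x y /is_classE[Ea ->] /is_classE[Eb ->]; apply/is_classE.
  rewrite vpa_prod (gr_mul_gcl k0 Hva) // /susy_prod -pr_mode; split=> //.
  have [h _] := li_mode k0 Hva (-1) Ea Eb.
  by apply: li_le h _; clear; lia.
- by apply/is_classE; split=> //; apply: E_le0.
- move=> r a x /is_classE[Ea ->]; apply/is_classE.
  by rewrite (gr_T_gcl k0 Hva) //; split=> //; apply: (li_T k0 Hva).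
- move=> i r a x /is_classE[Ea ->]; apply/is_classE.
  by rewrite (gr_S_gcl k0 Hva) //; split=> //; apply: (li_S k0 Hva).
move=> r s a b x y /is_classE[Ea ->] /is_classE[Eb ->] j J; apply/is_classE.
rewrite vpa_mode (gr_oddmono k0 Hva) // (mode_pr k0 Hva).
have EKa := li_oddmono k0 Hva (~: J)%SET Ea.
have [_ h] := li_mode k0 Hva j%:Z EKa Eb.
by split; [exact: h | rewrite (gr_br_gcl k0 Hva)].
Qed.
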